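(* Let $f:\mathbb{B}\to\mathbb{B}$ be a (slice) regular function and let $q_0\in\mathbb{B}$. Then for all $q\in\mathbb{B}$ $$|(f(q)-f(q_0))*(1-\overline{f(q_0)}*f(q))^{-*}|\le |(q-q_0)*(1-\bar q_0*q)^{-*}|,\qquad (a)$$ $$|R_{q_0}f(q)*(1-\overline{f(q_0)}*f(q))^{-*}|\le |(1-\bar q_0*q)^{-*}|.\qquad (b)$$ Moreover, $$\left|\partial_c f*(1-\overline{f(q_0)}*f(q))^{-*}\right|_{|_{q_0}}\le \frac{1}{1-|q_0|^2},\qquad (c)$$ $$\frac{|\partial_s f(q_0)|}{|1-f^s(q_0)|}\le\frac{1}{|1-\overline{q_0}^{\,2}|}.\qquad (d)$$ If $f$ is a regular Möbius transformation of $\mathbb{B}$, then equality holds in (a) and (b) for all $q\in\mathbb{B}$, and in (c) and (d). Otherwise, all these inequalities are strict (in (a) and (b): at every $q\in\mathbb{B}$), except for (a) at $q=q_0$, which reduces to $0\le 0$.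
   Context: $\mathbb{H}$ denotes the quaternions, $\mathbb{B}=\{q\in\mathbb{H}: |q|<1\}$, $\partial\mathbb{B}=\{q\in\mathbb{H}:|q|=1\}$, $\mathbb{S}=\{q\in\mathbb{H}: q^2=-1\}$, $L_I=\mathbb{R}+I\mathbb{R}$ for $I\in\mathbb{S}$. A function $f:\Omega\to\mathbb{H}$ on a domain $\Omega\subseteq\mathbb{H}$ is (slice) regular if for every $I\in\mathbb{S}$ its restriction to $\Omega\cap L_I$ is real differentiable and $\frac12\left(\frac{\partial}{\partial x}+I\frac{\partial}{\partial y}\right)f(x+Iy)=0$ there. On a ball $B(0,R)=\{|q|<R\}$ the regular functions are exactly the convergent power series $f(q)=\sum_n q^na_n$, $a_n\in\mathbb{H}$. Regular product: for $f(q)=\sum q^na_n$, $g(q)=\sum q^nb_n$, $f*g(q)=f(q)*g(q)=\sum_n q^n\sum_{k=0}^n a_kb_{n-k}$ (the letter $q$ always denotes the variable and other quaternions are treated as constant functions; so e.g. $\bar q_0*q=q\bar q_0$). Regular conjugate: $f^c(q)=\sum q^n\bar a_n$; symmetrization: $f^s=f*f^c=f^c*f$. For $f\not\equiv0$, the regular reciprocal is $f^{-*}(q)=f^s(q)^{-1}f^c(q)$, and $f^{-*}*g(q)=f^s(q)^{-1}(f^c*g)(q)$, $g*f^{-*}(q)=f^s(q)^{-1}(g*f^c)(q)$, wherever $f^s\ne0$. The functions $1-\bar q_0*q$ and $1-\overline{f(q_0)}*f(q)$ have reciprocals defined and regular on all of $\mathbb{B}$. Differential quotient: $R_{q_0}f(q)=(q-q_0)^{-*}*(f(q)-f(q_0))$,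 i.e. $R_{q_0}f$ is the unique regular function on $\mathbb{B}$ with $f(q)-f(q_0)=(q-q_0)*R_{q_0}f(q)$. Cullen derivative: $\partial_cf(x+Iy)=\frac12\left(\frac{\partial}{\partial x}-I\frac{\partial}{\partial y}\right)f(x+Iy)$, i.e. $\partial_c\left(\sum q^na_n\right)=\sum_{n\ge1} q^{n-1}na_n$; one has $\partial_cf(q_0)=R_{q_0}f(q_0)$. Spherical derivative: $\partial_sf(q_0)=R_{q_0}f(\bar q_0)$, which for nonreal $q_0$ equals $(2\,\mathrm{Im}(q_0))^{-1}(f(q_0)-f(\bar q_0))$. The notation $|\cdot|_{|_{q_0}}$ means the modulus of the value of the function at $q=q_0$. A regular Möbius transformation of $\mathbb{B}$ is a function of the form $q\mapsto(1-q\bar a)^{-*}*(q-a)u=(q-a)*(1-\bar a*q)^{-*}u$ with $a\in\mathbb{B}$, $u\in\partial\mathbb{B}$ (equivalently, a regular fractional transformation mapping $\mathbb{B}$ onto itself). *)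

(* Defs.v *)
From HB Require Import structures.
From mathcomp Require Import all_boot all_order all_algebra.
From mathcomp Require Import ring lra.
From mathcomp Require Import all_classical all_reals all_analysis.

Set Implicit Arguments.
Unset Strict Implicit.
Unset Printing Implicit Defensive.

Import Order.TTheory GRing.Theory Num.Theory.
Import numFieldNormedType.Exports.

Local Open Scope classical_set_scope.
Local Open Scope ring_scope.

Record quat (R : Type) := Quat { qa : R; qb : R; qc : R; qd : R }.

Definition tuple_of_quat (R : Type) (p : quat R) : R * R * R * R :=
  (qa p, qb p, qc p, qd p).
Definition quat_of_tuple (R : Type) (t : R * R * R * R) : quat R :=
  let: (a, b, c, d) := t in Quat a b c d.

Lemma tuple_of_quatK (R : Type) :
  cancel (@tuple_of_quat R) (@quat_of_tuple R).
Proof. by case. Qed.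

HB.instance Definition _ (R : choiceType) :=
  Choice.copy (quat R) (can_type (@tuple_of_quatK R)).

Section Quaternions.
Variable R : realType.
Implicit Types (p q r : quat R) (k l : R).

Definition qadd p q :=
  Quat (qa p + qa q) (qb p + qb q) (qc p + qc q) (qd p + qd q).
Definition qopp p := Quat (- qa p) (- qb p) (- qc p) (- qd p).
Definition qscale k p := Quat (k * qa p) (k * qb p) (k * qc p) (k * qd p).
Definition qmul p q := Quat
  (qa p * qa q - qb p * qb q - qc p * qc q - qd p * qd q)
  (qa p * qb q + qb p * qa q + qc p * qd q - qd p * qc q)
  (qa p * qc q - qb p * qd q + qc p * qa q + qd p * qb q)
  (qa p * qd q + qb p * qc q - qc p * qb q + qd p * qa q).
Definition qconj p := Quat (qa p) (- qb p) (- qc p) (- qd p).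
Definition qnorm2 p := qa p ^+ 2 + qb p ^+ 2 + qc p ^+ 2 + qd p ^+ 2.
Definition qinv p := qscale (qnorm2 p)^-1 (qconj p).

Fact qaddA : associative qadd.
Proof. by move=> [? ? ? ?] [? ? ? ?] [? ? ? ?]; congr Quat; rewrite /= addrA. Qed.
Fact qaddC : commutative qadd.
Proof. by move=> [? ? ? ?] [? ? ? ?]; congr Quat; rewrite /= addrC. Qed.
Fact qadd0 : left_id (Quat 0 0 0 0) qadd.
Proof. by move=> [? ? ? ?]; congr Quat; rewrite /= add0r. Qed.
Fact qaddN : left_inverse (Quat 0 0 0 0) qopp qadd.
Proof. by move=> [? ? ? ?]; congr Quat; rewrite /= addNr. Qed.

HB.instance Definition _ :=
  GRing.isZmodule.Build (quat R) qaddA qaddC qadd0 qaddN.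

Fact qmulA : associative qmul.
Proof. by move=> [? ? ? ?] [? ? ? ?] [? ? ? ?]; congr Quat => /=; ring. Qed.
Fact qmul1 : left_id (Quat 1 0 0 0) qmul.
Proof. by move=> [? ? ? ?]; congr Quat => /=; ring. Qed.
Fact qmulr1 : right_id (Quat 1 0 0 0) qmul.
Proof. by move=> [? ? ? ?]; congr Quat => /=; ring. Qed.
Fact qmulDl : left_distributive qmul +%R.
Proof. by move=> [? ? ? ?] [? ? ? ?] [? ? ? ?]; congr Quat => /=; ring. Qed.
Fact qmulDr : right_distributive qmul +%R.
Proof. by move=> [? ? ? ?] [? ? ? ?] [? ? ? ?]; congr Quat => /=; ring. Qed.
Fact qone_neq0 : Quat 1 0 0 0 != 0 :> quat R.
Proof. by apply/eqP => -[] /eqP; rewrite oner_eq0. Qed.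

HB.instance Definition _ := GRing.Zmodule_isNzRing.Build (quat R)
  qmulA qmul1 qmulr1 qmulDl qmulDr qone_neq0.

Fact qscaleA k l p : qscale k (qscale l p) = qscale (k * l) p.
Proof. by case: p => ? ? ? ?; congr Quat; rewrite /= mulrA. Qed.
Fact qscale1 : left_id 1 qscale.
Proof. by move=> [? ? ? ?]; congr Quat; rewrite /= mul1r. Qed.
Fact qscaleDr : right_distributive qscale +%R.
Proof. by move=> ? [? ? ? ?] [? ? ? ?]; congr Quat; rewrite /= mulrDr. Qed.
Fact qscaleDl p : {morph qscale^~ p : k l / k + l}.
Proof. by case: p => ? ? ? ? ? ?; congr Quat; rewrite /= mulrDl. Qed.

HB.instance Definition _ := GRing.Zmodule_isLmodule.Build R (quat R)
  qscaleA qscale1 qscaleDr qscaleDl.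

Fact qscaleAl k p q : k *: (p * q) = (k *: p) * q.
Proof. by case: p q => [? ? ? ?] [? ? ? ?]; congr Quat => /=; ring. Qed.
HB.instance Definition _ := GRing.Lmodule_isLalgebra.Build R (quat R) qscaleAl.

Fact qscaleAr k p q : k *: (p * q) = p * (k *: q).
Proof. by case: p q => [? ? ? ?] [? ? ? ?]; congr Quat => /=; ring. Qed.
HB.instance Definition _ := GRing.Lalgebra_isAlgebra.Build R (quat R) qscaleAr.

Fact qnorm2_ge0 p : 0 <= qnorm2 p.
Proof. by rewrite /qnorm2 !addr_ge0 ?sqr_ge0. Qed.

Fact qnorm2_eq0 p : qnorm2 p = 0 -> p = 0.
Proof.
case: p => a b c d /eqP; rewrite /qnorm2 /=.
rewrite !paddr_eq0 ?addr_ge0 ?sqr_ge0 // !sqrf_eq0.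
by move=> /andP[/andP[/andP[/eqP-> /eqP->] /eqP->] /eqP->].
Qed.

Fact qmulVq : {in [pred p | p != 0], left_inverse 1 qinv *%R}.
Proof.
move=> p; rewrite inE => p0.
have : qnorm2 p != 0 by apply: contra_neq p0; exact: qnorm2_eq0.
case: p {p0} => a b c d; rewrite /qnorm2 /= => n0.
by congr Quat; rewrite /= /qnorm2 /=; field.
Qed.

Fact qmulqV : {in [pred p | p != 0], right_inverse 1 qinv *%R}.
Proof.
move=> p; rewrite inE => p0.
have : qnorm2 p != 0 by apply: contra_neq p0; exact: qnorm2_eq0.
case: p {p0} => a b c d; rewrite /qnorm2 /= => n0.
by congr Quat; rewrite /= /qnorm2 /=; field.
Qed.

Fact qunitP p q : q * p = 1 /\ p * q = 1 -> p != 0.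
Proof. by move=> [+ _]; apply: contra_eq_neq => ->; rewrite mulr0 eq_sym oner_neq0. Qed.

Fact qinv_out : {in [predC [pred p : quat R | p != 0]], qinv =1 id}.
Proof.
move=> p; rewrite !inE negbK => /eqP ->.
by congr Quat; rewrite /= ?oppr0 mulr0.
Qed.

HB.instance Definition _ := GRing.NzRing_hasMulInverse.Build (quat R)
  qmulVq qmulqV qunitP qinv_out.

Definition qnorm p := Num.sqrt (qnorm2 p).

Fact qnormD p q : qnorm (p + q) <= qnorm p + qnorm q.
Proof.
have nn p' : 0 <= qnorm p' by exact: sqrtr_ge0.
rewrite -(ler_pXn2r (_ : 0 < 2)%N) ?nnegrE ?addr_ge0 //.
rewrite sqrrD !sqr_sqrtr ?qnorm2_ge0 //.
rewrite /qnorm -mulr_natl -sqrtrM ?qnorm2_ge0 //.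
case: p q => [a b c d] [a' b' c' d'] /=; rewrite /qnorm2 /=.
set X := (X in Num.sqrt X).
have XE : X = (a * a' + b * b' + c * c' + d * d') ^+ 2 +
   ((a * b' - b * a') ^+ 2 + (a * c' - c * a') ^+ 2 + (a * d' - d * a') ^+ 2 +
    (b * c' - c * b') ^+ 2 + (b * d' - d * b') ^+ 2 + (c * d' - d * c') ^+ 2).
  by rewrite /X; ring.
have : a * a' + b * b' + c * c' + d * d' <= Num.sqrt X.
  apply: le_trans (ler_norm _) _; rewrite -sqrtr_sqr ler_wsqrtr // XE lerDl.
  by rewrite !addr_ge0 ?sqr_ge0.
by clear; move: (Num.sqrt X) => s h; nra.
Qed.

Fact qnormZ k p : qnorm (k *: p) = `|k| * qnorm p.
Proof.
rewrite /qnorm -sqrtr_sqr -sqrtrM ?sqr_ge0 //; congr Num.sqrt.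
by case: p => ? ? ? ?; rewrite /qnorm2 /=; ring.
Qed.

Fact qnorm_eq0 p : qnorm p = 0 -> p = 0.
Proof.
move=> /eqP; rewrite sqrtr_eq0 => p0; apply: qnorm2_eq0.
by apply/eqP; rewrite eq_le p0 qnorm2_ge0.
Qed.

(* The norm [`|q|], and the topology it induces, is the Euclidean modulus. *)
HB.instance Definition _ :=
  Lmodule_isNormed.Build R (quat R) qnormD qnormZ qnorm_eq0.

End Quaternions.

Section SliceRegular.
Variable R : realType.
Local Notation H := (quat R).
Implicit Types (f g h : H -> H) (a : nat -> H) (p q : H).

Definition unit_ball : set H := [set q | `|q| < 1].

Definition imag_sphere : set H := [set I | I ^+ 2 = -1].

Definition slice (I : H) (z : R * R) : H := z.1%:A + z.2 *: I.

(* Meant for open [D]: differentiability is that of [f \o slice I] on the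
   plane, at the points that [slice I] sends into [D]. *)
Definition slice_regular (D : set H) f :=
  forall I, imag_sphere I -> forall z : R * R, D (slice I z) ->
    differentiable (f \o slice I) z /\
    2^-1 *: ('D_(1, 0) (f \o slice I) z + I * 'D_(0, 1) (f \o slice I) z) = 0.

Definition imag_part q : H := Quat 0 (qb q) (qc q) (qd q).

(* Some [I] with [I ^+ 2 = -1] and [q = slice I (qa q, `|imag_part q|)]; for
   real [q] every [I] qualifies, and the Cullen derivative of a regular
   function does not depend on it. *)
Definition imag_unit q : H :=
  if imag_part q == 0 then Quat 0 1 0 0
  else `|imag_part q|^-1 *: imag_part q.

Definition cullen_derivative f q : H :=
  let I := imag_unit q in
  let z := (qa q, `|imag_part q|) in
  2^-1 *: ('D_(1, 0) (f \o slice I) z - I * 'D_(0, 1) (f \o slice I) z).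

Definition pseries a q : H^nat := series (fun n => q ^+ n * a n).

Definition pseries_sum a q : H := limn (pseries a q).

Definition has_pseries f a :=
  forall q, unit_ball q -> pseries a q @ \oo --> f q.

(* The coefficients of [f] on the unit ball; unspecified if there are none. *)
Definition pseries_coef f : nat -> H := get [set a | has_pseries f a].

(* The operations below only depend on the values of their arguments on the
    unit ball, and are meaningful when these are regular there. *)

Definition reg_mul f g : H -> H := pseries_sum (fun n =>
  \sum_(k < n.+1) pseries_coef f k * pseries_coef g (n - k)%N).

Definition reg_conj f : H -> H :=
  pseries_sum (fun n => qconj (pseries_coef f n)).

Definition reg_symm f : H -> H := reg_mul f (reg_conj f).

Definition reg_recip f : H -> H := fun q => (reg_symm f q)^-1 * reg_conj f q.

(* [(q - q0)^{-*} * (f(q) - f(q0))] is singular at [q0], so it is taken to be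
   the regular [g] with [f(q) - f(q0) = (q - q0) * g(q)]. *)
Definition diff_quotient f q0 : H -> H :=
  get [set g | slice_regular unit_ball g /\
    forall q, unit_ball q ->
      f q - f q0 = reg_mul (fun p => p - q0) g q].

Definition spherical_derivative f q0 : H := diff_quotient f q0 (qconj q0).

Definition regular_moebius f :=
  exists a u : H, [/\ `|a| < 1, `|u| = 1 &
    forall q, unit_ball q ->
      f q = reg_mul (reg_recip (fun p => 1 - p * qconj a))
                    (fun p => (p - a) * u) q].

End SliceRegular.

Notation "f ** g" := (reg_mul f g) (at level 40, left associativity) : ring_scope.

(* Main.v *)
Require Import Defs.
From HB Require Import structures.
From mathcomp Require Import all_boot all_order all_algebra.
From mathcomp Require Import ring lra.
From mathcomp Require Import all_classical all_reals all_analysis.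
Import Defs.

Set Implicit Arguments.
Unset Strict Implicit.
Unset Printing Implicit Defensive.

Import Order.TTheory GRing.Theory Num.Theory.
Import numFieldNormedType.Exports.

Local Open Scope classical_set_scope.
Local Open Scope ring_scope.

(* Regular functions on the ball are identified with power series over the quaternions,
   with a central variable X. As a - a(q) is a multiple of X - q, the value of a product
   a * b at q is the sum of the q^n a(q) b_n, that is a(q) b(a(q)^-1 q a(q)).
   Write w = f(q0), f - w = (X - q0) R, G = (1 - conj(w) f)^-*, r0 = (1 - conj(q0) X)^-*.
   Then g = (f - w) G is bounded by 1 and (1 - conj(q0) X) g = (X - q0) k, where
   k = (1 - conj(q0) X) R G is bounded by 1: on spheres of radius tending to 1 the two
   linear factors have nearly the same modulus. Hence R G = r0 k, and the two sides of
   each inequality differ by the factor |k|, evaluated at some point of the ball. By the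
   maximum modulus principle either k is a constant of modulus 1, which happens exactly
   when f is a regular Moebius transformation, or |k| < 1 everywhere. *)

(** * Modulus and conjugation of quaternions *)

(** Conjugating a point keeps its modulus, so bounds over whole spheres survive products. Pointwise
    equalities need more: either the value of the first factor commutes with the point, or the
    conjugated point is found explicitly. For (c), the derivative and R have the same value at q0,
    and only that value of the first factor matters in a product at q0. For (d), G is read at c^-1
    conj(q0) c with c = R(conj(q0)); on the sphere through q0 the series of f is affine, and this
    turns |G| at that point into the inverse of |1 - f^s(q0)|. Slice regularity asks for
    differentiability only, so the power series expansion rests on Goursat's argument. It is carried
    out with finite sums: Riemann sums at dyadic nodes, and means over the 2^m-th roots of unity
    instead of Cauchy integrals. Such means also give the Cauchy estimates, and these, applied to
    the powers of a series, give the maximum modulus principle. *)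

Section QuaternionNorm.
Variable R : realType.
Local Notation H := (quat R).
Implicit Types (p q u v w : H) (k : R).

Lemma qnormE q : `|q| = Num.sqrt (qnorm2 q). Proof. by []. Qed.

Lemma qnorm_sq q : `|q| ^+ 2 = qnorm2 q.
Proof. by rewrite qnormE sqr_sqrtr // qnorm2_ge0. Qed.

Lemma qnormM p q : `|p * q| = `|p| * `|q|.
Proof.
rewrite !qnormE -sqrtrM ?qnorm2_ge0 //; congr Num.sqrt.
by case: p q => [? ? ? ?] [? ? ? ?]; rewrite /qnorm2 /=; ring.
Qed.

Lemma qnorm1 : `|1 : H| = 1.
Proof.
by rewrite qnormE /qnorm2 /= !expr0n /= !addr0 expr1n sqrtr1.
Qed.

Lemma qnormX q n : `|q ^+ n| = `|q| ^+ n.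
Proof. by elim: n => [|n IH]; rewrite ?expr0 ?qnorm1 // !exprS qnormM IH. Qed.

Lemma qunit q : (q \is a GRing.unit) = (q != 0). Proof. by []. Qed.

Lemma qnormV q : `|q^-1| = `|q|^-1.
Proof.
have [->|q0] := eqVneq q 0; first by rewrite invr0 normr0 invr0.
apply: (mulfI (_ : `|q| != 0)); first by rewrite normr_eq0.
by rewrite -qnormM mulrV // qnorm1 divff // normr_eq0.
Qed.

Lemma qmul_eq0 p q : (p * q == 0) = (p == 0) || (q == 0).
Proof. by rewrite -normr_eq0 qnormM mulf_eq0 !normr_eq0. Qed.

Lemma qmulI p q1 q2 : p != 0 -> p * q1 = p * q2 -> q1 = q2.
Proof. by rewrite -qunit => p0 e; rewrite -[q1](mulKr p0) e mulKr. Qed.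

Lemma qconjM p q : qconj (p * q) = qconj q * qconj p.
Proof. by case: p q => [? ? ? ?] [? ? ? ?]; congr Quat => /=; ring. Qed.

Lemma qconjD p q : qconj (p + q) = qconj p + qconj q.
Proof. by case: p q => [? ? ? ?] [? ? ? ?]; congr Quat => /=; ring. Qed.

Lemma qconjN p : qconj (- p) = - qconj p. Proof. by case: p. Qed.

Lemma qconjB p q : qconj (p - q) = qconj p - qconj q.
Proof. by rewrite qconjD qconjN. Qed.

Lemma qconjK : involutive (@qconj R).
Proof. by move=> [? ? ? ?]; congr Quat => /=; rewrite opprK. Qed.

Lemma qconj0 : qconj (0 : H) = 0.
Proof. by congr Quat => /=; rewrite oppr0. Qed.

Lemma qconj1 : qconj (1 : H) = 1.
Proof. by congr Quat => /=; rewrite oppr0. Qed.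

Lemma norm_qconj q : `|qconj q| = `|q|.
Proof. by rewrite !qnormE /qnorm2 /= !sqrrN. Qed.

Lemma mul_qconj q : q * qconj q = (`|q| ^+ 2)%:A.
Proof.
rewrite qnorm_sq; case: q => a b c d; rewrite /qnorm2 /=.
by congr Quat => /=; ring.
Qed.

Lemma mul_conjq q : qconj q * q = (`|q| ^+ 2)%:A.
Proof. by rewrite -[X in _ * X]qconjK mul_qconj norm_qconj. Qed.

Lemma qalgE k : k%:A = Quat k 0 0 0 :> H.
Proof. by congr Quat => /=; rewrite ?mulr1 ?mulr0. Qed.

Lemma qnormA k : `|k%:A : H| = `|k|.
Proof. by rewrite normrZ qnorm1 mulr1. Qed.

Lemma qalg_comm k q : k%:A * q = q * k%:A.
Proof. by rewrite -scalerAl -scalerAr mul1r mulr1. Qed.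

Lemma qVE q : q^-1 = (`|q| ^- 2) *: qconj q.
Proof.
have [->|q0] := eqVneq q 0; first by rewrite invr0 qconj0 scaler0.
apply: (qmulI q0); rewrite mulrV // -scalerAr mul_qconj scalerA mulVf ?scale1r //.
by rewrite expf_neq0 // normr_eq0.
Qed.

Lemma norm_conj_by q v : v != 0 -> `|v^-1 * q * v| = `|q|.
Proof.
by move=> v0; rewrite !qnormM qnormV mulrAC mulVf ?mul1r // normr_eq0.
Qed.

(** Moving a constant past the powers of the variable conjugates the variable; hence a constant on
    the left of a series changes the point of evaluation. *)
Lemma conj_by_exp q v n : v != 0 -> v * (v^-1 * q * v) ^+ n = q ^+ n * v.
Proof.
move=> v0; have ew : v * (v^-1 * q * v) = q * v by rewrite !mulrA mulrV ?mul1r.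
move: (v^-1 * q * v) ew => w ew.
elim: n => [|n IH]; first by rewrite !expr0 mulr1 mul1r.
by rewrite exprSr (mulrA v) IH -mulrA ew exprSr mulrA.
Qed.

(** The Schwarz-Pick identity of the disc persists for quaternions; it compares the two linear
    factors of a Moebius transformation, which agree in modulus on the unit sphere. *)
Lemma norm1DM_sq p q :
  `|1 - p * qconj q| ^+ 2 - `|p - q| ^+ 2 = (1 - `|p| ^+ 2) * (1 - `|q| ^+ 2).
Proof.
rewrite !qnorm_sq; case: p q => [? ? ? ?] [? ? ? ?]; rewrite /qnorm2 /=.
by ring.
Qed.

Lemma norm_coord_le q :
  [/\ `|qa q| <= `|q|, `|qb q| <= `|q|, `|qc q| <= `|q| & `|qd q| <= `|q|].
Proof.
have le x : x ^+ 2 <= qnorm2 q -> `|x| <= `|q|.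
  move=> h; rewrite qnormE -sqrtr_sqr ler_sqrt ?qnorm2_ge0 //.
split; apply: le; rewrite /qnorm2; move: (sqr_ge0 (qa q)) (sqr_ge0 (qb q))
  (sqr_ge0 (qc q)) (sqr_ge0 (qd q)); lra.
Qed.

Lemma norm_le_coord q : `|q| <= `|qa q| + `|qb q| + `|qc q| + `|qd q|.
Proof.
have {1}-> : q = Quat (qa q) 0 0 0 + Quat 0 (qb q) 0 0 + Quat 0 0 (qc q) 0 +
    Quat 0 0 0 (qd q).
  by case: q => ? ? ? ?; congr Quat => /=; rewrite ?addr0 ?add0r.
have n1 (x : R) : [/\ `|Quat x 0 0 0| = `|x|, `|Quat 0 x 0 0| = `|x|,
    `|Quat 0 0 x 0| = `|x| & `|Quat 0 0 0 x| = `|x|].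
  by rewrite !qnormE /qnorm2 /= !expr0n /= !addr0 !add0r sqrtr_sqr.
have [<- _ _ _] := n1 (qa q); have [_ <- _ _] := n1 (qb q).
have [_ _ <- _] := n1 (qc q); have [_ _ _ <-] := n1 (qd q).
apply: le_trans (ler_normD _ _) _; rewrite lerD2r.
apply: le_trans (ler_normD _ _) _; rewrite lerD2r.
exact: ler_normD.
Qed.

Lemma cvg_coord (u : nat -> H) :
  cvgn (fun n => qa (u n)) -> cvgn (fun n => qb (u n)) ->
  cvgn (fun n => qc (u n)) -> cvgn (fun n => qd (u n)) -> cvgn u.
Proof.
move=> /cvg_ex[a ca] /cvg_ex[b cb] /cvg_ex[c cc] /cvg_ex[d cd].
apply/cvg_ex; exists (Quat a b c d); apply/cvgrPdist_le => e e0.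
have e4 : 0 < e / 4 by rewrite divr_gt0.
move/cvgrPdist_le/(_ _ e4): ca => ca; move/cvgrPdist_le/(_ _ e4): cb => cb.
move/cvgrPdist_le/(_ _ e4): cc => cc; move/cvgrPdist_le/(_ _ e4): cd => cd.
near=> n; apply: le_trans (norm_le_coord _) _ => /=.
have : `|a - qa (u n)| <= e / 4 by near: n.
have : `|b - qb (u n)| <= e / 4 by near: n.
have : `|c - qc (u n)| <= e / 4 by near: n.
have : `|d - qd (u n)| <= e / 4 by near: n.
lra.
Unshelve. all: by end_near. Qed.

(** Each of the four real coordinates converges absolutely, being dominated by the same geometric
    series. *)
Lemma series_dominated_cvg (u : nat -> H) (C t : R) : 0 <= t < 1 ->
  (forall n, `|u n| <= C * t ^+ n) -> cvgn (series u).
Proof.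
move=> /andP[t0 t1] uC.
have gC : cvgn (series (geometric C t)).
  by apply: is_cvg_geometric_series; rewrite ger0_norm.
have rc (g : H -> R) : (forall q, `|g q| <= `|q|) ->
    (g 0 = 0) -> {morph g : x y / x + y} -> cvgn (fun n => g (series u n)).
  move=> gn g0 gD.
  have -> : (fun n => g (series u n)) = series (g \o u).
    by apply/funext => n; rewrite /series /= (big_morph _ gD g0).
  apply: normed_cvg; apply: (@series_le_cvg _ _ (geometric C t)) => // n.
  - exact: normr_ge0.
  - rewrite /= mulr_ge0 ?exprn_ge0 //.
    by have := le_trans (normr_ge0 _) (uC 0%N); rewrite expr0 mulr1.
  - exact: le_trans (gn _) (uC n).
by apply: cvg_coord; apply: rc => // q; have [] := norm_coord_le q.
Qed.

Lemma norm_series_le (u : nat -> H) (C t : R) n : 0 <= t < 1 ->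
  (forall n, `|u n| <= C * t ^+ n) -> `|series u n| <= C / (1 - t).
Proof.
move=> /andP[t0 t1] uC; rewrite /series /=.
have C0 : 0 <= C.
  by have := le_trans (normr_ge0 _) (uC 0%N); rewrite expr0 mulr1.
suff : `|\sum_(0 <= k < n) u k| <= C * ((1 - t ^+ n) / (1 - t)).
  move=> /le_trans; apply; rewrite ler_wpM2l // ler_piMl //.
    by rewrite invr_ge0 subr_ge0 ltW.
  by rewrite gerBl exprn_ge0.
elim: n => [|n IH].
  by rewrite big_geq // normr0 expr0 subrr mul0r mulr0.
rewrite big_nat_recr //=; apply: le_trans (ler_normD _ _) _.
have : C * ((1 - t ^+ n) / (1 - t)) + C * t ^+ n = C * ((1 - t ^+ n.+1) / (1 - t)).
  by rewrite exprS; field; rewrite subr_eq0 gt_eqF.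
by move=> <-; rewrite lerD.
Qed.

Lemma cvg_normle (u : nat -> H) (l : H) (C : R) :
  u @ \oo --> l -> (forall n, `|u n| <= C) -> `|l| <= C.
Proof.
move=> ul uC; have nl : (fun n => `|u n|) @ \oo --> `|l| by apply: cvg_norm.
by rewrite -(cvg_lim _ nl) //; apply: limr_le; [apply: cvgP nl|exact: nearW].
Qed.

Lemma cvg_qmulr (u : nat -> H) (l p : H) : u @ \oo --> l -> (fun n => u n * p) @ \oo --> l * p.
Proof.
move=> ul; have [->|p0] := eqVneq p 0.
  under eq_fun do rewrite mulr0.
  by rewrite mulr0; exact: cvg_cst.
move/cvgrPdist_le: ul => ul; apply/cvgrPdist_le => e e0.
have /ul : 0 < e / `|p| by rewrite divr_gt0 ?normr_gt0.
by apply: filterS => n; rewrite -mulrBl qnormM ler_pdivlMr ?normr_gt0.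
Qed.

Lemma cvg_qmull (u : nat -> H) (l p : H) : u @ \oo --> l -> (fun n => p * u n) @ \oo --> p * l.
Proof.
move=> ul; have [->|p0] := eqVneq p 0.
  under eq_fun do rewrite mul0r.
  by rewrite mul0r; exact: cvg_cst.
move/cvgrPdist_le: ul => ul; apply/cvgrPdist_le => e e0.
have /ul : 0 < e / `|p| by rewrite divr_gt0 ?normr_gt0.
by apply: filterS => n; rewrite -mulrBr qnormM ler_pdivlMr ?normr_gt0 // mulrC.
Qed.

End QuaternionNorm.

(** A type of its own, so that [*] can denote the convolution product. *)
Record fps (K : Type) := Fps { coef : nat -> K }.
Coercion coef : fps >-> Funclass.

HB.instance Definition _ (K : Type) := gen_eqMixin (fps K).
HB.instance Definition _ (K : Type) := gen_choiceMixin (fps K).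

Lemma fpsP (K : Type) (a b : fps K) : a =1 b -> a = b.
Proof. by case: a b => [a] [b] /= /funext ->. Qed.

(** * Power series with a central variable *)

Section PowerSeriesRing.
Variable K : nzRingType.
Implicit Types (a b c : fps K) (k : K).

Definition fps_add a b := Fps (fun n => a n + b n).
Definition fps_opp a := Fps (fun n => - a n).
Definition fps_zero : fps K := Fps (fun _ => 0).
Definition fps_const k : fps K := Fps (fun n => if n == 0%N then k else 0).
Definition fps_mul a b :=
  Fps (fun n => \sum_(k < n.+1) a k * b (n - k)%N).
Definition fps_trunc n a : {poly K} := \poly_(i < n.+1) a i.

Fact fps_addA : associative fps_add.
Proof. by move=> a b c; apply: fpsP => n /=; rewrite addrA. Qed.
Fact fps_addC : commutative fps_add.
Proof. by move=> a b; apply: fpsP => n /=; rewrite addrC. Qed.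
Fact fps_add0 : left_id fps_zero fps_add.
Proof. by move=> a; apply: fpsP => n /=; rewrite add0r. Qed.
Fact fps_addN : left_inverse fps_zero fps_opp fps_add.
Proof. by move=> a; apply: fpsP => n /=; rewrite addNr. Qed.

HB.instance Definition _ :=
  GRing.isZmodule.Build (fps K) fps_addA fps_addC fps_add0 fps_addN.

Lemma coef_trunc n a i : (i <= n)%N -> (fps_trunc n a)`_i = a i.
Proof. by move=> lin; rewrite coef_poly ltnS lin. Qed.

Lemma coef_mul_trunc n a b i : (i <= n)%N ->
  fps_mul a b i = (fps_trunc n a * fps_trunc n b)`_i.
Proof.
move=> lin; rewrite coefM; apply: eq_bigr => j _.
rewrite !coef_trunc //; first exact: leq_trans (leq_subr _ _) lin.
by apply: leq_trans lin; rewrite -ltnS.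
Qed.

(** A coefficient of a product involves only finitely many coefficients of the factors, so
    associativity is inherited from truncated polynomials. *)
Fact fps_mulA : associative fps_mul.
Proof.
move=> a b c; apply: fpsP => n.
rewrite (coef_mul_trunc (n := n)) // [RHS](coef_mul_trunc (n := n)) //.
have lE d e f i : (i <= n)%N ->
    (fps_trunc n d * fps_trunc n (fps_mul e f))`_i =
    (fps_trunc n d * (fps_trunc n e * fps_trunc n f))`_i.
  move=> lin; rewrite !coefM; apply: eq_bigr => j _.
  have lj : (i - j <= n)%N by apply: leq_trans (leq_subr _ _) lin.
  by rewrite [in LHS](coef_trunc _ lj) (coef_mul_trunc _ _ lj).
have rE d e f i : (i <= n)%N ->
    (fps_trunc n (fps_mul e f) * fps_trunc n d)`_i =
    ((fps_trunc n e * fps_trunc n f) * fps_trunc n d)`_i.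
  move=> lin; rewrite !coefM; apply: eq_bigr => j _.
  have lj : (j <= n)%N by apply: leq_trans lin; rewrite -ltnS.
  by rewrite [in LHS](coef_trunc _ lj) (coef_mul_trunc _ _ lj).
by rewrite lE // rE // mulrA.
Qed.

Fact fps_mul1 : left_id (fps_const 1) fps_mul.
Proof.
move=> a; apply: fpsP => n /=; rewrite big_ord_recl /= subn0 mul1r.
by rewrite big1 ?addr0 // => i _; rewrite mul0r.
Qed.

Fact fps_mulr1 : right_id (fps_const 1) fps_mul.
Proof.
move=> a; apply: fpsP => n /=; rewrite big_ord_recr /= subnn mulr1.
by rewrite big1 ?add0r // => i _; rewrite subn_eq0 leqNgt ltn_ord mulr0.
Qed.

Fact fps_mulDl : left_distributive fps_mul +%R.
Proof.
move=> a b c; apply: fpsP => n /=; rewrite -big_split /=.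
by apply: eq_bigr => i _; rewrite mulrDl.
Qed.

Fact fps_mulDr : right_distributive fps_mul +%R.
Proof.
move=> a b c; apply: fpsP => n /=; rewrite -big_split /=.
by apply: eq_bigr => i _; rewrite mulrDr.
Qed.

Fact fps_one_neq0 : fps_const 1 != 0.
Proof.
by apply/eqP => /(congr1 (fun a : fps K => a 0%N)) /eqP /=; rewrite oner_eq0.
Qed.

HB.instance Definition _ := GRing.Zmodule_isNzRing.Build (fps K)
  fps_mulA fps_mul1 fps_mulr1 fps_mulDl fps_mulDr fps_one_neq0.

Lemma coef0f n : (0 : fps K) n = 0. Proof. by []. Qed.
Lemma coefDf a b n : (a + b) n = a n + b n. Proof. by []. Qed.
Lemma coefNf a n : (- a) n = - a n. Proof. by []. Qed.
Lemma coefBf a b n : (a - b) n = a n - b n. Proof. by []. Qed.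
Lemma coefMf a b n : (a * b) n = \sum_(k < n.+1) a k * b (n - k)%N.
Proof. by []. Qed.

Lemma coefCMf k a n : (fps_const k * a) n = k * a n.
Proof.
rewrite coefMf big_ord_recl /= subn0.
by rewrite big1 ?addr0 // => i _; rewrite mul0r.
Qed.

Lemma coefMCf k a n : (a * fps_const k) n = a n * k.
Proof.
rewrite coefMf big_ord_recr /= subnn.
by rewrite big1 ?add0r // => i _; rewrite subn_eq0 leqNgt ltn_ord mulr0.
Qed.

Lemma fps_constM k l : fps_const (k * l) = fps_const k * fps_const l.
Proof. by apply: fpsP => n; rewrite coefCMf /=; case: eqP; rewrite ?mulr0. Qed.

Lemma fps_constD k l : fps_const (k + l) = fps_const k + fps_const l.
Proof. by apply: fpsP => n; rewrite coefDf /=; case: eqP; rewrite ?addr0. Qed.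

Lemma fps_constN k : fps_const (- k) = - fps_const k.
Proof. by apply: fpsP => n; rewrite coefNf /=; case: eqP; rewrite ?oppr0. Qed.

Lemma fps_constB k l : fps_const (k - l) = fps_const k - fps_const l.
Proof. by rewrite fps_constD fps_constN. Qed.

Lemma fps_const1 : fps_const 1 = 1. Proof. by []. Qed.

Lemma fps_const0 : fps_const 0 = 0.
Proof. by apply: fpsP => n /=; case: eqP. Qed.

Definition fpsX : fps K := Fps (fun n => if n == 1%N then 1 else 0).

Lemma coefXMf a n : (fpsX * a) n = if n == 0%N then 0 else a n.-1.
Proof.
rewrite coefMf; case: n => [|n]; first by rewrite big_ord1 /= mul0r.
rewrite big_ord_recl big_ord_recl /= mul0r add0r subSS subn0 mul1r.
by rewrite big1 ?addr0 // => i _; rewrite /= mul0r.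
Qed.

Lemma fpsX_comm a : a * fpsX = fpsX * a.
Proof.
apply: fpsP => n; rewrite coefXMf coefMf.
case: n => [|n]; first by rewrite big_ord1 /= mulr0.
rewrite big_ord_recr big_ord_recr /= subnn mulr0 addr0 subSnn /= mulr1.
rewrite big1 ?add0r // => i _; rewrite subSn; last exact: ltnW.
by rewrite /= eqSS subn_eq0 leqNgt ltn_ord mulr0.
Qed.

Definition fps_shift m a : fps K := Fps (fun n => a (m + n)%N).

Definition fps_deriv a : fps K := Fps (fun n => a n.+1 *+ n.+1).

Lemma coef_fps_deriv a n : fps_deriv a n = a n.+1 *+ n.+1. Proof. by []. Qed.

Lemma fps_derivD a b : fps_deriv (a + b) = fps_deriv a + fps_deriv b.
Proof. by apply: fpsP => n; rewrite coef_fps_deriv mulrnDl. Qed.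

Lemma fps_deriv_const k : fps_deriv (fps_const k) = 0.
Proof. by apply: fpsP => n; rewrite coef_fps_deriv mul0rn. Qed.

(** Leibniz's rule for a linear factor. At the point [k] the last term vanishes, which is why a
    series has the same derivative and difference quotient there. *)
Lemma fps_deriv_XBM k a :
  fps_deriv ((fpsX - fps_const k) * a) =
  a + (fpsX - fps_const k) * fps_deriv a.
Proof.
apply: fpsP => n; rewrite coef_fps_deriv coefDf !mulrBl !coefBf.
rewrite !coefXMf !coefCMf !coef_fps_deriv mulrnBl mulrSr.
case: n => [|n]; first by rewrite /= mulr0n !mulr1n !add0r.
by rewrite mulrnAr addrA [a _ + _]addrC.
Qed.

End PowerSeriesRing.

(** * Evaluation of convergent series *)

Section PowerSeriesEvaluation.
Variable R : realType.
Local Notation H := (quat R).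
Implicit Types (a b c h : fps H) (p q u v w : H) (r t : R).

(** Radius of convergence at least 1: bounded terms at every radius below 1 give geometric decay at
    any smaller one. *)
Definition fps_conv a :=
  forall r, 0 < r < 1 -> exists C, forall n, `|a n| * r ^+ n <= C.

Definition fps_eval a q : H := pseries_sum a q.

Definition fps_conj a : fps H := Fps (fun n => qconj (a n)).

(** Synthetic division: solving a - a(q) = (X - q) b for the coefficients of b yields the values at
    [q] of the tails of [a]. *)
Definition fps_quot q a : fps H := Fps (fun n => fps_eval (fps_shift n.+1 a) q).

(** Each of the powers t^k with k <= n is at least t^n, and their sum is (1 - t^(n+1)) / (1 - t). *)
Lemma geometric_mulrn_le t n : 0 <= t < 1 -> t ^+ n *+ n.+1 <= (1 - t)^-1.
Proof.
move=> /andP[t0 t1]; have s0 : 0 < 1 - t by rewrite subr_gt0.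
rewrite -[_^-1]mul1r ler_pdivlMr //.
suff : t ^+ n *+ n.+1 * (1 - t) <= 1 - t ^+ n.+1.
  by move=> /le_trans; apply; rewrite gerBl exprn_ge0.
elim: n => [|n IH]; first by rewrite expr0 mulr1n mul1r expr1.
have tn0 : 0 <= t ^+ n.+1 by rewrite exprn_ge0.
have tn1 : t ^+ n.+1 <= 1 by rewrite exprn_ile1 // ltW.
have E : t ^+ n.+1 *+ n.+1 = t * (t ^+ n *+ n.+1) by rewrite exprS mulrnAr.
rewrite mulrSr E mulrDl -mulrA.
have := ler_wpM2l t0 IH; rewrite [t ^+ n.+2]exprS.
move: (t ^+ n.+1) (_ * (1 - t)) tn0 tn1 => x y; nra.
Qed.

Lemma geometric_bound_cvg0 (u : nat -> H) (C t : R) : 0 <= t < 1 ->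
  (forall n, `|u n| <= C * t ^+ n) -> u @ \oo --> (0 : H).
Proof. by move=> t01 uC; apply: cvg_series_cvg_0; apply: series_dominated_cvg uC. Qed.

Lemma between_lt1 r : 0 <= r < 1 -> exists2 s, r < s & 0 < s < 1.
Proof.
by move=> /andP[r0 r1]; exists ((1 + r) / 2); [lra|apply/andP; split; lra].
Qed.

Lemma ratio01 r t : 0 <= t -> t < r -> 0 <= t / r < 1.
Proof.
move=> t0 tr; have r0 := le_lt_trans t0 tr.
by rewrite divr_ge0 ?(ltW r0) //= ltr_pdivrMr // mul1r.
Qed.

Lemma fps_conv_coef a r : fps_conv a -> 0 < r < 1 ->
  exists2 C, 0 <= C & forall n, `|a n| <= C * r^-1 ^+ n.
Proof.
move=> ca /[dup] /andP[r0 _] /ca [C hC]; exists C.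
  by apply: le_trans (hC 0%N); rewrite expr0 mulr1.
by move=> n; rewrite exprVn -ler_pdivrMr ?invr_gt0 ?exprn_gt0 // invrK.
Qed.

Lemma fps_conv_le a r : (forall n, `|a n| <= r) -> fps_conv a.
Proof.
move=> le s /andP[s0 s1]; exists r => n; apply: le_trans (le n).
by rewrite ler_piMr // exprn_ile1 // ltW.
Qed.

Lemma fps_term_bound a q r C : 0 < r -> (forall n, `|a n| <= C * r^-1 ^+ n) ->
  forall n, `|q ^+ n * a n| <= C * (`|q| / r) ^+ n.
Proof.
move=> r0 hC n; rewrite qnormM qnormX exprMn mulrC.
rewrite [_ ^+ n * _]mulrC mulrA ler_wpM2r ?exprn_ge0 //.
Qed.

Lemma fps_conv_term a q : fps_conv a -> `|q| < 1 ->
  exists C t, 0 <= t < 1 /\ forall n, `|q ^+ n * a n| <= C * t ^+ n.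
Proof.
move=> ca q1; have [|r qr r01] := @between_lt1 `|q|; first by rewrite normr_ge0.
have r0 : 0 < r by case/andP: r01.
have [C C0 hC] := fps_conv_coef ca r01.
exists C, (`|q| / r); split; last exact: fps_term_bound.
exact: ratio01.
Qed.

Lemma fps_eval_cvg a q : fps_conv a -> `|q| < 1 ->
  pseries a q @ \oo --> fps_eval a q.
Proof.
by move=> ca q1; have [C [t [t01 hC]]] := fps_conv_term ca q1;
  apply: series_dominated_cvg hC.
Qed.

Lemma fps_eval_unique a q l : pseries a q @ \oo --> l -> fps_eval a q = l.
Proof. by move=> /cvg_lim; apply; exact: norm_hausdorff. Qed.

Lemma fps_conv_const u : fps_conv (fps_const u).
Proof. by apply: (@fps_conv_le _ `|u|) => -[|n] //=; rewrite normr0. Qed.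

Lemma fps_convX : fps_conv (fpsX H).
Proof.
by apply: (@fps_conv_le _ 1) => -[|[|n]] //=; rewrite ?normr0 ?qnorm1.
Qed.

Lemma fps_convD a b : fps_conv a -> fps_conv b -> fps_conv (a + b).
Proof.
move=> ca cb r r01; have /andP[r0 _] := r01.
have [C hC] := ca r r01; have [D hD] := cb r r01.
exists (C + D) => n; apply: le_trans (lerD (hC n) (hD n)).
by rewrite -mulrDl ler_wpM2r ?ler_normD ?exprn_ge0 ?ltW.
Qed.

Lemma fps_convN a : fps_conv a -> fps_conv (- a).
Proof.
by move=> ca r r01; have [C hC] := ca r r01; exists C => n; rewrite normrN.
Qed.

Lemma fps_convB a b : fps_conv a -> fps_conv b -> fps_conv (a - b).
Proof. by move=> ca cb; apply: fps_convD => //; apply: fps_convN. Qed.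

Lemma fps_conv1 : fps_conv 1. Proof. exact: fps_conv_const. Qed.

Lemma fps_conv_conj a : fps_conv a -> fps_conv (fps_conj a).
Proof.
by move=> ca r r01; have [C hC] := ca r r01; exists C => n; rewrite norm_qconj.
Qed.

(** The factor n + 1, which comes from convolution or differentiation, is absorbed by passing to a
    slightly larger radius. *)
Lemma fps_conv_polynomial_growth a :
  (forall s, 0 < s < 1 -> exists2 C, 0 <= C &
    forall n, `|a n| <= C * s^-1 ^+ n *+ n.+1) -> fps_conv a.
Proof.
move=> ha r /andP[r0 r1].
have [|s rs s01] := @between_lt1 r; first by rewrite ltW.
have s0 : 0 < s by case/andP: s01.
have [C C0 hC] := ha s s01.
exists (C * (1 - r / s)^-1) => n.
apply: (@le_trans _ _ (C * ((r / s) ^+ n *+ n.+1))).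
  have -> : C * ((r / s) ^+ n *+ n.+1) = C * s^-1 ^+ n *+ n.+1 * r ^+ n.
    by rewrite exprMn -[in RHS]mulr_natr -[_ *+ n.+1]mulr_natr; ring.
  by rewrite ler_wpM2r // exprn_ge0 // ltW.
rewrite ler_wpM2l // geometric_mulrn_le //.
by apply: ratio01 => //; exact: ltW.
Qed.

Lemma fps_convM a b : fps_conv a -> fps_conv b -> fps_conv (a * b).
Proof.
move=> ca cb; apply: fps_conv_polynomial_growth => s s01.
have [C C0 hC] := fps_conv_coef ca s01; have [D D0 hD] := fps_conv_coef cb s01.
have s0 : 0 < s by case/andP: s01.
exists (C * D); first by rewrite mulr_ge0.
move=> n; apply: le_trans (ler_norm_sum _ _ _) _.
rewrite -[n.+1 in leRHS]card_ord -sumr_const; apply: ler_sum => i _.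
rewrite qnormM; apply: le_trans (ler_pM _ _ (hC _) (hD _)) _ => //.
by rewrite mulrACA -exprD subnKC // -ltnS.
Qed.

Lemma fps_conv_shift m a : fps_conv a -> fps_conv (fps_shift m a).
Proof.
move=> ca r r01; have [C hC] := ca r r01; have /andP[r0 _] := r01.
exists (C / r ^+ m) => n; rewrite ler_pdivlMr ?exprn_gt0 //.
by rewrite -mulrA -exprD addnC hC.
Qed.

Lemma fps_conv_deriv a : fps_conv a -> fps_conv (fps_deriv a).
Proof.
move=> ca; apply: fps_conv_polynomial_growth => s s01.
have [C C0 hC] := fps_conv_coef ca s01; have s0 : 0 < s by case/andP: s01.
exists (C / s); first by rewrite divr_ge0 // ltW.
move=> n; rewrite coef_fps_deriv -scaler_nat normrZ normr_nat mulr_natl.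
by rewrite lerMn2r /= -mulrA -exprS hC.
Qed.

Lemma norm_fps_eval_le a q r C : fps_conv a -> `|q| < r < 1 ->
  (forall n, `|a n| <= C * r^-1 ^+ n) -> `|fps_eval a q| <= C / (1 - `|q| / r).
Proof.
move=> ca /andP[qr r1] hC; have r0 := le_lt_trans (normr_ge0 q) qr.
apply: cvg_normle (fps_eval_cvg ca (lt_trans qr r1)) _ => n.
apply: norm_series_le; last exact: fps_term_bound.
by apply: ratio01.
Qed.

Lemma fps_conv_quot q a : `|q| < 1 -> fps_conv a -> fps_conv (fps_quot q a).
Proof.
move=> q1 ca r /andP[r0 r1].
have [|s rs s01] := @between_lt1 (Num.max `|q| r).
  by rewrite le_max normr_ge0 gt_max q1 r1.
move: rs; rewrite gt_max => /andP[qs rs]; have /andP[s0 s1] := s01.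
have [C C0 hC] := fps_conv_coef ca s01.
have qs0 : 0 < 1 - `|q| / s by rewrite subr_gt0 ltr_pdivrMr // mul1r.
exists (C / s / (1 - `|q| / s)) => n.
have := @norm_fps_eval_le (fps_shift n.+1 a) q s (C * s^-1 ^+ n.+1).
move=> /(_ (fps_conv_shift _ ca)); rewrite qs s1 => /(_ isT) le.
have {}le : `|fps_quot q a n| <= C * s^-1 ^+ n.+1 / (1 - `|q| / s).
  by apply: le => m; apply: le_trans (hC _) _; rewrite exprD mulrA.
apply: (@le_trans _ _ (C * s^-1 ^+ n.+1 / (1 - `|q| / s) * s ^+ n)).
  by apply: ler_pM; rewrite ?exprn_ge0 ?(ltW r0) // lerXn2r ?nnegrE ?ltW.
rewrite mulrAC ler_wpM2r ?invr_ge0 ?(ltW qs0) //.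
by rewrite exprS -!mulrA -exprMn mulVf ?gt_eqF // expr1n mulr1.
Qed.

Lemma fps_evalD a b q : fps_conv a -> fps_conv b -> `|q| < 1 ->
  fps_eval (a + b) q = fps_eval a q + fps_eval b q.
Proof.
move=> ca cb q1; apply: fps_eval_unique.
have -> : pseries (a + b) q = (fun n => pseries a q n + pseries b q n).
  apply/funext => n; rewrite /pseries /series /= -big_split /=.
  by apply: eq_bigr => i _; rewrite mulrDr.
by apply: cvgD; apply: fps_eval_cvg.
Qed.

Lemma fps_evalN a q : fps_conv a -> `|q| < 1 -> fps_eval (- a) q = - fps_eval a q.
Proof.
move=> ca q1; apply: fps_eval_unique.
have -> : pseries (- a) q = (fun n => - pseries a q n).
  apply/funext => n; rewrite /pseries /series /= -sumrN /=.
  by apply: eq_bigr => i _; rewrite mulrN.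
by apply: cvgN; apply: fps_eval_cvg.
Qed.

Lemma fps_evalB a b q : fps_conv a -> fps_conv b -> `|q| < 1 ->
  fps_eval (a - b) q = fps_eval a q - fps_eval b q.
Proof. by move=> ca cb q1; rewrite fps_evalD ?fps_evalN //; apply: fps_convN. Qed.

Lemma fps_eval_const k q : fps_eval (fps_const k) q = k.
Proof.
apply: fps_eval_unique; rewrite -(cvg_shiftS _).
apply: cvg_near_cst; apply: nearW => n; rewrite /pseries /series /=.
rewrite big_nat_recl //= expr0 mul1r big1 ?addr0 // => i _; rewrite mulr0 //.
Qed.

Lemma fps_eval1 q : fps_eval 1 q = 1. Proof. exact: fps_eval_const. Qed.

Lemma fps_evalMC a k q : fps_conv a -> `|q| < 1 ->
  fps_eval (a * fps_const k) q = fps_eval a q * k.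
Proof.
move=> ca q1; apply: fps_eval_unique.
have -> : pseries (a * fps_const k) q = (fun n => pseries a q n * k).
  apply/funext => n; rewrite /pseries /series mulr_suml.
  by apply: eq_bigr => i _; rewrite coefMCf mulrA.
by apply: cvg_qmulr; apply: fps_eval_cvg.
Qed.

Lemma fps_evalCM k a q : k != 0 -> fps_conv a -> `|q| < 1 ->
  fps_eval (fps_const k * a) q = k * fps_eval a (k^-1 * q * k).
Proof.
move=> k0 ca q1; apply: fps_eval_unique.
have -> : pseries (fps_const k * a) q = (fun n => k * pseries a (k^-1 * q * k) n).
  apply/funext => n; rewrite /pseries /series mulr_sumr.
  by apply: eq_bigr => i _; rewrite coefCMf !mulrA conj_by_exp.
by apply: cvg_qmull; apply: fps_eval_cvg; rewrite ?norm_conj_by.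
Qed.

(** The partial sums telescope to a single term, which tends to 0. *)
Lemma fps_eval_XBM h q : fps_conv h -> `|q| < 1 ->
  fps_eval ((fpsX H - fps_const q) * h) q = 0.
Proof.
move=> ch q1; apply: fps_eval_unique; rewrite -(cvg_shiftS _).
have [C [t [t01 hC]]] := fps_conv_term ch q1.
have E n : pseries ((fpsX H - fps_const q) * h) q n.+1 = - (q ^+ n.+1 * h n).
  elim: n => [|n IH]; rewrite /pseries /series.
    by rewrite [LHS]big_nat1 mulrBl coefBf coefXMf coefCMf sub0r expr0 mul1r expr1.
  rewrite [LHS]big_nat_recr // [X in X + _ = _]IH.
  rewrite mulrBl coefBf coefXMf coefCMf -[n.+1 == 0%N]/false mulrBr addrA addNr sub0r.
  by rewrite mulrA -exprSr.
have t0 : 0 <= t by case/andP: t01.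
apply: (@geometric_bound_cvg0 _ (`|q| * C) t t01) => n /=.
by rewrite E normrN exprS -mulrA qnormM -mulrA ler_wpM2l.
Qed.

Lemma fps_evalX q : `|q| < 1 -> fps_eval (fpsX H) q = q.
Proof.
move=> q1; have := fps_eval_XBM fps_conv1 q1; rewrite mulr1 fps_evalB //.
- by rewrite fps_eval_const => /eqP; rewrite subr_eq0 => /eqP.
- exact: fps_convX.
- exact: fps_conv_const.
Qed.

Lemma fps_eval_shift a q : fps_conv a -> `|q| < 1 ->
  fps_eval a q = a 0%N + q * fps_eval (fps_shift 1 a) q.
Proof.
move=> ca q1; apply: fps_eval_unique; rewrite -(cvg_shiftS _).
have E n : pseries a q n.+1 = a 0%N + q * pseries (fps_shift 1 a) q n.
  rewrite /pseries /series /= big_nat_recl //= expr0 mul1r; congr (_ + _).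
  by rewrite mulr_sumr; apply: eq_bigr => i _; rewrite exprS mulrA.
under eq_fun do rewrite E.
by apply: cvgD; [exact: cvg_cst|apply: cvg_qmull; apply: fps_eval_cvg => //;
  apply: fps_conv_shift].
Qed.

Lemma fps_quotE a q : fps_conv a -> `|q| < 1 ->
  (fpsX H - fps_const q) * fps_quot q a = a - fps_const (fps_eval a q).
Proof.
move=> ca q1; apply: fpsP => n.
rewrite mulrBl !coefBf coefXMf coefCMf; case: n => [|n].
  by rewrite (fps_eval_shift ca q1) sub0r /= opprD addrA subrr sub0r.
rewrite /= subr0 [in LHS](fps_eval_shift (fps_conv_shift _ ca) q1) /=.
rewrite addn0 [X in fps_eval X q](_ : _ = fps_shift n.+2 a) ?addrK //.
by apply: fpsP => m /=; rewrite add1n addnS.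
Qed.

(* Both sides differ by the value at [q] of a multiple of [X - q]. *)
Lemma fps_evalM a b q : fps_conv a -> fps_conv b -> `|q| < 1 ->
  fps_eval (a * b) q = fps_eval (fps_const (fps_eval a q) * b) q.
Proof.
move=> ca cb q1.
have aE : a = fps_const (fps_eval a q) + (fpsX H - fps_const q) * fps_quot q a.
  by rewrite fps_quotE // addrC subrK.
have cR := fps_conv_quot q1 ca.
rewrite {1}aE mulrDl -mulrA fps_evalD ?fps_eval_XBM ?addr0 //.
- exact: fps_convM.
- by apply: fps_convM => //; exact: fps_conv_const.
- apply: fps_convM; last exact: fps_convM.
  by apply: fps_convB; [exact: fps_convX|exact: fps_conv_const].
Qed.

Lemma fps_evalM0 a b q : fps_conv a -> fps_conv b -> `|q| < 1 ->
  fps_eval a q = 0 -> fps_eval (a * b) q = 0.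
Proof.
by move=> ca cb q1 a0; rewrite fps_evalM // a0 fps_const0 mul0r -fps_const0
  fps_eval_const.
Qed.

Lemma fps_evalMn0 a b q : fps_conv a -> fps_conv b -> `|q| < 1 ->
  fps_eval a q != 0 -> fps_eval (a * b) q =
  fps_eval a q * fps_eval b ((fps_eval a q)^-1 * q * fps_eval a q).
Proof. by move=> ca cb q1 a0; rewrite fps_evalM // fps_evalCM. Qed.

Lemma fps_evalM_comm a b q : fps_conv a -> fps_conv b -> `|q| < 1 ->
  q * fps_eval a q = fps_eval a q * q ->
  fps_eval (a * b) q = fps_eval a q * fps_eval b q.
Proof.
move=> ca cb q1 qa; have [a0|a0] := eqVneq (fps_eval a q) 0.
  by rewrite fps_evalM0 // a0 mul0r.
rewrite (fps_evalMn0 ca cb q1 a0); move: (fps_eval a q) qa a0 => v qv v0.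
by have -> : v^-1 * q * v = q by rewrite -mulrA qv (mulKr (v0 : v \is a GRing.unit)).
Qed.

Lemma fps_deriv_eval a q : fps_conv a -> `|q| < 1 ->
  fps_eval (fps_deriv a) q = fps_eval (fps_quot q a) q.
Proof.
move=> ca q1; have := fps_quotE ca q1 => /(congr1 (@fps_deriv _)).
rewrite fps_deriv_XBM -[in RHS]fps_constN [RHS]fps_derivD fps_deriv_const addr0 => <-.
have cR := fps_conv_quot q1 ca.
rewrite fps_evalD ?fps_eval_XBM ?addr0 //; first exact: fps_conv_deriv.
apply: fps_convM; last exact: fps_conv_deriv.
by apply: fps_convB; [exact: fps_convX|exact: fps_conv_const].
Qed.

End PowerSeriesEvaluation.

(** * Differentiability along slices *)

Section DifferentiableEpsilon.
Variables (R : realType) (V W : normedModType R).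
Implicit Types (f : V -> W) (x : V).

Lemma differentiable_linear_approx f x (L : {linear V -> W}) :
  continuous L ->
  (forall e, 0 < e -> \forall h \near (0 : V), `|f (h + x) - f x - L h| <= e * `|h|) ->
  differentiable f x /\ 'd f x = L :> (V -> W).
Proof.
move=> cL fL.
have E : f \o shift x = cst (f x) + L +o_ 0 id.
  apply/eqaddoP => e e0; have := fL e e0; apply: filterS => h.
  by rewrite opprD addrA.
have dE := diff_unique cL E; split=> //.
by apply/diff_locallyP; rewrite dE.
Qed.

Lemma differentiable_approx f x : differentiable f x -> forall e, 0 < e ->
  \forall h \near (0 : V), `|f (h + x) - f x - 'd f x h| <= e * `|h|.
Proof.
move=> df e e0; have /eqaddoP /(_ e e0) := diff_locally df.
by apply: filterS => h; rewrite opprD addrA.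
Qed.

End DifferentiableEpsilon.

Section SliceDifferentiability.
Variable R : realType.
Local Notation H := (quat R).
Implicit Types (f g : H -> H) (p q I : H) (z h : R * R).

Definition slice_line I : set H := range (@slice R I).

(** A complex derivative along the slice. The Cauchy-Riemann equation, with [I] on the left, says
    that the differential is h -> h d, so the increment stands on the left of [d]. *)
Definition slice_derives I f q (d : H) := forall e, 0 < e ->
  exists2 r, 0 < r & forall p, slice_line I p -> `|p - q| < r ->
    `|f p - f q - (p - q) * d| <= e * `|p - q|.

Lemma imag_sphere_coord I : imag_sphere I ->
  qa I = 0 /\ qb I ^+ 2 + qc I ^+ 2 + qd I ^+ 2 = 1.
Proof.
case: I => a b c d; rewrite /imag_sphere /= expr2 => -[] /= e1 e2 e3 e4.
have a0 : a = 0.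
  apply/eqP; apply: contraT => a0.
  have b0 : b = 0 by apply: (mulfI a0); move: e2; rewrite oppr0; lra.
  have c0 : c = 0 by apply: (mulfI a0); move: e3; rewrite oppr0; lra.
  have d0 : d = 0 by apply: (mulfI a0); move: e4; rewrite oppr0; lra.
  by move: e1; rewrite b0 c0 d0; nra.
by split=> //; move: e1; rewrite a0; lra.
Qed.

Lemma norm_slice_sq I z : imag_sphere I ->
  `|slice I z| ^+ 2 = z.1 ^+ 2 + z.2 ^+ 2.
Proof.
move=> /imag_sphere_coord [a0 n1]; rewrite qnorm_sq /slice qalgE.
case: I a0 n1 => a b c d /= -> n1; rewrite /qnorm2 /=.
transitivity (z.1 ^+ 2 + z.2 ^+ 2 * (b ^+ 2 + c ^+ 2 + d ^+ 2)); first by ring.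
by rewrite n1 mulr1.
Qed.

Lemma sliceD I z h : slice I (z + h) = slice I z + slice I h.
Proof. by rewrite /slice /= !scalerDl addrACA. Qed.

Lemma sliceB I z h : slice I (z - h) = slice I z - slice I h.
Proof. by rewrite /slice /= !scalerBl opprD addrACA. Qed.

Lemma sliceZ I (k : R) z : slice I (k *: z) = k *: slice I z.
Proof. by rewrite /slice /= !scalerDr !scalerA. Qed.

Lemma slice_comm I z h : slice I z * slice I h = slice I h * slice I z.
Proof.
rewrite /slice !mulrDl !mulrDr -!scalerAl -!scalerAr !mul1r !mulr1 !scalerA.
rewrite [h.1 * z.1]mulrC [h.1 * z.2]mulrC [h.2 * z.1]mulrC [h.2 * z.2]mulrC.
by rewrite -!addrA; congr (_ + _); rewrite addrCA.
Qed.

Lemma norm_pairE (z : R * R) : `|z| = Num.max `|z.1| `|z.2|.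
Proof. by []. Qed.

Lemma norm_le_slice I z : imag_sphere I -> `|z| <= `|slice I z|.
Proof.
move=> Is; rewrite norm_pairE ge_max; apply/andP.
by split; rewrite -(ler_pXn2r (_ : 0 < 2)%N) ?nnegrE //;
  rewrite norm_slice_sq // real_normK ?num_real // ?lerDl ?lerDr sqr_ge0.
Qed.

(** The plane [R * R] carries the maximum norm; 2 is a bound for the exact constant sqrt 2. *)
Lemma norm_slice_le I z : imag_sphere I -> `|slice I z| <= 2 * `|z|.
Proof.
move=> Is; rewrite -(ler_pXn2r (_ : 0 < 2)%N) ?nnegrE ?mulr_ge0 //.
rewrite norm_slice_sq // norm_pairE -[z.1 ^+ 2]real_normK ?num_real //.
rewrite -[z.2 ^+ 2]real_normK ?num_real //.
have : `|z.1| <= Num.max `|z.1| `|z.2| by rewrite le_max lexx.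
have : `|z.2| <= Num.max `|z.1| `|z.2| by rewrite le_max lexx orbT.
have := normr_ge0 z.1; have := normr_ge0 z.2.
move: `|z.1| `|z.2| (Num.max _ _) => x y m; nra.
Qed.

Definition slice_mul I (d : H) z : H := slice I z * d.

Fact slice_mul_linear I d : linear (slice_mul I d).
Proof.
by move=> k z h; rewrite /slice_mul sliceD sliceZ mulrDl scalerAl.
Qed.

HB.instance Definition _ I d :=
  GRing.isLinear.Build R (R * R)%type H _ (slice_mul I d) (slice_mul_linear I d).

Lemma slice_mul_continuous I d : continuous (slice_mul I d).
Proof.
move=> z; have -> : slice_mul I d = (fun z => z.1 *: d + z.2 *: (I * d)).
  by apply/funext => h; rewrite /slice_mul /slice mulrDl -!scalerAl mul1r.
by apply: cvgD; apply: cvgZr_tmp; [exact: cvg_fst|exact: cvg_snd].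
Qed.

Lemma imag_sphere_CR I (d1 d2 : H) : imag_sphere I ->
  (2^-1 *: (d1 + I * d2) = 0 <-> d2 = I * d1).
Proof.
rewrite /imag_sphere /= expr2 => Is; split=> [/eqP|->].
  rewrite scaler_eq0 invr_eq0 pnatr_eq0 /= addr_eq0 => /eqP ->.
  by rewrite mulrN mulrA Is mulN1r opprK.
by rewrite mulrA Is mulN1r subrr scaler0.
Qed.

Lemma slice_derives_diff I f z d : imag_sphere I ->
  slice_derives I f (slice I z) d ->
  differentiable (f \o slice I) z /\
  'd (f \o slice I) z = slice_mul I d :> (R * R -> H).
Proof.
move=> Is fd.
apply: (@differentiable_linear_approx R _ _ (f \o slice I) z (slice_mul I d)).
  exact: slice_mul_continuous.
move=> e e0; have e2 : 0 < e / 2 by rewrite divr_gt0.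
have [r r0 hr] := fd _ e2.
have r2 : 0 < r / 2 by rewrite divr_gt0.
near=> h; rewrite /= [h + z]addrC sliceD.
have hs : `|slice I h| <= 2 * `|h| by exact: norm_slice_le.
have -> : slice_mul I d h = (slice I z + slice I h - slice I z) * d.
  by rewrite addrC addKr.
apply: le_trans (hr _ _ _) _.
- by exists (z + h) => //; rewrite sliceD.
- rewrite addrC addKr; apply: le_lt_trans hs _.
  have : `|h| < r / 2.
    near: h; apply/nbhs_ballP; exists (r / 2) => //= y.
    by rewrite -ball_normE /= sub0r normrN.
  lra.
- by rewrite addrC addKr -mulrA ler_wpM2l ?(ltW e0) // mulrC ler_pdivrMr // mulrC.
Unshelve. all: by end_near. Qed.

Lemma diff_slice_derives I f z : imag_sphere I ->
  differentiable (f \o slice I) z ->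
  2^-1 *: ('D_(1, 0) (f \o slice I) z + I * 'D_(0, 1) (f \o slice I) z) = 0 ->
  slice_derives I f (slice I z) ('D_(1, 0) (f \o slice I) z).
Proof.
move=> Is df /(imag_sphere_CR _ _ Is) CR e e0.
have /nbhs_ballP [r /= r0 hr] := differentiable_approx df e0; exists r => // p [z' _ <-] lt.
have hb : `|z' - z| < r by apply: le_lt_trans lt; rewrite -sliceB norm_le_slice.
have := hr (z' - z); rewrite -ball_normE /= sub0r normrN => /(_ hb).
rewrite /= subrK.
have -> : 'd (f \o slice I) z (z' - z) = (slice I z' - slice I z) * 'D_(1, 0) (f \o slice I) z.
  have {1}-> : z' - z = (z' - z).1 *: (1, 0) + (z' - z).2 *: (0, 1) :> R * R.
    by apply/eqP; rewrite xpair_eqE /= !scaler0 addr0 add0r ![_ *: _]mulr1 !eqxx.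
  rewrite linearD !linearZ /= -!deriveE // CR -sliceB /slice mulrDl.
  by rewrite -!scalerAl mul1r.
move=> /le_trans; apply; rewrite ler_wpM2l ?(ltW e0) // -sliceB.
exact: norm_le_slice.
Qed.

Lemma slice_derives_CR I f z d : imag_sphere I ->
  slice_derives I f (slice I z) d ->
  'D_(1, 0) (f \o slice I) z = d /\
  'D_(0, 1) (f \o slice I) z = I * d.
Proof.
move=> Is /(slice_derives_diff Is) [df dE].
rewrite !deriveE // dE /slice_mul /slice /= !scale0r !scale1r addr0 add0r.
by rewrite mul1r.
Qed.

Lemma slice_regularP (D : set H) f : slice_regular D f <->
  forall I q, imag_sphere I -> slice_line I q -> D q ->
    exists d, slice_derives I f q d.
Proof.
split=> [fr I q Is [z _ <-] Dz|fd I Is z Dz].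
  have [df CR] := fr I Is z Dz; eexists; exact: diff_slice_derives.
have [d hd] := fd I _ Is (ex_intro2 _ _ z Logic.I erefl) Dz.
have [df dE] := slice_derives_diff Is hd; split=> //.
by have [-> ->] := slice_derives_CR Is hd; apply/imag_sphere_CR.
Qed.

Lemma imag_unitP q : imag_sphere (imag_unit q) /\
  q = slice (imag_unit q) (qa q, `|imag_part q|).
Proof.
rewrite /imag_unit; case: ifPn => [/eqP e|n0].
  split.
    rewrite /imag_sphere /= expr2.
    by congr Quat => /=; rewrite ?(mul0r, mulr0, mulr1, subr0, addr0, oppr0, sub0r, subrr).
  rewrite /slice /= e normr0 scale0r addr0 qalgE.
  by case: q e => a b c d [-> -> ->].
have N0 : `|imag_part q| != 0 by rewrite normr_eq0.
split; last first.
  rewrite /slice /= scalerA divff // scale1r qalgE.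
  by case: q {n0 N0} => a b c d; congr Quat; rewrite /= ?add0r ?addr0.
rewrite /imag_sphere /= expr2 -scalerAl -scalerAr scalerA.
have -> : imag_part q * imag_part q = (- `|imag_part q| ^+ 2)%:A.
  rewrite qnorm_sq qalgE; case: q {n0 N0} => a b c d.
  by congr Quat; rewrite /qnorm2 /=; ring.
by rewrite scalerA mulrN -expr2 -exprMn mulVf // expr1n scaleN1r.
Qed.

Lemma slice_line_comm I p q : slice_line I p -> slice_line I q -> p * q = q * p.
Proof. by move=> [z _ <-] [h _ <-]; exact: slice_comm. Qed.

Lemma slice_line_alg I (k : R) : slice_line I k%:A.
Proof. by exists (k, 0) => //; rewrite /slice /= scale0r addr0. Qed.

Lemma slice_lineD I p q : slice_line I p -> slice_line I q -> slice_line I (p + q).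
Proof. by move=> [z _ <-] [h _ <-]; exists (z + h); rewrite ?sliceD. Qed.

Lemma slice_lineB I p q : slice_line I p -> slice_line I q -> slice_line I (p - q).
Proof. by move=> [z _ <-] [h _ <-]; exists (z - h); rewrite ?sliceB. Qed.

Lemma slice_lineZ I (k : R) p : slice_line I p -> slice_line I (k *: p).
Proof. by move=> [z _ <-]; exists (k *: z); rewrite ?sliceZ. Qed.

Lemma sliceM I z h : imag_sphere I -> slice I z * slice I h =
  slice I (z.1 * h.1 - z.2 * h.2, z.1 * h.2 + z.2 * h.1).
Proof.
rewrite /imag_sphere /= expr2 => Is.
rewrite /slice /= mulrDl !mulrDr -!scalerAl -!scalerAr !mul1r !mulr1 Is !scalerA.
rewrite scalerBl scalerDl scalerN -!addrA; congr (_ + _).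
by rewrite [in RHS]addrC -[RHS]addrA.
Qed.

End SliceDifferentiability.

(** * Regular operations on series *)

Section SeriesRepresentation.
Variable R : realType.
Local Notation H := (quat R).
Implicit Types (a b c : fps H) (f g : H -> H) (p q u v w I : H) (r t x : R).

Definition represented_by f a :=
  fps_conv a /\ forall q, `|q| < 1 -> f q = fps_eval a q.

Lemma represented_by_eval a : fps_conv a -> represented_by (fps_eval a) a.
Proof. by []. Qed.

Lemma fps_eval_bounded a r : fps_conv a -> r < 1 ->
  exists2 C, 0 <= C & forall q, `|q| <= r -> `|fps_eval a q| <= C.
Proof.
move=> ca r1; have [r0|r0] := ltP r 0.
  by exists 0 => // q /le_lt_trans/(_ r0); rewrite ltNge normr_ge0.
have [|s rs s01] := @between_lt1 R r; first by rewrite r0.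
have /andP[s0 s1] := s01.
have [C C0 hC] := fps_conv_coef ca s01.
have rs0 : 0 < 1 - r / s by rewrite subr_gt0 ltr_pdivrMr // mul1r.
exists (C / (1 - r / s)) => [|q qr]; first by rewrite divr_ge0 // ltW.
apply: le_trans (norm_fps_eval_le ca _ hC) _.
  by rewrite s1 (le_lt_trans qr).
have qs : `|q| / s <= r / s by rewrite ler_wpM2r // invr_ge0 ltW.
rewrite ler_wpM2l // lef_pV2 ?posrE ?lerD2l ?lerN2 //.
by rewrite (lt_le_trans rs0) // lerD2l lerN2.
Qed.

(** Here [p - q] commutes with [p], so the factorization of a - a(q) may be evaluated at [p] factor
    by factor. *)
Lemma fps_eval_commE a p q : fps_conv a -> `|p| < 1 -> `|q| < 1 -> p * q = q * p ->
  fps_eval a p = fps_eval a q + (p - q) * fps_eval (fps_quot q a) p.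
Proof.
move=> ca p1 q1 pq; have cR := fps_conv_quot q1 ca.
have cX : fps_conv (fpsX H - fps_const q).
  by apply: fps_convB; [exact: fps_convX|exact: fps_conv_const].
have XE : fps_eval (fpsX H - fps_const q) p = p - q.
  by rewrite fps_evalB ?fps_evalX ?fps_eval_const //;
    [exact: fps_convX|exact: fps_conv_const].
have := fps_quotE ca q1 => /(congr1 (fun b => fps_eval b p)).
rewrite fps_evalM_comm // XE; last by rewrite mulrBl mulrBr pq.
rewrite fps_evalB //; last exact: fps_conv_const.
by rewrite fps_eval_const => ->; rewrite addrC subrK.
Qed.

(** Dividing twice by X - q leaves the remainder (p - q)^2 times a function that is bounded on a
    ball around [q]. *)
Lemma represented_slice_derives f a I q : represented_by f a -> imag_sphere I ->
  slice_line I q -> `|q| < 1 -> slice_derives I f q (fps_eval (fps_deriv a) q).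
Proof.
move=> [ca fE] Is Iq q1 e e0.
have [|r qr /andP[r0 r1]] := @between_lt1 R `|q|; first by rewrite normr_ge0.
have cR := fps_conv_quot q1 ca; have cRR := fps_conv_quot q1 cR.
have [C C0 hC] := fps_eval_bounded cRR r1.
exists (Num.min (r - `|q|) (e / (C + 1))).
  by rewrite lt_min subr_gt0 qr divr_gt0 // ltr_pwDr.
move=> p Ip; rewrite lt_min => /andP[pr pe].
have pr' : `|p| <= r.
  by rewrite -[p](subrK q); apply: le_trans (ler_normD _ _) _; lra.
have p1 : `|p| < 1 by apply: le_lt_trans r1.
have pq := slice_line_comm Ip Iq.
rewrite !fE // fps_deriv_eval // (fps_eval_commE ca p1 q1 pq) [fps_eval a q + _]addrC addrK.
rewrite (fps_eval_commE cR p1 q1 pq) mulrDr [_ * fps_eval _ q + _]addrC addrK.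
rewrite !qnormM mulrC ler_wpM2r //; apply: (@le_trans _ _ (e / (C + 1) * (C + 1))).
  by apply: ler_pM => //; rewrite ?(ltW pe) //; apply: le_trans (hC _ pr') _; rewrite lerDl.
by rewrite divfK // gt_eqF // ltr_pwDr.
Qed.

Lemma represented_regular f a : represented_by f a -> slice_regular (@unit_ball R) f.
Proof.
move=> fa; apply/slice_regularP => I q Is Iq q1.
by eexists; apply: represented_slice_derives fa Is Iq q1.
Qed.

Lemma represented_cullen f a : represented_by f a ->
  represented_by (cullen_derivative f) (fps_deriv a).
Proof.
move=> fa; split=> [|q q1]; first by apply: fps_conv_deriv; case: fa.
rewrite /cullen_derivative; have [Is qE] := imag_unitP q.
set I := imag_unit q in Is qE *; set z := (qa q, _) in qE *.
have Iq : slice_line I q by exists z.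
have := represented_slice_derives fa Is Iq q1.
rewrite {1}qE => /(slice_derives_CR Is) [-> ->].
move: Is; rewrite /imag_sphere /= expr2 mulrA => ->.
rewrite mulN1r opprK -[fps_eval _ _]scale1r -scalerDl scalerA mulVf ?scale1r //.
Qed.

(** Near 0 a nonzero constant coefficient would dominate the rest; once it vanishes, the series is
    divided by the variable. Real points lie on every slice, so this identifies expansions obtained
    on different slices. *)
Lemma fps_eq0_real c x : fps_conv c -> 0 < x <= 1 ->
  (forall t, 0 < t < x -> fps_eval c t%:A = 0) -> c = 0.
Proof.
move=> cc /andP[x0 x1] c0; apply: fpsP => n.
have lt1 t : 0 < t < x -> `|t%:A : H| < 1.
  by move=> /andP[t0 tx]; rewrite qnormA gtr0_norm // (lt_le_trans tx).
have z c' : fps_conv c' -> (forall t, 0 < t < x -> fps_eval c' t%:A = 0) ->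
    c' 0%N = 0.
  move=> cc' c'0; apply/eqP; rewrite -normr_le0 leNgt; apply/negP => n0.
  have [C C0 hC] := @fps_eval_bounded (fps_shift 1 c') 2^-1 (fps_conv_shift _ cc') ltac:(lra).
  pose t := Num.min (x / 2) (Num.min 2^-1 (`|c' 0%N| / (2 * (C + 1)))).
  have C1 : 0 < C + 1 by rewrite ltr_pwDr.
  have t0 : 0 < t by rewrite !lt_min; apply/and3P; split; rewrite ?divr_gt0 ?mulr_gt0.
  have tx : 0 < t < x.
    by rewrite t0 (le_lt_trans (_ : t <= x / 2)) ?ge_min ?lexx //; lra.
  have t2 : t <= 2^-1 by rewrite !ge_min lexx orbT.
  have tc : t <= `|c' 0%N| / (2 * (C + 1)) by rewrite !ge_min lexx !orbT.
  have := c'0 t tx; rewrite fps_eval_shift ?lt1 // => /eqP.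
  rewrite addr_eq0 => /eqP /(congr1 (fun y : H => `|y|)).
  rewrite normrN qnormM qnormA gtr0_norm // => E.
  have := hC t%:A; rewrite qnormA gtr0_norm // => /(_ t2) hle.
  move: tc; rewrite ler_pdivlMr ?mulr_gt0 // E.
  have := normr_ge0 (fps_eval (fps_shift 1 c') t%:A).
  by rewrite E in n0; move: n0 hle; move: `|_| => y; nra.
elim: n c cc c0 => [|n IH] c cc c0; first exact: z.
have -> : c n.+1 = fps_shift 1 c n by rewrite /= add1n.
apply: IH => [|t tx]; first exact: fps_conv_shift.
have := c0 t tx; rewrite fps_eval_shift ?lt1 // z // add0r => /eqP.
rewrite qmul_eq0 => /orP[|/eqP //].
by rewrite -normr_eq0 qnormA; case/andP: tx => t0; rewrite gtr0_norm ?gt_eqF.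
Qed.

Lemma fps_eq_real a b x : fps_conv a -> fps_conv b -> 0 < x <= 1 ->
  (forall t, 0 < t < x -> fps_eval a t%:A = fps_eval b t%:A) -> a = b.
Proof.
move=> ca cb x01 ab; apply/eqP; rewrite -subr_eq0; apply/eqP.
apply: (@fps_eq0_real _ x) => //; first exact: fps_convB.
move=> t tx; rewrite fps_evalB ?ab ?subrr //.
move: tx x01 => /andP[t0 tx] /andP[_ x1].
by rewrite qnormA gtr0_norm // (lt_le_trans tx).
Qed.

Lemma fps_eval_inj a b : fps_conv a -> fps_conv b ->
  (forall q, `|q| < 1 -> fps_eval a q = fps_eval b q) -> a = b.
Proof.
move=> ca cb ab; apply: (@fps_eq_real _ _ 1) => //; first by rewrite ltr01 lexx.
by move=> t /andP[t0 t1]; apply: ab; rewrite qnormA gtr0_norm.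
Qed.

(** Convergence at the real point [r] bounds all but finitely many terms; the remaining ones are
    bounded by their sum. *)
Lemma cvg_pseries_conv (a : nat -> H) :
  (forall q, `|q| < 1 -> cvgn (pseries a q)) -> fps_conv (Fps a).
Proof.
move=> ha r /andP[r0 r1].
have := ha r%:A; rewrite qnormA gtr0_norm // => /(_ r1) /cvg_series_cvg_0.
move=> /cvgrPdist_le /(_ 1 ltr01) [N _ hN].
exists (1 + \sum_(i < N) `|a i| * r ^+ i) => n.
have E : `|a n| * r ^+ n = `|r%:A ^+ n * a n|.
  by rewrite qnormM qnormX qnormA gtr0_norm // mulrC.
have S0 (P : pred 'I_N) : 0 <= \sum_(i < N | P i) `|a i| * r ^+ i.
  by apply: sumr_ge0 => i _; rewrite mulr_ge0 // exprn_ge0 // ltW.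
have [Nn|nN] := leqP N n.
  have := hN n Nn; rewrite /= sub0r normrN -E /= => le.
  by apply: le_trans le _; rewrite lerDl S0.
by rewrite (bigD1 (Ordinal nN)) //= addrCA lerDl addr_ge0.
Qed.

Lemma has_pseriesP f (a : nat -> H) : has_pseries f a <-> represented_by f (Fps a).
Proof.
split=> [fa|[ca fE] q q1]; last by rewrite fE //; exact: (fps_eval_cvg ca q1).
split=> [|q q1]; first by apply: cvg_pseries_conv => q q1; apply: cvgP (fa q q1).
by apply/esym/fps_eval_unique; exact: fa.
Qed.

Lemma represented_coef f a : represented_by f a -> pseries_coef f = a.
Proof.
case: a => a fa; have /getI : has_pseries f a by apply/has_pseriesP.
rewrite -/(pseries_coef f) => /= /has_pseriesP [cb fE].
have [ca fE'] := fa.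
suff E : Fps a = Fps (pseries_coef f) by case: E.
by apply: fps_eval_inj => // q q1; rewrite -fE // -fE'.
Qed.

Lemma represented_unique f a b : represented_by f a -> represented_by f b -> a = b.
Proof.
by move=> /represented_coef + /represented_coef; case: a b => [a] [b] /= -> ->.
Qed.

Lemma represented_ext f g a : (forall q, `|q| < 1 -> f q = g q) ->
  represented_by f a -> represented_by g a.
Proof. by move=> fg [ca fE]; split=> // q q1; rewrite -fg // fE. Qed.

Lemma represented_const u : represented_by (cst u) (fps_const u).
Proof. by split=> [|q q1]; [exact: fps_conv_const|rewrite fps_eval_const]. Qed.

Lemma represented_id : represented_by id (fpsX H).
Proof. by split=> [|q q1]; [exact: fps_convX|rewrite fps_evalX]. Qed.

Lemma represented_sub f g a b : represented_by f a -> represented_by g b ->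
  represented_by (fun q => f q - g q) (a - b).
Proof.
move=> [ca fE] [cb gE]; split=> [|q q1]; first exact: fps_convB.
by rewrite fps_evalB // fE // gE.
Qed.

Lemma represented_mulr f a u : represented_by f a ->
  represented_by (fun q => f q * u) (a * fps_const u).
Proof.
move=> [ca fE]; split=> [|q q1]; last by rewrite fps_evalMC // fE.
by apply: fps_convM => //; exact: fps_conv_const.
Qed.

Lemma represented_reg_mul f g a b : represented_by f a -> represented_by g b ->
  represented_by (f ** g) (a * b).
Proof.
move=> fa gb; rewrite /reg_mul (represented_coef fa) (represented_coef gb).
by split=> //; apply: fps_convM; [case: fa|case: gb].
Qed.

Lemma represented_reg_conj f a : represented_by f a ->
  represented_by (reg_conj f) (fps_conj a).
Proof.
move=> fa; rewrite /reg_conj (represented_coef fa).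
by split=> //; apply: fps_conv_conj; case: fa.
Qed.

Lemma represented_reg_symm f a : represented_by f a ->
  represented_by (reg_symm f) (a * fps_conj a).
Proof.
by move=> fa; apply: represented_reg_mul => //; exact: represented_reg_conj.
Qed.

Lemma fps_conjM a b : fps_conj (a * b) = fps_conj b * fps_conj a.
Proof.
apply: fpsP => n; rewrite [LHS]/= [RHS]coefMf.
rewrite (big_morph _ (@qconjD R) (qconj0 R)) (reindex_inj rev_ord_inj) /=.
by apply: eq_bigr => i _; rewrite qconjM subSS subKn // -ltnS.
Qed.

Lemma fps_conjK : involutive (@fps_conj R).
Proof. by move=> a; apply: fpsP => n /=; rewrite qconjK. Qed.

Lemma fps_conj1 : fps_conj 1 = 1 :> fps H.
Proof. by apply: fpsP => -[|n] /=; rewrite ?qconj1 ?qconj0. Qed.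

Lemma fps_conj_const u : fps_conj (fps_const u) = fps_const (qconj u).
Proof. by apply: fpsP => -[|n] /=; rewrite ?qconj0. Qed.

Lemma fps_conjX : fps_conj (fpsX H) = fpsX H.
Proof. by apply: fpsP => -[|[|n]] /=; rewrite ?qconj1 ?qconj0. Qed.

Lemma fps_conjD a b : fps_conj (a + b) = fps_conj a + fps_conj b.
Proof. by apply: fpsP => n /=; rewrite qconjD. Qed.

Lemma fps_conjN a : fps_conj (- a) = - fps_conj a.
Proof. by apply: fpsP => n /=; rewrite qconjN. Qed.

Lemma qconj_fixed q : qconj q = q -> q = (qa q)%:A.
Proof.
case: q => a b c d [/= b0 c0 d0]; rewrite qalgE.
by congr Quat; [move: b0|move: c0|move: d0]; lra.
Qed.

Lemma fps_real_comm a b : fps_conj a = a -> a * b = b * a.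
Proof.
move=> ra; apply: fpsP => n; rewrite !coefMf (reindex_inj rev_ord_inj) /=.
apply: eq_bigr => i _; rewrite subSS subKn; last by rewrite -ltnS.
rewrite (@qconj_fixed (a (n - i)%N)) ?qalg_comm //.
by rewrite -[in RHS]ra.
Qed.

Lemma fps_real_eval_comm a q : fps_conj a = a -> fps_conv a -> `|q| < 1 ->
  q * fps_eval a q = fps_eval a q * q.
Proof.
move=> ra ca q1.
have c := fps_eval_cvg ca q1; have c1 := @cvg_qmull R _ _ q c.
have c2 := @cvg_qmulr R _ _ q c.
suff E : (fun n => q * pseries a q n) = (fun n => pseries a q n * q).
  by move: c1; rewrite E => c1; exact: (cvg_unique (@norm_hausdorff _ _) c1 c2).
apply/funext => n; rewrite /pseries /series mulr_sumr mulr_suml.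
apply: eq_bigr => i _; rewrite mulrA -exprS exprSr -!mulrA; congr (_ * _).
by rewrite (@qconj_fixed (a i)) ?qalg_comm // -[in RHS]ra.
Qed.

(** The reciprocal is defined pointwise, from the symmetrization. That series has real coefficients,
    so its value at [q] commutes with [q], and evaluating f^c = f^s * b is multiplicative. It is
    invertible as well, hence has no zero in the ball. *)
Lemma represented_reg_recip f a b : represented_by f a -> fps_conv b ->
  a * b = 1 -> b * a = 1 -> represented_by (reg_recip f) b.
Proof.
move=> fa cb ab ba; split=> // q q1; rewrite /reg_recip.
have [cN ->] := represented_reg_symm fa; last by [].
have [cc ->] := represented_reg_conj fa; last by [].
set N := a * _ in cN *.
have rN : fps_conj N = N by rewrite fps_conjM fps_conjK.
have -> : fps_conj a = N * b.
  by rewrite (fps_real_comm _ rN) mulrA ba mul1r.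
have qN := fps_real_eval_comm rN cN q1.
rewrite fps_evalM_comm // mulKr // qunit.
have cbb : fps_conv (fps_conj b * b) by apply: fps_convM => //; apply: fps_conv_conj.
have E : N * (fps_conj b * b) = 1.
  by rewrite -mulrA [_ * (_ * b)]mulrA -fps_conjM ba fps_conj1 mul1r ab.
apply/eqP => N0; have := fps_evalM0 cN cbb q1 N0; rewrite E fps_eval1.
by move/eqP; rewrite oner_eq0.
Qed.

End SeriesRepresentation.

Ltac quat_field :=
  repeat match goal with x : quat _ |- _ => destruct x end;
  congr Quat => /=; field.

(** * Bisection of the unit square *)

Section Bisection.
Variable R : realType.
Implicit Types (P : R -> R -> R -> Prop) (x y s : R).

Lemma half_pow_cvg0 (e : R) : 0 < e -> exists n, 2^-1 ^+ n < e.
Proof.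
move=> e0; have h : `|2^-1 : R| < 1 by rewrite ger0_norm; lra.
have /cvgrPdist_lt /(_ e e0) [n _ hn] := cvg_expr h.
by exists n; have := hn n (leqnn n); rewrite /= sub0r normrN ger0_norm ?exprn_ge0.
Qed.

(** If [P] fails on the whole square, it fails on one of the four quarters, and so on; the failing
    squares shrink to a point, around which [P] holds. *)
Lemma square_bisection P :
  (forall x y s, P x y (s / 2) -> P (x + s / 2) y (s / 2) ->
     P x (y + s / 2) (s / 2) -> P (x + s / 2) (y + s / 2) (s / 2) -> P x y s) ->
  (forall px py, 0 <= px <= 1 -> 0 <= py <= 1 -> exists2 r, 0 < r &
     forall x y s, 0 < s < r -> 0 <= x <= px -> px <= x + s <= 1 ->
       0 <= y <= py -> py <= y + s <= 1 -> P x y s) ->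
  P 0 0 1.
Proof.
move=> Psplit Ploc; apply: contrapT => nP.
pose bad (c : R * R) (n : nat) := ~ P c.1 c.2 (2^-1 ^+ n).
have halfE n : (2^-1 : R) ^+ n / 2 = 2^-1 ^+ n.+1 by rewrite exprSr.
(* Stated for every square, failing or not, so that [choice] provides a total function to
   iterate. *)
have step (cn : (R * R) * nat) : exists c', let (c, n) := cn in
    bad c n -> bad c' n.+1 /\
    (c'.1 = c.1 \/ c'.1 = c.1 + 2^-1 ^+ n.+1) /\
    (c'.2 = c.2 \/ c'.2 = c.2 + 2^-1 ^+ n.+1).
  case: cn => [[x y] n]; have [badn|] := pselect (bad (x, y) n); last by exists (x, y).
  apply: contrapT => noc; apply: badn; rewrite /=.
  have g x' y' : (x' = x \/ x' = x + 2^-1 ^+ n.+1) ->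
      (y' = y \/ y' = y + 2^-1 ^+ n.+1) -> P x' y' (2^-1 ^+ n.+1).
    move=> hx hy; apply: contrapT => nP'; apply: noc.
    by exists (x', y') => _; split.
  by apply: Psplit; rewrite halfE; apply: g; by [left|right].
have [F hF] := choice step.
pose c := fix c n := if n is m.+1 then F (c m, m) else (0, 0).
have badc n : bad (c n) n.
  by elim: n => [|n IH]; [rewrite /bad /= expr0|have [] := hF (c n, n) IH].
have stepc n : ((c n.+1).1 = (c n).1 \/ (c n.+1).1 = (c n).1 + 2^-1 ^+ n.+1) /\
    ((c n.+1).2 = (c n).2 \/ (c n.+1).2 = (c n).2 + 2^-1 ^+ n.+1).
  by have [] := hF (c n, n) (badc n).
(* One coordinate at a time: the lower ends increase and the upper ends decrease, and the limit of
   the lower ends lies in all the intervals. *)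
have nested (u : nat -> R) : u 0%N = 0 ->
    (forall n, u n.+1 = u n \/ u n.+1 = u n + 2^-1 ^+ n.+1) ->
    exists p, forall n, 0 <= u n <= p /\ p <= u n + 2^-1 ^+ n <= 1.
  move=> u0 su; have h0 n : 0 <= (2^-1 : R) ^+ n by rewrite exprn_ge0.
  have hh n : (2^-1 : R) ^+ n = 2^-1 ^+ n.+1 + 2^-1 ^+ n.+1.
    by rewrite exprSr -mulrDr; have -> : (2^-1 + 2^-1 = 1 :> R); [lra|rewrite mulr1].
  have inc n k : u n <= u (n + k)%N.
    elim: k => [|k IH]; rewrite ?addn0 // addnS; apply: le_trans IH _.
    by have [->|->] := su (n + k)%N; rewrite ?lerDl.
  have dec n k : u (n + k)%N + 2^-1 ^+ (n + k) <= u n + 2^-1 ^+ n.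
    elim: k => [|k IH]; rewrite ?addn0 // addnS; apply: le_trans IH.
    rewrite (hh (n + k)%N); have := h0 (n + k).+1.
    by have [->|->] := su (n + k)%N; lra.
  have le m n : u m <= u n + 2^-1 ^+ n.
    have [/subnKC <-|/ltnW/subnKC <-] := leqP n m.
      by apply: le_trans (dec n (m - n)%N); rewrite lerDl.
    by apply: le_trans (inc m (n - m)%N) _; rewrite lerDl.
  have ndu : nondecreasing_seq u.
    by move=> m n /subnKC <-; exact: inc.
  have cu : cvgn u.
    apply: nondecreasing_is_cvgn => //; exists (u 0%N + 2^-1 ^+ 0) => _ [m _ <-].
    exact: le.
  exists (limn u) => n; split; apply/andP; split.
  - by rewrite -u0; apply: ndu.
  - exact: nondecreasing_cvgn_le.
  - by apply: limr_le => //; apply: nearW => m; exact: le.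
  - by have := dec 0%N n; rewrite add0n u0 expr0 add0r.
have [px hx] := nested (fun n => (c n).1) erefl (fun n => (stepc n).1).
have [py hy] := nested (fun n => (c n).2) erefl (fun n => (stepc n).2).
have px01 : 0 <= px <= 1.
  by have [] := hx 0%N; rewrite /= expr0 add0r => /andP[_ ->] /andP[->].
have py01 : 0 <= py <= 1.
  by have [] := hy 0%N; rewrite /= expr0 add0r => /andP[_ ->] /andP[->].
have [r r0 hr] := Ploc px py px01 py01.
have [n nr] := half_pow_cvg0 r0.
have [x1 x2] := hx n; have [y1 y2] := hy n.
by apply: (badc n); apply: hr; rewrite ?exprn_gt0.
Qed.

End Bisection.

(** * Goursat's theorem *)

Section Goursat.
Variable R : realType.
Local Notation H := (quat R).
Variables (I : H) (g : H -> H).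
Hypothesis I_imag : imag_sphere I.
Implicit Types (gamma : R -> H) (a s x y L e : R) (m n : nat) (p q d : H).

Definition path_node a s m (i : nat) : R := a + i%:R * (s / 2 ^+ m).

(* Dyadic nodes make the subdivision of a square exact at every finite level,
   so that no integral is needed. *)
Definition path_sum gamma a s m : H := \sum_(i < 2 ^ m)
  (gamma (path_node a s m i.+1) - gamma (path_node a s m i)) *
    g (gamma (path_node a s m i)).

Lemma path_node0 a s m : path_node a s m 0 = a.
Proof. by rewrite /path_node mul0r addr0. Qed.

Lemma path_node_end a s m : path_node a s m (2 ^ m) = a + s.
Proof. by rewrite /path_node natrX mulrC divfK // expf_neq0. Qed.

Lemma path_node_le a s m i : 0 <= s -> (i <= 2 ^ m)%N ->
  a <= path_node a s m i <= a + s.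
Proof.
move=> s0 iN; have h0 : 0 <= s / 2 ^+ m by rewrite divr_ge0 ?exprn_ge0.
rewrite -[X in _ && (_ <= X)](path_node_end a s m) /path_node lerDl lerD2l.
by rewrite mulr_ge0 //= ler_wpM2r // ler_nat.
Qed.

Lemma path_nodeS a s m i : path_node a s m i.+1 - path_node a s m i = s / 2 ^+ m.
Proof. by rewrite /path_node -natr1 mulrDl mul1r opprD addrACA subrr add0r addrC addKr. Qed.

Lemma path_sum_split gamma a s m :
  path_sum gamma a s m.+1 =
  path_sum gamma a (s / 2) m + path_sum gamma (a + s / 2) (s / 2) m.
Proof.
have h1 i : path_node a s m.+1 i = path_node a (s / 2) m i.
  by rewrite /path_node exprS invfM (mulrA s).
have h2 i : path_node a s m.+1 (2 ^ m + i) = path_node (a + s / 2) (s / 2) m i.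
  rewrite h1 /path_node natrD mulrDl addrA; congr (_ + _).
  by rewrite -/(path_node a (s / 2) m (2 ^ m)) path_node_end.
rewrite /path_sum expnS mul2n -addnn big_split_ord /=; congr (_ + _).
  by apply: eq_bigr => i _; rewrite !h1.
by apply: eq_bigr => i _; rewrite -addnS !h2.
Qed.

(* Up to second order the summand is the increment of this primitive. *)
Definition local_primitive q d p : H := p * (g q - q * d) + 2^-1 *: (p * p * d).

(** For the affine model g(q) + (p - q) d, a summand misses the increment of the primitive by half
    of a squared step times d. The first error term collects these and vanishes as [m] grows; the
    second comes from replacing [g] by its affine model. *)
Lemma path_sum_approx gamma a s L D e q d m :
  0 <= s -> 0 <= L -> 0 <= e -> slice_line I q ->
  (forall t, a <= t <= a + s -> slice_line I (gamma t)) ->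
  (forall t u, a <= t <= a + s -> a <= u <= a + s ->
     `|gamma t - gamma u| <= L * `|t - u|) ->
  (forall t, a <= t <= a + s -> `|g (gamma t) - g q - (gamma t - q) * d| <= e * D) ->
  `|path_sum gamma a s m -
    (local_primitive q d (gamma (a + s)) - local_primitive q d (gamma a))|
  <= (L * s) ^+ 2 * `|d| / 2 ^+ m + e * D * L * s.
Proof.
move=> s0 L0 e0 Iq Ig Lg dg; have N0 : (2 : R) ^+ m != 0 by rewrite expf_neq0.
have h0 : 0 <= s / 2 ^+ m by rewrite divr_ge0 ?exprn_ge0.
pose z i := gamma (path_node a s m i).
have -> : local_primitive q d (gamma (a + s)) - local_primitive q d (gamma a) =
    \sum_(i < 2 ^ m) (local_primitive q d (z i.+1) - local_primitive q d (z i)).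
  rewrite -(big_mkord xpredT (fun i => local_primitive q d (z i.+1) - local_primitive q d (z i))).
  by rewrite telescope_sumr // /z path_node_end path_node0.
rewrite /path_sum -sumrB.
have term i : (i < 2 ^ m)%N -> `|(z i.+1 - z i) * g (z i) -
    (local_primitive q d (z i.+1) - local_primitive q d (z i))| <=
    (L * (s / 2 ^+ m)) ^+ 2 * `|d| + e * D * (L * (s / 2 ^+ m)).
  move=> iN; have n1 := path_node_le a s0 iN; have n0 := path_node_le a s0 (ltnW iN).
  have dz : `|z i.+1 - z i| <= L * (s / 2 ^+ m).
    by apply: le_trans (Lg _ _ n1 n0) _; rewrite path_nodeS ger0_norm.
  have c : z i.+1 * z i = z i * z i.+1 by apply: slice_line_comm (Ig _ n1) (Ig _ n0).
  have cq : q * z i = z i * q by apply: slice_line_comm Iq (Ig _ n0).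
  have cq1 : q * z i.+1 = z i.+1 * q by apply: slice_line_comm Iq (Ig _ n1).
  have -> : (z i.+1 - z i) * g (z i) -
      (local_primitive q d (z i.+1) - local_primitive q d (z i)) =
      (z i.+1 - z i) * (g (z i) - g q - (z i - q) * d) -
      2^-1 *: ((z i.+1 - z i) * (z i.+1 - z i) * d).
    rewrite /local_primitive; move: (z i.+1) (z i) (g _) (g q) c => b1 b0 G Gq c.
    rewrite !mulrBl !mulrBr.
    rewrite !mulrBl !mulrA c.
    move: (b1 * G) (b0 * G) (b1 * Gq) (b0 * Gq) (b1 * q * d) (b0 * q * d) => t1 t2 t3 t4 t5 t6.
    move: (b0 * b1 * d) (b1 * b1 * d) (b0 * b0 * d) => t7 t8 t9.
    by clear; quat_field.
  apply: le_trans (ler_normB _ _) _; rewrite addrC; apply: lerD; last first.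
    by rewrite qnormM mulrC; apply: ler_pM => //; apply: dg.
  rewrite normrZ !qnormM mulrA ler_wpM2r //.
  rewrite (_ : `|2^-1 : R| = 2^-1); last by rewrite ger0_norm.
  have := ler_pM (normr_ge0 _) (normr_ge0 _) dz dz; rewrite -expr2.
  have := normr_ge0 (z i.+1 - z i); move: `|_| => t; nra.
apply: le_trans (ler_norm_sum _ _ _) _.
apply: (@le_trans _ _ (\sum_(i < 2 ^ m)
    ((L * (s / 2 ^+ m)) ^+ 2 * `|d| + e * D * (L * (s / 2 ^+ m))))).
  by apply: ler_sum => i _; apply: term.
rewrite sumr_const card_ord -[_ *+ (2 ^ m)]mulr_natr natrX.
rewrite le_eqVlt; apply/orP; left; apply/eqP; field.
exact: expf_neq0.
Qed.

Section Square.
Variables (Psi : R -> R -> H) (L : R).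
Hypothesis L_ge0 : 0 <= L.
Hypothesis Psi_line : forall x y, 0 <= x <= 1 -> 0 <= y <= 1 -> slice_line I (Psi x y).
Hypothesis Psi_lip : forall x y x' y', 0 <= x <= 1 -> 0 <= y <= 1 ->
  0 <= x' <= 1 -> 0 <= y' <= 1 ->
  `|Psi x y - Psi x' y'| <= L * (`|x - x'| + `|y - y'|).
Hypothesis g_derives : forall x y, 0 <= x <= 1 -> 0 <= y <= 1 ->
  exists d, slice_derives I g (Psi x y) d.

(** The Riemann sum of the integral of [g] along the image under [Psi] of the boundary of a square,
    counterclockwise. *)
Definition circulation x y s m :=
  path_sum (Psi^~ y) x s m + path_sum (Psi (x + s)) y s m -
  path_sum (Psi^~ (y + s)) x s m - path_sum (Psi x) y s m.

Lemma circulation_split x y s m : circulation x y s m.+1 =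
  circulation x y (s / 2) m + circulation (x + s / 2) y (s / 2) m +
  circulation x (y + s / 2) (s / 2) m + circulation (x + s / 2) (y + s / 2) (s / 2) m.
Proof.
have half u : u + s / 2 + s / 2 = u + s by rewrite -addrA -splitr.
rewrite /circulation !path_sum_split !half.
move: (path_sum (Psi^~ y) x _ _) (path_sum (Psi^~ y) (x + s / 2) _ _)
  (path_sum (Psi^~ (y + s / 2)) x _ _) (path_sum (Psi^~ (y + s / 2)) (x + s / 2) _ _)
  (path_sum (Psi^~ (y + s)) x _ _) (path_sum (Psi^~ (y + s)) (x + s / 2) _ _)
  (path_sum (Psi x) y _ _) (path_sum (Psi (x + s / 2)) y _ _)
  (path_sum (Psi (x + s)) y _ _) (path_sum (Psi x) (y + s / 2) _ _)
  (path_sum (Psi (x + s / 2)) (y + s / 2) _ _)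
  (path_sum (Psi (x + s)) (y + s / 2) _ _)
  => t1 t2 t3 t4 t5 t6 t7 t8 t9 t10 t11 t12.
by clear; quat_field.
Qed.

(** The increments of the primitive cancel around the square, so only the errors on the four sides
    remain. The size [r] depends on the centre only, whereas the level [M] may depend on the
    square. *)
Lemma circulation_local px py e : 0 < e -> 0 <= px <= 1 -> 0 <= py <= 1 ->
  exists2 r, 0 < r & forall x y s, 0 < s < r -> 0 <= x <= px -> px <= x + s <= 1 ->
    0 <= y <= py -> py <= y + s <= 1 ->
    exists M, forall m, (M <= m)%N -> `|circulation x y s m| <= e * s ^+ 2.
Proof.
move=> e0 px01 py01; have [d hd] := g_derives px01 py01.
set q := Psi px py in hd.
(* The affine model is off by at most e' * 2 L s on each side, of length at most L s: in total 8 e'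
   L^2 s^2, at most half of e s^2. *)
pose e' := e / (16 * (L ^+ 2 + 1)).
have L1 : 0 < L ^+ 2 + 1 by rewrite ltr_pwDr // sqr_ge0.
have e'0 : 0 < e' by rewrite divr_gt0 // mulr_gt0.
have [r r0 hr] := hd e' e'0.
exists (r / (2 * (L + 1))); first by rewrite divr_gt0 // mulr_gt0 // ltr_pwDr.
move=> x y s /andP[s0 sr] /andP[x0 xp] /andP[px1 x1] /andP[y0 yp] /andP[py1 y1].
have Lsr : L * (s + s) < r.
  move: sr; rewrite ltr_pdivlMr ?mulr_gt0 ?ltr_pwDr // => sr.
  by apply: le_lt_trans sr; nra.
have near u v : x <= u <= x + s -> y <= v <= y + s ->
    `|g (Psi u v) - g q - (Psi u v - q) * d| <= e' * (L * (s + s)).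
  move=> /andP[u0 u1] /andP[v0 v1].
  have u01 : 0 <= u <= 1 by apply/andP; split; lra.
  have v01 : 0 <= v <= 1 by apply/andP; split; lra.
  have le : `|Psi u v - q| <= L * (s + s).
    apply: le_trans (Psi_lip u01 v01 px01 py01) _; rewrite ler_wpM2l //.
    by apply: lerD; rewrite ler_norml; apply/andP; split; lra.
  apply: le_trans (hr _ (Psi_line u01 v01) (le_lt_trans le Lsr)) _.
  by rewrite ler_wpM2l // ltW.
have hx v : y <= v <= y + s -> forall m, `|path_sum (Psi^~ v) x s m -
    (local_primitive q d (Psi (x + s) v) - local_primitive q d (Psi x v))| <=
    (L * s) ^+ 2 * `|d| / 2 ^+ m + e' * (L * (s + s)) * L * s.
  move=> hv m; have v01 : 0 <= v <= 1.
    by case/andP: hv => ? ?; apply/andP; split; lra.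
  have b t : x <= t <= x + s -> 0 <= t <= 1.
    by case/andP=> ? ?; apply/andP; split; lra.
  apply: (path_sum_approx (gamma := Psi^~ v)) => //; rewrite ?(ltW s0) ?(ltW e'0) //.
  - exact: Psi_line.
  - by move=> t /b t01; exact: Psi_line.
  - move=> t u /b t01 /b u01; apply: le_trans (Psi_lip t01 v01 u01 v01) _.
    by rewrite subrr normr0 addr0.
  - by move=> t ht; exact: near.
have hy u : x <= u <= x + s -> forall m, `|path_sum (Psi u) y s m -
    (local_primitive q d (Psi u (y + s)) - local_primitive q d (Psi u y))| <=
    (L * s) ^+ 2 * `|d| / 2 ^+ m + e' * (L * (s + s)) * L * s.
  move=> hu m; have u01 : 0 <= u <= 1.
    by case/andP: hu => ? ?; apply/andP; split; lra.
  have b t : y <= t <= y + s -> 0 <= t <= 1.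
    by case/andP=> ? ?; apply/andP; split; lra.
  apply: (path_sum_approx (gamma := Psi u)) => //; rewrite ?(ltW s0) ?(ltW e'0) //.
  - exact: Psi_line.
  - by move=> t /b t01; exact: Psi_line.
  - move=> t v /b t01 /b v01; apply: le_trans (Psi_lip u01 t01 u01 v01) _.
    by rewrite subrr normr0 add0r.
  - by move=> t ht; exact: near.
(* The discretization errors of the four sides then use at most the other half of e s^2. *)
have e8 : 0 < e / (8 * (L ^+ 2 * `|d| + 1)).
  by rewrite divr_gt0 // mulr_gt0 // ltr_pwDr // mulr_ge0 ?sqr_ge0.
have [M hM] := half_pow_cvg0 e8; exists M => m Mm.
have hm : 4 * (L ^+ 2 * `|d| / 2 ^+ m) <= e / 2.
  have : (2 ^- m : R) <= 2^-1 ^+ M.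
    by rewrite -exprVn ler_wiXn2l //; lra.
  have D0 : 0 <= L ^+ 2 * `|d| by rewrite mulr_ge0 ?sqr_ge0.
  move: hM; rewrite ltr_pdivlMr ?mulr_gt0 ?ltr_pwDr //.
  have : 0 <= (2 ^- m : R) by rewrite invr_ge0 exprn_ge0.
  move: (2 ^- m : R) (2^-1 ^+ M) D0 => t T; move: (_ * `|d|) => D; nra.
have he : 8 * (e' * L ^+ 2) <= e / 2.
  have : e' * (16 * (L ^+ 2 + 1)) = e by rewrite divfK // gt_eqF // mulr_gt0.
  by have := sqr_ge0 L; move: (L ^+ 2) => l; nra.
have xx : x <= x <= x + s by rewrite lexx lerDl ltW.
have xs : x <= x + s <= x + s by rewrite lexx lerDl ltW.
have yy : y <= y <= y + s by rewrite lexx lerDl ltW.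
have ys : y <= y + s <= y + s by rewrite lexx lerDl ltW.
have b1 := hx y yy m; have b2 := hy (x + s) xs m.
have b3 := hx (y + s) ys m; have b4 := hy x xx m.
have -> : circulation x y s m =
   (path_sum (Psi^~ y) x s m -
     (local_primitive q d (Psi (x + s) y) - local_primitive q d (Psi x y))) +
   (path_sum (Psi (x + s)) y s m -
     (local_primitive q d (Psi (x + s) (y + s)) - local_primitive q d (Psi (x + s) y))) -
   (path_sum (Psi^~ (y + s)) x s m -
     (local_primitive q d (Psi (x + s) (y + s)) - local_primitive q d (Psi x (y + s)))) -
   (path_sum (Psi x) y s m -
     (local_primitive q d (Psi x (y + s)) - local_primitive q d (Psi x y))).
  rewrite /circulation.
  move: (path_sum (Psi^~ y) _ _ _) (path_sum (Psi (x + s)) _ _ _)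
    (path_sum (Psi^~ (y + s)) _ _ _) (path_sum (Psi x) _ _ _) => t1 t2 t3 t4.
  move: (local_primitive q d (Psi x y)) (local_primitive q d (Psi (x + s) y))
    (local_primitive q d (Psi x (y + s))) (local_primitive q d (Psi (x + s) (y + s)))
    => t5 t6 t7 t8.
  by clear; quat_field.
apply: le_trans (ler_normB _ _) _.
apply: (@le_trans _ _ (4 * ((L * s) ^+ 2 * `|d| / 2 ^+ m + e' * (L * (s + s)) * L * s))).
  have := ler_normB (path_sum (Psi^~ y) x s m -
     (local_primitive q d (Psi (x + s) y) - local_primitive q d (Psi x y)) +
   (path_sum (Psi (x + s)) y s m -
     (local_primitive q d (Psi (x + s) (y + s)) - local_primitive q d (Psi (x + s) y))))
   (path_sum (Psi^~ (y + s)) x s m -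
     (local_primitive q d (Psi (x + s) (y + s)) - local_primitive q d (Psi x (y + s)))).
  have := ler_normD (path_sum (Psi^~ y) x s m -
     (local_primitive q d (Psi (x + s) y) - local_primitive q d (Psi x y)))
   (path_sum (Psi (x + s)) y s m -
     (local_primitive q d (Psi (x + s) (y + s)) - local_primitive q d (Psi (x + s) y))).
  by move: b1 b2 b3 b4; lra.
have -> : 4 * ((L * s) ^+ 2 * `|d| / 2 ^+ m + e' * (L * (s + s)) * L * s) =
  (4 * (L ^+ 2 * `|d| / 2 ^+ m) + 8 * (e' * L ^+ 2)) * s ^+ 2 by ring.
by rewrite ler_wpM2r ?sqr_ge0 //; lra.
Qed.

(** A bound proportional to the area is preserved when four quarters are put together, so bisection
    carries the local estimate to the whole square. *)
Lemma goursat e : 0 < e ->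
  exists M, forall m, (M <= m)%N -> `|circulation 0 0 1 m| <= e.
Proof.
move=> e0; pose P x y s := exists M, forall m, (M <= m)%N ->
  `|circulation x y s m| <= e * s ^+ 2.
suff [M hM] : P 0 0 1 by exists M => m /hM; rewrite expr1n mulr1.
apply: square_bisection => [x y s [M1 h1] [M2 h2] [M3 h3] [M4 h4]|px py px01 py01].
  (* One level is added because splitting a square consumes one level of dyadic nodes. *)
  exists (M1 + M2 + M3 + M4).+1 => -[//|m]; rewrite ltnS => Mm.
  rewrite circulation_split.
  have {h1} := h1 m (leq_trans (leq_trans (leq_trans (leq_addr _ _) (leq_addr _ _)) (leq_addr _ _)) Mm).
  have {h2} := h2 m (leq_trans (leq_trans (leq_trans (leq_addl _ _) (leq_addr _ _)) (leq_addr _ _)) Mm).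
  have {h3} := h3 m (leq_trans (leq_trans (leq_addl _ _) (leq_addr _ _)) Mm).
  have {h4} := h4 m (leq_trans (leq_addl _ _) Mm).
  move: (circulation x y _ _) (circulation _ y _ _) (circulation x _ _ _) (circulation _ _ _ _) => c1 c2 c3 c4.
  have := ler_normD (c1 + c2 + c3) c4; have := ler_normD (c1 + c2) c3.
  have := ler_normD c1 c2; rewrite exprMn; move: (s ^+ 2) => S.
  have -> : (2^-1 : R) ^+ 2 = 4^-1 by field.
  lra.
exact: circulation_local.
Qed.

End Square.
End Goursat.

(** * Cauchy means and power series expansion *)

Section SliceCircle.
Variable R : realType.
Local Notation H := (quat R).
Variable I : H.
Hypothesis I_imag : imag_sphere I.
Implicit Types (f : H -> H) (p q d : H) (x y e r : R) (m n i : nat).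

Definition slice_circle y : H := slice I (cos (y * (2 * pi)), sin (y * (2 * pi))).

Lemma slice_circle_line y : slice_line I (slice_circle y).
Proof. by exists (cos (y * (2 * pi)), sin (y * (2 * pi))). Qed.

Lemma norm_slice_circle y : `|slice_circle y| = 1.
Proof.
apply/eqP; rewrite -(@eqrXn2 _ 2) // norm_slice_sq //= expr1n.
by rewrite cos2Dsin2.
Qed.

Lemma slice_circleD x y : slice_circle (x + y) = slice_circle x * slice_circle y.
Proof.
rewrite /slice_circle sliceM // mulrDl cosD sinD /=.
by congr (slice I (_, _)); rewrite addrC.
Qed.

Lemma slice_circle0 : slice_circle 0 = 1.
Proof. by rewrite /slice_circle mul0r cos0 sin0 /slice /= scale0r addr0 scale1r. Qed.

Lemma slice_circle_half : slice_circle 2^-1 = -1.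
Proof.
by rewrite /slice_circle mulrA mulVf ?pnatr_eq0 // mul1r cospi sinpi /slice /=
  scale0r addr0 scaleN1r.
Qed.

Lemma slice_circle1 : slice_circle 1 = 1.
Proof. by rewrite (splitr 1) mul1r slice_circleD slice_circle_half mulrNN mulr1. Qed.

Lemma slice_circleMn x n : slice_circle (n%:R * x) = slice_circle x ^+ n.
Proof.
elim: n => [|n IH]; first by rewrite mul0r slice_circle0 expr0.
by rewrite -natr1 mulrDl mul1r slice_circleD IH exprSr.
Qed.

Lemma lipschitz1_of_derive (h h' : R -> R) x y :
  (forall t : R, is_derive t (1 : R) h (h' t)) -> (forall t, `|h' t| <= 1) ->
  `|h x - h y| <= `|x - y|.
Proof.
move=> hd h1; wlog xy : x y / y <= x.
  move=> W; have [|/ltW] := leP y x; first exact: W.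
  by rewrite distrC (distrC x); exact: W.
have [|c _ ->] := @MVT_segment R h h' y x xy.
  apply: continuous_subspaceT => t.
  by apply: differentiable_continuous; apply/derivable1_diffP; have [] := hd t.
by rewrite normrM ler_piMl.
Qed.

(** A factor 2 pi comes from the parametrization by the unit interval, a factor 2 from comparing the
    modulus with the maximum norm. *)
Lemma slice_circle_lipschitz x y :
  `|slice_circle x - slice_circle y| <= 4 * pi * `|x - y|.
Proof.
rewrite /slice_circle -sliceB; apply: le_trans (norm_slice_le _ I_imag) _.
have -> : 4 * pi * `|x - y| = 2 * `|x * (2 * pi) - y * (2 * pi)|.
  rewrite -mulrBl normrM (@ger0_norm _ (2 * pi)); last by rewrite mulr_ge0 // pi_ge0.
  by ring.
rewrite ler_wpM2l // norm_pairE /= ge_max; apply/andP; split.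
  apply: (@lipschitz1_of_derive _ (fun t => - sin t)) => t.
  by rewrite normrN sin_max.
by apply: (@lipschitz1_of_derive _ cos) => t; rewrite cos_max.
Qed.

(** The quotient rule survives because the points of a slice commute with each other: a factor with
    values in the slice may stand on the left of [f] and be moved past [p - q]. *)
Lemma slice_derives_quotient f q z0 d : slice_line I q -> slice_line I z0 ->
  q != z0 -> slice_derives I f q d ->
  exists d', slice_derives I (fun p => (p - z0)^-1 * f p) q d'.
Proof.
move=> Iq I0 qz fd; set B := (q - z0)^-1.
exists (B * (d - B * f q)) => e e0.
have rho0 : 0 < `|q - z0| by rewrite normr_gt0 subr_eq0.
set rho := `|q - z0| in rho0.
have [r r0 hr] := fd (e * rho / 4) ltac:(by rewrite divr_gt0 // mulr_gt0).
(* Bounds the second-order remainder by C |p - q|^2, as |(p - z0)^-1| <= 2 / rho once |p - q| < rho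
   / 2. *)
pose C := 2 / rho * `|B| * `|d - B * f q|.
have C0 : 0 <= C by rewrite !mulr_ge0 // invr_ge0 ltW.
exists (Num.min r (Num.min (rho / 2) (e / (2 * (C + 1))))).
  by rewrite !lt_min r0 !divr_gt0 // mulr_gt0 // ltr_pwDr.
move=> p Ip; rewrite !lt_min => /and3P[pr prho pe].
have := hr p Ip pr; set E := f p - f q - (p - q) * d => hE.
have uq : q - z0 != 0 by rewrite subr_eq0.
have pz : rho / 2 <= `|p - z0|.
  have -> : p - z0 = (q - z0) - (q - p) by clear; quat_field.
  by apply: le_trans (lerB_dist _ _); rewrite (distrC q p) -/rho; lra.
have up : p - z0 != 0 by rewrite -normr_gt0; apply: lt_le_trans pz; rewrite divr_gt0.
set A := (p - z0)^-1.
have An : `|A| <= 2 / rho.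
  rewrite qnormV -[2 / rho]invrK lef_pV2 ?posrE ?invr_gt0 ?divr_gt0 ?normr_gt0 //.
  by rewrite invf_div.
have cu : (p - q) * (p - z0) = (p - z0) * (p - q).
  by apply: (@slice_line_comm _ I); apply: slice_lineB.
have cA : (p - q) * A = A * (p - q).
  by rewrite -[LHS](mulKr (up : p - z0 \is a GRing.unit)) (mulrA (p - z0)) -cu
    -(mulrA (p - q)) mulrV ?mulr1.
have AB : A - B = - ((p - q) * A * B).
  have -> : (p - q) * A * B = A * ((p - z0) - (q - z0)) * B.
    by rewrite cA; congr (_ * _ * _); clear; quat_field.
  by rewrite mulrBr mulrBl mulVr // mul1r -mulrA mulrV // mulr1 opprB.
have -> : A * f p - B * f q - (p - q) * (B * (d - B * f q)) =
    A * E - (p - q) * ((p - q) * A * B) * (d - B * f q).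
  have {}AB : (p - q) * A * B = B - A by rewrite -[LHS]opprK -AB opprB.
  rewrite /E AB; clear -cA AB.
  move: (p - q) A B (f p) (f q) cA AB => u A B fp fq cA AB.
  rewrite !(mulrBr, mulrBl, mulrA) -cA AB mulrBl.
  move: (A * fp) (A * fq) (B * fq) (u * A * d) (u * B * d) (u * B * B * fq)
    => t1 t2 t3 t4 t5 t6.
  by clear; quat_field.
apply: le_trans (ler_normB _ _) _.
have b1 : `|A * E| <= e / 2 * `|p - q|.
  rewrite qnormM; apply: le_trans (ler_pM _ _ An hE) _ => //.
  by rewrite le_eqVlt; apply/orP; left; apply/eqP; field; rewrite gt_eqF.
have b2 : `|(p - q) * ((p - q) * A * B) * (d - B * f q)| <= `|p - q| * (`|p - q| * C).
  rewrite !qnormM -!mulrA !ler_wpM2l // /C -!mulrA.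
  by rewrite [leRHS]mulrA ler_wpM2r // mulr_ge0.
have b3 : `|p - q| * C <= e / 2.
  move: pe; rewrite ltr_pdivlMr ?mulr_gt0 ?ltr_pwDr // => pe.
  have := normr_ge0 (p - q); move: pe; move: `|p - q| => t; nra.
apply: le_trans (lerD b1 b2) _.
have := ler_wpM2l (normr_ge0 (p - q)) b3; lra.
Qed.

End SliceCircle.

Lemma qinvZ (R : realType) (k : R) (q : quat R) : k != 0 ->
  (k *: q)^-1 = k^-1 *: q^-1.
Proof.
move=> k0; have [->|q0] := eqVneq q 0; first by rewrite scaler0 invr0 scaler0.
have kq0 : k *: q != 0 by rewrite scaler_eq0 negb_or k0.
apply: (qmulI kq0); rewrite mulrV // -scalerAl -scalerAr scalerA divff //.
by rewrite scale1r mulrV.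
Qed.

(** * Cauchy's formula as a mean over roots of unity *)

Section CauchyMean.
Variable R : realType.
Local Notation H := (quat R).
Variables (I : H) (f : H -> H) (r : R) (z0 : H).
Hypothesis I_imag : imag_sphere I.
Hypothesis f_derives : forall q, slice_line I q -> `|q| < 1 ->
  exists d, slice_derives I f q d.
Hypothesis r01 : 0 < r < 1.
Hypothesis z0_line : slice_line I z0.
Hypothesis z0r : `|z0| < r.
Implicit Types (p q d : H) (x y e : R) (m n i : nat).

Definition dyadic_root m : H := slice_circle I (1 / 2 ^+ m).

Definition circle_node m i : H := r *: dyadic_root m ^+ i.

(** The Cauchy kernel (q - z0)^-1 multiplied by [q], since dq = I q dtheta on the circle. *)
Definition cauchy_weight q : H := q * (q - z0)^-1.

Lemma circle_nodeE m i : circle_node m i = r *: slice_circle I (path_node 0 1 m i).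
Proof. by rewrite /path_node add0r slice_circleMn. Qed.

Lemma circle_node_line m i : slice_line I (circle_node m i).
Proof. by rewrite circle_nodeE; apply: slice_lineZ; exact: slice_circle_line. Qed.

Lemma norm_circle_node m i : `|circle_node m i| = r.
Proof.
have r0 : 0 <= r by case/andP: r01 => /ltW.
by rewrite circle_nodeE normrZ norm_slice_circle // mulr1 ger0_norm.
Qed.

Lemma circle_nodeS m i : circle_node m i.+1 = dyadic_root m * circle_node m i.
Proof. by rewrite /circle_node exprS scalerAr. Qed.

Lemma dyadic_root_half m : dyadic_root m.+1 ^+ (2 ^ m) = -1.
Proof.
rewrite -slice_circleMn // -[RHS](slice_circle_half I); congr (slice_circle I _).
by rewrite natrX exprS; field; rewrite expf_neq0.
Qed.

Lemma dyadic_root_full m : dyadic_root m ^+ (2 ^ m) = 1.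
Proof.
rewrite -slice_circleMn // -[RHS](slice_circle1 I_imag); congr (slice_circle I _).
by rewrite natrX; field; rewrite expf_neq0.
Qed.

Lemma norm_dyadic_root m : `|dyadic_root m| = 1.
Proof. exact: norm_slice_circle. Qed.

(** A polygon of 2^m equal chords leads from 1 to -1. The lower bound on the chord makes it possible
    to divide a small circulation by the step between nodes. *)
Lemma dyadic_root_sub1 m : 2 <= 2 ^+ m.+1 * `|dyadic_root m.+1 - 1|.
Proof.
have := subrX1 (dyadic_root m.+1) (2 ^ m); rewrite dyadic_root_half => /(congr1 (fun q : H => `|q|)).
rewrite qnormM -opprD normrN (_ : `|1 + 1 : H| = 2); last first.
  by rewrite -[1 : H]scale1r -scalerDl qnormA ger0_norm.
have : `|\sum_(i < 2 ^ m) dyadic_root m.+1 ^+ i| <= 2 ^+ m.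
  apply: le_trans (ler_norm_sum _ _ _) _.
  under eq_bigr do rewrite qnormX norm_dyadic_root expr1n.
  by rewrite sumr_const card_ord natrX.
rewrite [2 ^+ m.+1]exprS; have : 0 <= (2 : R) ^+ m by rewrite exprn_ge0.
have := normr_ge0 (dyadic_root m.+1 - 1).
by move: (2 ^+ m) `|dyadic_root m.+1 - 1| `|\sum_(i < _) _| => a b c; nra.
Qed.

Lemma norm_node_sub m i : r - `|z0| <= `|circle_node m i - z0|.
Proof. by apply: le_trans (lerB_dist _ _); rewrite norm_circle_node. Qed.

(* Shrinks the circle of radius [r] towards [z0]; Goursat's theorem for
   [(p - z0)^-1 * f p] on it moves Cauchy means to small circles around [z0]. *)
Definition cone_map dl x y : H :=
  z0 + (dl + (1 - dl) * x) *: (r *: slice_circle I y - z0).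

(** The edges y = 0 and y = 1 have the same image and cancel in the circulation; what remains is the
    sum over the outer circle minus the sum over the small one. *)
Lemma cauchy_mean_cone dl e : 0 < dl < 1 -> 0 < e ->
  exists M, forall m, (M <= m)%N ->
    `|\sum_(i < 2 ^ m) cauchy_weight (circle_node m i) *
       (f (circle_node m i) - f (z0 + dl *: (circle_node m i - z0)))| <= e * 2 ^+ m.
Proof.
move=> /andP[dl0 dl1] e0; have /andP[r0 r1] := r01.
pose g p := (p - z0)^-1 * f p.
pose Psi := cone_map dl.
pose T x := dl + (1 - dl) * x.
have T01 x : 0 <= x <= 1 -> dl <= T x <= 1.
  by move=> /andP[x0 x1]; apply/andP; split; rewrite /T; nra.
have nc y : `|r *: slice_circle I y| = r.
  by rewrite normrZ norm_slice_circle // mulr1 gtr0_norm.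
have Psi_line x y : slice_line I (Psi x y).
  apply: slice_lineD => //; apply: slice_lineZ; apply: slice_lineB => //.
  by apply: slice_lineZ; exact: slice_circle_line.
have Psi1 x y : 0 <= x <= 1 -> `|Psi x y| < 1.
  move=> /T01 /andP[t0 t1]; rewrite /Psi /cone_map -/(T x).
  have -> : z0 + T x *: (r *: slice_circle I y - z0) =
      (1 - T x) *: z0 + T x *: (r *: slice_circle I y).
    by rewrite scalerBl scale1r scalerBr addrCA addrC [_ - _ + _]addrC.
  apply: le_lt_trans (ler_normD _ _) _; rewrite !normrZ norm_slice_circle //.
  rewrite mulr1 (ger0_norm (ltW r0)) !ger0_norm; [|lra|lra].
  by have := normr_ge0 z0; move: z0r r1 t0 t1; move: `|z0| (T x) => a t; nra.
have Psi0 x y : 0 <= x <= 1 -> Psi x y != z0.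
  move=> /T01 /andP[t0 t1]; rewrite -subr_eq0 /Psi /cone_map addrC addKr.
  rewrite scaler_eq0 negb_or; apply/andP; split; first by rewrite gt_eqF // -/(T x); lra.
  by rewrite subr_eq0; apply: contraTneq z0r => <-; rewrite nc ltxx.
have lip x y x' y' : 0 <= x <= 1 -> 0 <= y <= 1 -> 0 <= x' <= 1 -> 0 <= y' <= 1 ->
    `|Psi x y - Psi x' y'| <= (2 + 4 * pi) * (`|x - x'| + `|y - y'|).
  move=> hx hy hx' hy'; have /andP[t0 t1] := T01 _ hx'.
  have -> : Psi x y - Psi x' y' = ((1 - dl) * (x - x')) *: (r *: slice_circle I y - z0)
      + (T x' * r) *: (slice_circle I y - slice_circle I y').
    rewrite /Psi /cone_map -!/(T _).
    have -> : (1 - dl) * (x - x') = T x - T x' by rewrite /T; ring.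
    move: (T x) (T x') (slice_circle I y) (slice_circle I y') z0 => *.
    by clear; quat_field.
  apply: le_trans (ler_normD _ _) _.
  rewrite (normrZ ((1 - dl) * (x - x'))) (normrZ (T x' * r)).
  have l1 : `|r *: slice_circle I y - z0| <= 2.
    by apply: le_trans (ler_normB _ _) _; rewrite nc; move: z0r r1; lra.
  have l2 := slice_circle_lipschitz I_imag y y'.
  have l3 : `|(1 - dl) * (x - x')| <= `|x - x'|.
    by rewrite normrM ler_piMl // ger0_norm; lra.
  have l4 : `|T x' * r| <= 1 by rewrite ger0_norm; nra.
  have p0 := @pi_ge0 R.
  have m1 := ler_pM (normr_ge0 _) (normr_ge0 _) l3 l1.
  have m2 := ler_pM (normr_ge0 _) (normr_ge0 _) l4 l2.
  apply: le_trans (lerD m1 m2) _; rewrite mul1r.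
  have := normr_ge0 (x - x'); have := normr_ge0 (y - y'); move: p0.
  by move: pi `|x - x'| `|y - y'| => P a b; nra.
have gd x y : 0 <= x <= 1 -> 0 <= y <= 1 -> exists d, slice_derives I g (Psi x y) d.
  move=> hx hy; have [d hd] := f_derives (Psi_line x y) (Psi1 x y hx).
  exact: slice_derives_quotient (Psi_line x y) z0_line (Psi0 x y hx) hd.
have L0 : 0 <= 2 + 4 * pi :> R by rewrite addr_ge0 // mulr_ge0 // pi_ge0.
have [M hM] := goursat L0 (fun x y _ _ => Psi_line x y) lip gd e0.
exists M.+1 => -[//|m] /ltnW /hM; rewrite /circulation add0r.
have -> : Psi^~ 1 = Psi^~ 0.
  by apply/funext => x; rewrite /Psi /cone_map slice_circle1 // slice_circle0.
have -> (b t l : H) : b + t - b - l = t - l by clear; quat_field.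
set S := \sum_(i < _) _.
have P1 i : Psi 1 (path_node 0 1 m.+1 i) = circle_node m.+1 i.
  by rewrite /Psi /cone_map mulr1 (addrC dl) subrK scale1r -circle_nodeE addrC subrK.
have P0 i : Psi 0 (path_node 0 1 m.+1 i) = z0 + dl *: (circle_node m.+1 i - z0).
  by rewrite /Psi /cone_map mulr0 addr0 -circle_nodeE.
(* The factor [dl] of the increments on the small circle is cancelled by the inverse of p - z0, so
   both circles carry the same weights. *)
have -> : path_sum g (Psi 1) 0 1 m.+1 - path_sum g (Psi 0) 0 1 m.+1 =
    (dyadic_root m.+1 - 1) * S.
  rewrite /path_sum -sumrB /S mulr_sumr; apply: eq_bigr => i _.
  rewrite !P1 !P0 circle_nodeS; set z := circle_node m.+1 i.
  set w := dyadic_root m.+1.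
  rewrite /g /cauchy_weight -/w.
  have -> : z0 + dl *: (w * z - z0) - (z0 + dl *: (z - z0)) = dl *: ((w - 1) * z).
    by rewrite mulrBl mul1r; move: z z0 (w * z) => a b c; clear; quat_field.
  have -> : z0 + dl *: (z - z0) - z0 = dl *: (z - z0) by rewrite addrC addKr.
  have -> : w * z - z = (w - 1) * z by rewrite mulrBl mul1r.
  rewrite qinvZ ?gt_eqF //.
  move: (w - 1) z (z - z0)^-1 (f z) (f _) => a b c t u; clear -dl0.
  rewrite -(scalerAl dl^-1) -scalerAr -scalerAl scalerA mulVf ?gt_eqF // scale1r.
  by rewrite !mulrBr !mulrA.
rewrite qnormM => h; have := dyadic_root_sub1 m.
have := normr_ge0 S; move: h; rewrite exprS.
have : 0 <= (2 : R) ^+ m by rewrite exprn_ge0.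
move: `|S| `|dyadic_root m.+1 - 1| (2 ^+ m) => a b c; nra.
Qed.

(** Once the values on the outer circle have been replaced by values on a small circle around [z0],
    differentiability at [z0] makes these close to f(z0). *)
Lemma cauchy_mean e : 0 < e -> exists M, forall m, (M <= m)%N ->
  `|\sum_(i < 2 ^ m) cauchy_weight (circle_node m i) *
     (f (circle_node m i) - f z0)| <= e * 2 ^+ m.
Proof.
move=> e0; have /andP[r0 r1] := r01.
have z01 : `|z0| < 1 by apply: lt_trans r1.
have [d hd] := f_derives z0_line z01.
have dr : 0 < r - `|z0| by rewrite subr_gt0.
pose W := r / (r - `|z0|).
have W0 : 0 < W by rewrite divr_gt0.
have wW m i : `|cauchy_weight (circle_node m i)| <= W.
  rewrite qnormM norm_circle_node ler_wpM2l ?(ltW r0) // qnormV lef_pV2 ?posrE //.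
    exact: norm_node_sub.
  by apply: lt_le_trans dr _; exact: norm_node_sub.
have e2 : 0 < e / 2 by rewrite divr_gt0.
pose e1 := e / (2 * W * (1 + `|d|)).
have d1 : 0 < 1 + `|d| by rewrite ltr_pwDl.
have e10 : 0 < e1 by rewrite divr_gt0 // mulr_gt0 // mulr_gt0.
(* Tolerance 1 gives |f(p) - f(z0)| <= (1 + |d|) |p - z0| near [z0]. The points of the small circle
   are within 2 dl <= e1 / 2 of [z0], and [e1] is such that the weighted error is e / 4. *)
have [rho rho0 hrho] := hd 1 ltr01.
pose dl := Num.min 2^-1 (Num.min (rho / 4) (e1 / 4)).
have dl0 : 0 < dl by rewrite !lt_min invr_gt0 ltr0n (divr_gt0 rho0) // divr_gt0.
have dlh : dl <= 2^-1 by rewrite !ge_min lexx.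
have dlr : dl <= rho / 4 by rewrite !ge_min lexx orbT.
have dle : dl <= e1 / 4 by rewrite !ge_min lexx !orbT.
have [|M hM] := @cauchy_mean_cone dl (e / 2) _ e2.
  by rewrite dl0 /=; move: dlh; lra.
exists M => m /hM {}hM.
pose p i := z0 + dl *: (circle_node m i - z0).
have pz i : p i - z0 = dl *: (circle_node m i - z0) by rewrite /p addrC addKr.
have np i : `|p i - z0| <= 2 * dl.
  rewrite pz normrZ gtr0_norm // mulrC ler_wpM2r ?(ltW dl0) //.
  by apply: le_trans (ler_normB _ _) _; rewrite norm_circle_node; move: z0r r1; lra.
have fp i : `|f (p i) - f z0| <= e1 / 2 * (1 + `|d|).
  have Ip : slice_line I (p i).
    apply: slice_lineD => //; apply: slice_lineZ; apply: slice_lineB => //.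
    exact: circle_node_line.
  have := hrho (p i) Ip; rewrite mul1r => /(_ (le_lt_trans (np i) _)) h.
  have {}h := h ltac:(by move: dlr rho0; lra).
  rewrite -[f (p i) - _](subrK ((p i - z0) * d)).
  apply: le_trans (ler_normD _ _) _; rewrite qnormM mulrDr mulr1.
  have npi : `|p i - z0| <= e1 / 2 by apply: le_trans (np i) _; move: dle; lra.
  by apply: lerD; [exact: le_trans h npi|rewrite ler_wpM2r].
have -> : \sum_(i < 2 ^ m) cauchy_weight (circle_node m i) * (f (circle_node m i) - f z0)
  = \sum_(i < 2 ^ m) cauchy_weight (circle_node m i) * (f (circle_node m i) - f (p i))
  + \sum_(i < 2 ^ m) cauchy_weight (circle_node m i) * (f (p i) - f z0).
  rewrite -big_split /=; apply: eq_bigr => i _; rewrite -mulrDr; congr (_ * _).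
  by rewrite addrA subrK.
apply: le_trans (ler_normD _ _) _.
apply: le_trans (lerD hM (_ : _ <= e / 2 * 2 ^+ m)) _; last by rewrite -mulrDl -splitr.
apply: le_trans (ler_norm_sum _ _ _) _.
rewrite -natrX mulr_natr -[(2 ^ m)%N in leRHS]card_ord -sumr_const; apply: ler_sum => i _.
rewrite qnormM; apply: le_trans (ler_pM _ _ (wW _ _) (fp i)) _ => //.
have -> : W * (e1 / 2 * (1 + `|d|)) = e / 4.
  by rewrite /e1; field; rewrite !gt_eqF.
lra.
Qed.

End CauchyMean.

(** * Limits along an ultrafilter *)

Section UltraLimit.
Variables (R : realType) (U : set_system nat).
Hypothesis U_ultra : UltraFilter U.

(** The limit is the supremum of the levels that [u] reaches on a set of [U]; a level above it is
    not reached, so the complementary set belongs to [U]. *)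
Lemma ultra_limit_real (u : nat -> R) (C : R) : (forall m, `|u m| <= C) ->
  exists l, forall e, 0 < e -> U [set m | `|u m - l| <= e].
Proof.
move=> uC; pose A := [set x : R | U [set m | x <= u m]].
have A0 : A (- C) by apply: filterS filterT => m _ /=; rewrite lerNl (le_trans _ (uC m)) // -normrN ler_norm.
have Aub : ubound A C.
  move=> x Ax; have /filter_ex [m /= xm] := Ax.
  by apply: le_trans xm _; apply: le_trans (ler_norm _) (uC m).
have supA : has_sup A by split; [exists (- C)|exists C].
exists (sup A) => e e0.
have [x Ax xs] := sup_adherent e0 supA.
have notA : ~ A (sup A + e).
  by move=> /(sup_upper_bound supA); rewrite gerDl leNgt e0.
have [//|nU] := in_ultra_setVsetC [set m | sup A + e <= u m] U_ultra.
apply: filterS (filterI Ax nU) => m [/= xm /negP]; rewrite -ltNge => mu.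
by rewrite ler_norml; apply/andP; split; move: xm xs mu; lra.
Qed.

Lemma ultra_limit (u : nat -> quat R) (C : R) : (forall m, `|u m| <= C) ->
  exists l, forall e, 0 < e -> U [set m | `|u m - l| <= e].
Proof.
move=> uC.
have [a ha] : exists l, forall e, 0 < e -> U [set m | `|qa (u m) - l| <= e].
  by apply: (@ultra_limit_real _ C) => m; apply: le_trans (uC m); have [] := norm_coord_le (u m).
have [b hb] : exists l, forall e, 0 < e -> U [set m | `|qb (u m) - l| <= e].
  by apply: (@ultra_limit_real _ C) => m; apply: le_trans (uC m); have [] := norm_coord_le (u m).
have [c hc] : exists l, forall e, 0 < e -> U [set m | `|qc (u m) - l| <= e].
  by apply: (@ultra_limit_real _ C) => m; apply: le_trans (uC m); have [] := norm_coord_le (u m).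
have [d hd] : exists l, forall e, 0 < e -> U [set m | `|qd (u m) - l| <= e].
  by apply: (@ultra_limit_real _ C) => m; apply: le_trans (uC m); have [] := norm_coord_le (u m).
exists (Quat a b c d) => e e0; have e4 : 0 < e / 4 by rewrite divr_gt0.
apply: filterS (filterI (filterI (ha _ e4) (hb _ e4)) (filterI (hc _ e4) (hd _ e4))).
move=> m /= [[h1 h2] [h3 h4]]; apply: le_trans (norm_le_coord _) _ => /=.
by move: h1 h2 h3 h4; lra.
Qed.

End UltraLimit.

(** * Power series expansion on one slice *)

Section SliceExpansion.
Variable R : realType.
Local Notation H := (quat R).
Variables (I : H) (f : H -> H) (r : R).
Hypothesis I_imag : imag_sphere I.
Hypothesis f_derives : forall q, slice_line I q -> `|q| < 1 ->
  exists d, slice_derives I f q d.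
Hypothesis r01 : 0 < r < 1.
Implicit Types (p q d z : H) (x y e : R) (m n i : nat).

Local Notation omega := (dyadic_root I).
Local Notation node := (circle_node I r).

(** The order of the root divides 2^m, so it is a power of 2; it does not divide 2^(m-1), as the
    corresponding power is -1. Hence the order is exactly 2^m. *)
Lemma dyadic_root_neq1 m n : (0 < n < 2 ^ m)%N -> omega m ^+ n != 1.
Proof.
move=> /andP[n0 nm]; apply/eqP => w1.
have [d dprim] := @prim_order_exists _ (2 ^ m) (omega m) (expn_gt0 2 m) (dyadic_root_full I_imag m).
move=> /(dvdn_pfactor _ _ (isT : prime 2)) [k km dE].
have dn : (d %| n)%N by rewrite (prim_order_dvd dprim) w1.
move: km; rewrite leq_eqVlt => /orP[/eqP km|km].
  by move: (dvdn_leq n0 dn); rewrite dE km leqNgt nm.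
case: m w1 nm dprim dE km => // m w1 nm dprim dE km.
have /eqP : omega m.+1 ^+ (2 ^ m) == 1.
  by rewrite -(prim_order_dvd dprim) dE dvdn_exp2l.
rewrite dyadic_root_half // => /(congr1 (@qa R)) /=; lra.
Qed.

Lemma node_neq0 m i : node m i != 0.
Proof. by rewrite -normr_gt0 norm_circle_node //; case/andP: r01. Qed.

Lemma node_exp m i n : node m i ^+ n = r ^+ n *: (omega m ^+ n) ^+ i.
Proof. by rewrite /circle_node exprZn -exprM mulnC exprM. Qed.

Lemma sum_node_inv m n : (0 < n < 2 ^ m)%N ->
  \sum_(i < 2 ^ m) (node m i)^-1 ^+ n = 0.
Proof.
move=> hn; have w1 := dyadic_root_neq1 hn.
have r0 : r != 0 by case/andP: r01 => r0 _; rewrite gt_eqF.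
under eq_bigr => i _ do rewrite exprVn node_exp qinvZ ?expf_neq0 // -[((omega m ^+ n) ^+ i)^-1]exprVn.
rewrite -scaler_sumr; set S := \sum_(i < _) _.
have : ((omega m ^+ n)^-1 - 1) * S = 0.
  rewrite -subrX1 exprVn -exprM mulnC exprM dyadic_root_full // expr1n invr1.
  by rewrite subrr.
move=> /eqP; rewrite qmul_eq0 => /orP[|/eqP ->]; last by rewrite scaler0.
rewrite subr_eq0 => /eqP /(congr1 (fun q : H => q^-1)); rewrite invrK invr1 => /eqP.
by rewrite (negPf w1).
Qed.

(* The Taylor coefficients are limits of these means along an ultrafilter, which
   spares proving that they converge. *)
Definition mean_coef m n : H :=
  (2 ^- m) *: \sum_(i < 2 ^ m) (node m i)^-1 ^+ n * f (node m i).

(** A finite geometric sum in z0 / z. All nodes have the same 2^m-th power r^(2^m), so the error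
    factor does not depend on the node and can be taken out of the mean. *)
Lemma cauchy_weightE (z0 : H) m i : slice_line I z0 -> `|z0| < r ->
  \sum_(n < 2 ^ m) z0 ^+ n * (node m i)^-1 ^+ n =
  (1 - z0 ^+ (2 ^ m) * r%:A^-1 ^+ (2 ^ m)) * cauchy_weight z0 (node m i).
Proof.
move=> I0 z0r; set z := node m i; set N := (2 ^ m)%N.
have zn0 : z != 0 by exact: node_neq0.
have Iz : slice_line I z by exact: circle_node_line.
have r0 : r != 0 by case/andP: r01 => r0 _; rewrite gt_eqF.
have zz0 : z - z0 != 0.
  by rewrite subr_eq0; apply: contraTneq z0r => <-; rewrite norm_circle_node // ltxx.
have c0 : z0 * z = z * z0 by apply: slice_line_comm I0 Iz.
have c1 : GRing.comm z0 z^-1 by apply: commrV.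
have -> : \sum_(n < N) z0 ^+ n * z^-1 ^+ n = \sum_(n < N) (z0 * z^-1) ^+ n.
  by apply: eq_bigr => n _; rewrite exprMn_comm.
have -> : z0 ^+ N * r%:A^-1 ^+ N = (z0 * z^-1) ^+ N.
  rewrite exprMn_comm // !exprVn; congr (_ * _^-1).
  by rewrite /z /N node_exp dyadic_root_full // expr1n exprZn expr1n.
have w1 : (1 - z0 * z^-1) * cauchy_weight z0 z = 1.
  rewrite /cauchy_weight mulrA mulrBl mul1r -[z0 * z^-1 * z]mulrA mulVr // mulr1.
  by rewrite mulrV.
have -> : 1 - (z0 * z^-1) ^+ N = (\sum_(n < N) (z0 * z^-1) ^+ n) * (1 - z0 * z^-1).
  have -> : 1 - (z0 * z^-1) ^+ N = - ((z0 * z^-1) ^+ N - 1) by rewrite opprB.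
  rewrite subrX1 -mulNr opprB; apply: commr_sum => k _.
  by apply: commrX; apply: commr_sym; apply: commrB; [exact: commr1|exact: commr_refl].
by rewrite -mulrA w1 mulr1.
Qed.

Lemma mean_coef_eval (z0 : H) m : slice_line I z0 -> `|z0| < r ->
  \sum_(n < 2 ^ m) z0 ^+ n * mean_coef m n - f z0 =
  (1 - z0 ^+ (2 ^ m) * r%:A^-1 ^+ (2 ^ m)) *
  (2 ^- m *: \sum_(i < 2 ^ m) cauchy_weight z0 (node m i) * (f (node m i) - f z0)).
Proof.
move=> I0 z0r; set N := (2 ^ m)%N.
have E (h : nat -> H) : \sum_(n < N) z0 ^+ n *
    (2 ^- m *: \sum_(i < N) (node m i)^-1 ^+ n * h i) =
    (1 - z0 ^+ N * r%:A^-1 ^+ N) *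
    (2 ^- m *: \sum_(i < N) cauchy_weight z0 (node m i) * h i).
  under eq_bigr => n _ do rewrite -scalerAr mulr_sumr.
  rewrite -scaler_sumr exchange_big /= -scalerAr mulr_sumr; congr (_ *: _).
  apply: eq_bigr => i _; rewrite mulrA -cauchy_weightE // mulr_suml.
  by apply: eq_bigr => n _; rewrite mulrA.
rewrite (E (fun i => f (node m i))).
(* The same identity for the constant function f(z0), for which all means except that of order 0
   vanish. *)
have fE : f z0 = (1 - z0 ^+ N * r%:A^-1 ^+ N) *
    (2 ^- m *: \sum_(i < N) cauchy_weight z0 (node m i) * f z0).
  rewrite -(E (fun=> f z0)); have N0 : (0 < N)%N by rewrite expn_gt0.
  rewrite (bigD1 (Ordinal N0)) //= [X in _ + X]big1 ?addr0.
    rewrite expr0 mul1r; under eq_bigr do rewrite expr0 mul1r.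
    rewrite sumr_const card_ord -[_ *+ N]scaler_nat scalerA /N natrX mulVf ?scale1r //.
  move=> n n0; rewrite -mulr_suml sum_node_inv ?mul0r ?scaler0 ?mulr0 //.
  by rewrite ltn_ord andbT lt0n.
rewrite [X in _ - X = _]fE -mulrBr; congr (_ * _).
by rewrite -scalerBr -sumrB; congr (_ *: _); apply: eq_bigr => i _; rewrite mulrBr.
Qed.

Lemma mean_coef_cvg (z0 : H) e : slice_line I z0 -> `|z0| < r -> 0 < e ->
  exists M, forall m, (M <= m)%N ->
    `|\sum_(n < 2 ^ m) z0 ^+ n * mean_coef m n - f z0| <= e.
Proof.
move=> I0 z0r e0; have e2 : 0 < e / 2 by rewrite divr_gt0.
have [M hM] := cauchy_mean I_imag f_derives r01 I0 z0r e2; exists M => m /hM {}hM.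
have r0 : 0 < r by case/andP: r01.
rewrite mean_coef_eval // qnormM.
have -> : e = 2 * (e / 2) by rewrite mulrC divfK.
apply: ler_pM => //.
  apply: le_trans (ler_normB _ _) _; rewrite qnorm1 lerD2l qnormM !qnormX qnormV.
  rewrite qnormA gtr0_norm // -exprMn exprn_ile1 //.
    by rewrite divr_ge0 // ltW.
  by rewrite ler_pdivrMr // mul1r ltW.
rewrite normrZ ger0_norm ?invr_ge0 ?exprn_ge0 // mulrC ler_pdivrMr ?exprn_gt0 //.
Qed.

(** The function is continuous on the compact circle, so the bound is uniform in [m], as limits
    along an ultrafilter require. *)
Lemma circle_bounded : exists2 B, 0 <= B & forall m n, `|mean_coef m n| <= B * r^-1 ^+ n.
Proof.
have /andP[r0 r1] := r01.
pose h y := `|f (r *: slice_circle I y)|.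
have hc : continuous h.
  move=> y; pose q := r *: slice_circle I y.
  have Iq t : slice_line I (r *: slice_circle I t).
    by apply: slice_lineZ; exact: slice_circle_line.
  have q1 : `|q| < 1 by rewrite normrZ norm_slice_circle // mulr1 gtr0_norm.
  have [d hd] := f_derives (Iq y) q1.
  apply/cvgrPdist_le => e e0; have [s s0 hs] := hd 1 ltr01.
  have K0 : 0 < 4 * pi :> R by rewrite mulr_gt0 // pi_gt0.
  have d0 : 0 < 1 + `|d| by rewrite ltr_pwDl.
  near=> t; apply: le_trans (ler_dist_dist _ _) _; rewrite distrC.
  have tq : `|r *: slice_circle I t - q| <= 4 * pi * `|t - y|.
    rewrite /q -scalerBr normrZ gtr0_norm //.
    apply: le_trans (slice_circle_lipschitz I_imag t y).
    by rewrite ler_piMl // ltW.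
  have ty : `|t - y| < Num.min (s / (4 * pi)) (e / (4 * pi * (1 + `|d|))).
    rewrite distrC; near: t; apply/nbhs_ballP.
    exists (Num.min (s / (4 * pi)) (e / (4 * pi * (1 + `|d|)))) => //=.
    by rewrite lt_min (divr_gt0 s0) // divr_gt0 // mulr_gt0.
  move: ty; rewrite lt_min => /andP[t1 t2].
  have := hs _ (Iq t); rewrite mul1r => /(_ (le_lt_trans tq _)) hh.
  have {}hh := hh ltac:(by rewrite mulrC -ltr_pdivlMr).
  rewrite -[f _ - _](subrK ((r *: slice_circle I t - q) * d)).
  apply: le_trans (ler_normD _ _) _; rewrite qnormM.
  apply: le_trans (lerD hh (lexx _)) _.
  rewrite -{1}[`|_ - q|]mulr1 -mulrDr.
  apply: le_trans (ler_wpM2r (ltW d0) tq) _.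
  have -> : 4 * pi * `|t - y| * (1 + `|d|) = `|t - y| * (4 * pi * (1 + `|d|)) by ring.
  by move: t2; rewrite ltr_pdivlMr ?(mulr_gt0 K0) // => /ltW.
have [c _ hB] := EVT_max ler01 (continuous_subspaceT hc).
exists (h c) => [|m n]; first exact: normr_ge0.
rewrite normrZ ger0_norm ?invr_ge0 ?exprn_ge0 // mulrC ler_pdivrMr ?exprn_gt0 //.
apply: le_trans (ler_norm_sum _ _ _) _.
rewrite -natrX mulr_natr -[(2 ^ m)%N in leRHS]card_ord -sumr_const; apply: ler_sum => i _.
rewrite qnormM qnormX qnormV norm_circle_node // mulrC ler_wpM2r ?exprn_ge0 ?invr_ge0 ?(ltW r0) //.
rewrite circle_nodeE // hB // in_itv /=.
by have := @path_node_le R 0 1 m i ler01 (ltnW (ltn_ord i)); rewrite add0r.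
Unshelve. all: by end_near. Qed.

Lemma norm_sum_tail (u : nat -> H) (B t : R) K N : 0 <= t < 1 -> (K <= N)%N ->
  (forall n, `|u n| <= B * t ^+ n) ->
  `|\sum_(K <= n < N) u n| <= B * t ^+ K / (1 - t).
Proof.
move=> t01 KN uB; rewrite -{1}[K]add0n big_addn.
rewrite -/(series (fun n => u (n + K)%N) (N - K)%N).
by apply: norm_series_le => // n; rewrite -mulrA -exprD addnC.
Qed.

Lemma slice_expansion : exists (c : nat -> H) (B : R),
  (forall n, `|c n| <= B * r^-1 ^+ n) /\
  forall z0 : H, slice_line I z0 -> `|z0| < r -> pseries c z0 @ \oo --> f z0.
Proof.
have /andP[r0 r1] := r01.
have [B B0 hB] := circle_bounded.
have [U [Uultra Uoo]] := @ultraFilterLemma _ (nbhs \oo) _.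
have [c hc] := choice (fun n => ultra_limit Uultra (fun m => hB m n)).
exists c, B; split=> [n|z0 I0 z0r].
  apply/ler_addgt0Pr => e e0; have /filter_ex [m /= le] := hc n e e0.
  have := hB m n; have := ler_normB (mean_coef m n) (mean_coef m n - c n).
  by rewrite opprB addrC subrK; move: le; lra.
have z01 : `|z0| <= 1 by rewrite ltW // (lt_trans z0r).
pose t := `|z0| / r; have t01 : 0 <= t < 1 by apply: ratio01.
(* Three errors: that of Cauchy's mean, the terms of index at least [K], which are geometrically
   small, and the distance of the first [K] mean coefficients to their limits. For a suitable [m],
   the first and third are below e / 2 simultaneously. *)
have key K : `|f z0 - pseries c z0 K| <= B / (1 - t) * t ^+ K.
  apply/ler_addgt0Pr => e e0; have e2 : 0 < e / 2 by rewrite divr_gt0.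
  have eK : 0 < e / 2 / K.+1%:R by rewrite divr_gt0 // ltr0n.
  have [M hM] := mean_coef_cvg I0 z0r e2.
  have UM : U [set m | (M <= m)%N /\ (K <= 2 ^ m)%N].
    apply: Uoo; exists (M + K)%N => // m /= MK; split.
      exact: leq_trans (leq_addr _ _) MK.
    by apply: leq_trans (leq_trans (leq_addl _ _) MK) _; rewrite ltnW // ltn_expl.
  have UK : U [set m | forall k : 'I_K, `|mean_coef m k - c k| <= e / 2 / K.+1%:R].
    by apply: filter_forall => k; exact: hc.
  have UF : Filter U by exact: _.
  have UMK := @filterI _ U UF _ _ UM UK; have [m /= [[Mm Km] hk]] := filter_ex UMK.
  have hz := hM m Mm.
  have -> : f z0 - pseries c z0 K =
      - (\sum_(n < 2 ^ m) z0 ^+ n * mean_coef m n - f z0) +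
      \sum_(K <= n < 2 ^ m) z0 ^+ n * mean_coef m n +
      \sum_(n < K) z0 ^+ n * (mean_coef m n - c n).
    rewrite -(big_mkord xpredT (fun n => z0 ^+ n * mean_coef m n)).
    rewrite (big_cat_nat (leq0n K) Km) /= opprB opprD addrA -[_ + \sum_(K <= _ < _) _ + _]addrA.
    rewrite [\sum_(n < K) _](_ : _ = \sum_(0 <= n < K) z0 ^+ n * mean_coef m n - pseries c z0 K).
      by move: (\sum_(K <= _ < _) _) (\sum_(0 <= _ < _) _) (pseries _ _ _) (f z0) => *;
        clear; quat_field.
    rewrite /pseries /series /= -sumrB big_mkord.
    by apply: eq_bigr => n _; rewrite mulrBr.
  apply: le_trans (ler_normD _ _) _.
  apply: (@le_trans _ _ (e / 2 + B * t ^+ K / (1 - t) + e / 2)); last first.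
    by rewrite addrAC -splitr addrC mulrAC.
  apply: lerD.
    apply: le_trans (ler_normD _ _) _; rewrite normrN; apply: lerD => //.
    by apply: norm_sum_tail => // n; exact: (@fps_term_bound R (Fps (mean_coef m)) z0 r B r0 (hB m)).
  apply: le_trans (ler_norm_sum _ _ _) _.
  apply: (@le_trans _ _ (\sum_(n < K) e / 2 / K.+1%:R)).
    apply: ler_sum => n _; rewrite qnormM qnormX -[leRHS]mul1r.
    by apply: ler_pM; rewrite ?exprn_ge0 ?exprn_ile1.
  rewrite sumr_const card_ord -[_ *+ K]mulr_natr mulrAC ler_pdivrMr ?ltr0n //.
  by rewrite ler_wpM2l ?(ltW e2) // ler_nat.
apply/cvgrPdist_le => e e0.
have := @geometric_bound_cvg0 R (fun K => f z0 - pseries c z0 K) _ t t01 key.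
by move=> /cvgrPdist_le /(_ e e0); apply: filterS => K; rewrite sub0r normrN.
Qed.

End SliceExpansion.

(** * Cauchy estimates and maximum modulus *)

Section RegularFunctions.
Variable R : realType.
Local Notation H := (quat R).
Implicit Types (a b c k : fps H) (f g : H -> H) (p q u v w : H) (r t x y C : R).

Lemma fps_XBM_inj q a b :
  (fpsX H - fps_const q) * a = (fpsX H - fps_const q) * b -> a = b.
Proof.
move=> /eqP; rewrite -subr_eq0 -mulrBr => /eqP E.
apply/eqP; rewrite -subr_eq0; apply/eqP; move: (a - b) E => d E.
have dE n : q * d n = if n == 0%N then 0 else d n.-1.
  have := congr1 (fun e : fps H => e n) E.
  by rewrite mulrBl coefBf coefXMf coefCMf coef0f => /eqP; rewrite subr_eq0 => /eqP.
have [q0|q0] := eqVneq q 0.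
  by apply: fpsP => n; have := dE n.+1; rewrite q0 mul0r.
apply: fpsP; elim=> [|n IH]; apply: (qmulI q0); rewrite dE /= ?IH mulr0 //.
Qed.

(** Rescaling both series by the smaller radius reduces the claim to uniqueness on the real points
    of the unit ball. *)
Lemma expansions_agree f (c1 c2 : nat -> H) (B1 B2 r1 r2 : R) :
  0 < r1 -> 0 < r2 ->
  (forall n, `|c1 n| <= B1 * r1^-1 ^+ n) -> (forall n, `|c2 n| <= B2 * r2^-1 ^+ n) ->
  (forall t, 0 < t < r1 -> pseries c1 t%:A @ \oo --> f t%:A) ->
  (forall t, 0 < t < r2 -> pseries c2 t%:A @ \oo --> f t%:A) -> c1 = c2.
Proof.
move=> r10 r20 h1 h2 f1 f2; pose s := Num.min r1 r2.
have s0 : 0 < s by rewrite lt_min r10.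
have conv (c : nat -> H) B r : 0 < r -> s <= r -> (forall n, `|c n| <= B * r^-1 ^+ n) ->
    fps_conv (Fps (fun n => s ^+ n *: c n)).
  move=> r0 sr hc; apply: (@fps_conv_le _ _ B) => n /=.
  have B0 : 0 <= B by have := le_trans (normr_ge0 _) (hc 0%N); rewrite expr0 mulr1.
  rewrite normrZ ger0_norm ?exprn_ge0 ?(ltW s0) //.
  apply: le_trans (ler_wpM2l _ (hc n)) _; first by rewrite exprn_ge0 // ltW.
  rewrite mulrCA -exprMn ler_piMr // exprn_ile1 // ?divr_ge0 ?(ltW s0) ?(ltW r0) //.
  by rewrite ler_pdivrMr // mul1r.
have ev (c : nat -> H) r : s <= r -> (forall t, 0 < t < r -> pseries c t%:A @ \oo --> f t%:A) ->
    forall t, 0 < t < 1 -> fps_eval (Fps (fun n => s ^+ n *: c n)) t%:A = f (t * s)%:A.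
  move=> sr fc t /andP[t0 t1]; apply: fps_eval_unique.
  have -> : pseries (Fps (fun n => s ^+ n *: c n)) t%:A = pseries c (t * s)%:A.
    apply/funext => n; rewrite /pseries /series; apply: eq_bigr => i _ /=.
    rewrite -scalerAr scalerAl; congr (_ * _).
    have e (k : R) : (k%:A : H) ^+ i = (k ^+ i)%:A by rewrite exprZn expr1n.
    by rewrite !e scalerA exprMn mulrC.
  apply: fc; rewrite mulr_gt0 //=; apply: lt_le_trans sr.
  by rewrite gtr_pMl.
have s1 : s <= r1 by rewrite ge_min lexx.
have s2 : s <= r2 by rewrite ge_min lexx orbT.
have E := @fps_eq_real _ _ _ 1 (conv _ _ _ r10 s1 h1) (conv _ _ _ r20 s2 h2).
have {}E := E (introT andP (conj ltr01 (lexx 1))).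
have {}E : Fps (fun n => s ^+ n *: c1 n) = Fps (fun n => s ^+ n *: c2 n).
  by apply: E => t ht; rewrite (ev _ _ s1 f1) // (ev _ _ s2 f2).
apply/funext => n; have := congr1 (fun a => s ^- n *: coef a n) E.
by rewrite /= !scalerA mulVf ?scale1r // expf_neq0 // gt_eqF.
Qed.

Lemma imag_sphere_i : imag_sphere (Quat 0 1 0 0 : H).
Proof.
rewrite /imag_sphere /= expr2.
by congr Quat => /=; rewrite ?(mul0r, mulr0, mulr1, subr0, addr0, oppr0, sub0r).
Qed.

(** Each slice and each radius below 1 has its own expansion. All of them represent [f] at small
    positive reals, so they share the coefficients found on one reference slice at radius 1/2. *)
Lemma regular_represented f : slice_regular (@unit_ball R) f ->
  exists a, represented_by f a.
Proof.
move=> /slice_regularP fr.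
have der I q : imag_sphere I -> slice_line I q -> `|q| < 1 ->
    exists d, slice_derives I f q d by move=> Is Iq q1; exact: fr.
have half01 : 0 < (2^-1 : R) < 1 by apply/andP; split; lra.
have real (c : nat -> H) I r :
    (forall z0 : H, slice_line I z0 -> `|z0| < r -> pseries c z0 @ \oo --> f z0) ->
    forall t, 0 < t < r -> pseries c t%:A @ \oo --> f t%:A.
  move=> h t /andP[t0 tr]; apply: h; first exact: slice_line_alg.
  by rewrite qnormA gtr0_norm.
have [c [B [cB cf]]] := slice_expansion imag_sphere_i (fun q => der _ q imag_sphere_i) half01.
have all I r : imag_sphere I -> 0 < r < 1 -> (exists B', forall n, `|c n| <= B' * r^-1 ^+ n) /\
    forall z0 : H, slice_line I z0 -> `|z0| < r -> pseries c z0 @ \oo --> f z0.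
  move=> Is r01; have [c' [B' [cB' cf']]] := slice_expansion Is (fun q => der _ q Is) r01.
  have -> : c = c'.
    apply: (expansions_agree _ _ cB cB' (real _ _ _ cf) (real _ _ _ cf')).
      by case/andP: half01.
    by case/andP: r01.
  by split; [exists B'|].
exists (Fps c); split=> [r r01|q q1].
  have [[B' hB'] _] := all _ r imag_sphere_i r01; exists B' => n.
  have r0 : 0 < r by case/andP: r01.
  by have := hB' n; rewrite exprVn ler_pdivlMr // exprn_gt0.
have [|r qr r01] := @between_lt1 R `|q|; first by rewrite normr_ge0.
have [Is qE] := imag_unitP q; have [_ hq] := all _ r Is r01.
by apply/esym/fps_eval_unique; apply: hq => //; rewrite {2}qE; eexists.
Qed.

(** The function chosen by [get] is regular, hence a series, and the factor X - q can be
    cancelled. *)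
Lemma represented_diff_quotient f a q : represented_by f a -> `|q| < 1 ->
  represented_by (diff_quotient f q) (fps_quot q a).
Proof.
move=> fa q1; have [ca fE] := fa.
have cR := fps_conv_quot q1 ca.
have Xq : represented_by (fun p => p - q) (fpsX H - fps_const q).
  by apply: represented_sub; [exact: represented_id|exact: represented_const].
have fw : represented_by (fun p => f p - f q) (a - fps_const (fps_eval a q)).
  by rewrite -fE //; apply: represented_sub => //; exact: represented_const.
pose P := [set g | slice_regular (@unit_ball R) g /\
    forall p, unit_ball p -> f p - f q = reg_mul (fun p => p - q) g p].
have [gr gE] : P (diff_quotient f q).
  apply: (@getPex _ P); exists (fps_eval (fps_quot q a)).
  have g0 := represented_by_eval cR; split; first exact: represented_regular g0.
  move=> p p1; have [_ ->] // := fw; have [_ ->] // := represented_reg_mul Xq g0.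
  by rewrite fps_quotE.
have [b gb] := regular_represented gr.
suff <- : b = fps_quot q a by [].
apply: (@fps_XBM_inj q); rewrite fps_quotE //.
apply: represented_unique (represented_reg_mul Xq gb) _.
by apply: represented_ext fw => p p1; exact: gE.
Qed.

Lemma exprV_mul_le q n m : q != 0 -> (n <= m)%N -> q^-1 ^+ n * q ^+ m = q ^+ (m - n).
Proof.
move=> q0 nm; rewrite -{1}(subnKC nm) exprD mulrA exprVn mulVr ?mul1r //.
by rewrite unitrX.
Qed.

Lemma exprV_mul_lt q n m : q != 0 -> (m < n)%N -> q^-1 ^+ n * q ^+ m = q^-1 ^+ (n - m).
Proof.
move=> q0 mn; rewrite -{1}(subnK (ltnW mn)) exprD -mulrA [q^-1 ^+ m]exprVn.
by rewrite mulVr ?mulr1 // unitrX.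
Qed.

Lemma sum_node m n : (0 < n < 2 ^ m)%N -> forall r, 
  \sum_(i < 2 ^ m) circle_node (Quat 0 1 0 0) r m i ^+ n = 0.
Proof.
move=> hn r; have w1 := dyadic_root_neq1 imag_sphere_i hn.
under eq_bigr => i _ do rewrite node_exp.
rewrite -scaler_sumr; set S := \sum_(i < _) _.
have : (dyadic_root (Quat 0 1 0 0) m ^+ n - 1) * S = 0.
  rewrite -subrX1 -exprM mulnC exprM dyadic_root_full ?expr1n ?subrr //.
  exact: imag_sphere_i.
move=> /eqP; rewrite qmul_eq0 subr_eq0 (negPf w1) /= => /eqP ->.
by rewrite scaler0.
Qed.

Lemma fps_eval_take a q N : fps_conv a -> `|q| < 1 ->
  fps_eval a q = \sum_(n < N) q ^+ n * a n + q ^+ N * fps_eval (fps_shift N a) q.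
Proof.
move=> ca q1; elim: N => [|N IH].
  rewrite big_ord0 expr0 mul1r add0r; congr (fps_eval _ q).
  by apply: fpsP.
rewrite IH big_ord_recr /= -addrA; congr (_ + _).
rewrite (fps_eval_shift (fps_conv_shift N ca) q1) mulrDr /= addn0.
rewrite mulrA -exprSr; congr (_ + _ * fps_eval _ q).
by apply: fpsP => n /=; rewrite add1n addnS addSn.
Qed.

Lemma expr_lt_eventually t e : 0 <= t < 1 -> 0 < e -> exists m, t ^+ (2 ^ m) <= e.
Proof.
move=> /andP[t0 t1] e0; have h : `|t| < 1 by rewrite ger0_norm.
have /cvgrPdist_le /(_ e e0) [n _ hn] := cvg_expr h.
have := hn (2 ^ n)%N; rewrite /= sub0r normrN ger0_norm ?exprn_ge0 // => hn'.
by exists n; apply: hn'; rewrite ltnW // ltn_expl.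
Qed.

(** The mean of z^-n a(z) over N roots of unity of a single slice isolates the coefficient of order
    n < N, up to the tail of the series beyond N. Powers of z stand on the left of the coefficients,
    so noncommutativity does not interfere. *)
Lemma cauchy_estimate a r C n : fps_conv a -> 0 < r < 1 ->
  (forall q, `|q| = r -> `|fps_eval a q| <= C) -> `|a n| * r ^+ n <= C.
Proof.
move=> ca r01 aC; have /andP[r0 r1] := r01; have r0' := ltW r0.
have [|s rs s01] := @between_lt1 R r; first by rewrite r0'.
have /andP[s0 s1] := s01.
have [D D0 hD] := fps_conv_coef ca s01.
have t01 : 0 <= r / s < 1 by apply: ratio01.
have t1 : 0 < 1 - r / s by rewrite subr_gt0; case/andP: t01.
have tail N q : `|q| = r -> `|q ^+ N * fps_eval (fps_shift N a) q| <= D * (r / s) ^+ N / (1 - r / s).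
  move=> qr; have := @norm_fps_eval_le R (fps_shift N a) q s (D * s^-1 ^+ N) (fps_conv_shift N ca).
  rewrite qr rs s1 => /(_ isT) h; rewrite qnormM qnormX qr exprMn.
  rewrite (_ : _ / _ = r ^+ N * (D * s^-1 ^+ N / (1 - r / s))); last by ring.
  rewrite ler_wpM2l ?exprn_ge0 //; apply: h => m.
  by apply: le_trans (hD _) _; rewrite exprD mulrA.
apply/ler_addgt0Pr => e e0.
have eD : 0 < e * (1 - r / s) / (D + 1) by rewrite divr_gt0 ?mulr_gt0 // ltr_pwDr.
have [m0 hm0] := expr_lt_eventually t01 eD.
(* At least [m0], to make the tail at most [e], and larger than [n], so that n < 2^m. *)
pose m := (m0 + n.+1)%N; pose N := (2 ^ m)%N.
have nN : (n < N)%N.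
  by apply: leq_trans (_ : m <= _)%N; [rewrite /m addnS ltnS leq_addl|rewrite ltnW // ltn_expl].
have small : (r / s) ^+ N <= e * (1 - r / s) / (D + 1).
  apply: le_trans hm0; have /andP[? /ltW ?] := t01.
  by rewrite ler_wiXn2l // leq_exp2l // leq_addr.
pose z i := circle_node (Quat 0 1 0 0 : H) r m i.
have zr i : `|z i| = r by apply: norm_circle_node => //; exact: imag_sphere_i.
have z1 i : `|z i| < 1 by rewrite zr.
have z0 i : z i != 0 by rewrite -normr_gt0 zr.
have S1 : \sum_(i < N) (z i)^-1 ^+ n * fps_eval a (z i) =
    N%:R *: a n + \sum_(i < N) (z i)^-1 ^+ n * (z i ^+ N * fps_eval (fps_shift N a) (z i)).
  under eq_bigr => i _ do rewrite (fps_eval_take N ca (z1 i)) mulrDr mulr_sumr.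
  rewrite big_split /=; congr (_ + _); rewrite exchange_big /=.
  rewrite (bigD1 (Ordinal nN)) //= [X in _ + X]big1 ?addr0.
    under eq_bigr => i _ do rewrite mulrA (exprV_mul_le (z0 i) (leqnn n)) subnn expr0 mul1r.
    by rewrite sumr_const card_ord scaler_nat.
  move=> j jn; under eq_bigr => i _ do rewrite mulrA.
  rewrite -mulr_suml; apply/eqP; rewrite qmul_eq0; apply/orP; left; apply/eqP.
  have [jn'|nj|E] := ltngtP j n; last by case/eqP: jn; apply: val_inj.
    under eq_bigr => i _ do rewrite (exprV_mul_lt (z0 i) jn').
    apply: (sum_node_inv imag_sphere_i r01); rewrite subn_gt0 jn' /=.
    exact: leq_ltn_trans (leq_subr _ _) nN.
  under eq_bigr => i _ do rewrite (exprV_mul_le (z0 i) (ltnW nj)).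
  apply: sum_node; rewrite subn_gt0 nj /=.
  exact: leq_ltn_trans (leq_subr _ _) (ltn_ord j).
have N0 : 0 < N%:R :> R by rewrite ltr0n expn_gt0.
have rn0 : 0 < r ^+ n by rewrite exprn_gt0.
have /(congr1 (fun q : H => `|q|)) : N%:R *: a n =
    \sum_(i < N) (z i)^-1 ^+ n * (fps_eval a (z i) - z i ^+ N * fps_eval (fps_shift N a) (z i)).
  have -> : N%:R *: a n = \sum_(i < N) (z i)^-1 ^+ n * fps_eval a (z i) -
      \sum_(i < N) (z i)^-1 ^+ n * (z i ^+ N * fps_eval (fps_shift N a) (z i)).
    by rewrite S1 addrK.
  by rewrite -sumrB; apply: eq_bigr => i _; rewrite mulrBr.
rewrite normrZ gtr0_norm // => aN.
rewrite -(ler_pM2l N0) mulrA aN.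
apply: (@le_trans _ _ (\sum_(i < N) (C + e) / r ^+ n * r ^+ n)); last first.
  by rewrite divfK ?gt_eqF // sumr_const card_ord mulr_natl.
rewrite -mulr_suml ler_wpM2r ?(ltW rn0) //.
apply: le_trans (ler_norm_sum _ _ _) _; apply: ler_sum => i _.
rewrite qnormM qnormX qnormV zr exprVn mulrC ler_wpM2r ?invr_ge0 ?(ltW rn0) //.
apply: le_trans (ler_normB _ _) _; apply: lerD; first exact: aC.
apply: le_trans (tail N _ (zr i)) _; rewrite ler_pdivrMr //.
have D1 : 0 < D + 1 by rewrite ltr_pwDr.
move: small; rewrite ler_pdivlMr // => small; apply: le_trans small.
by rewrite mulrC ler_wpM2l ?exprn_ge0 ?lerDl //; case/andP: t01.
Qed.

Lemma fps_coef_le a C n : fps_conv a -> (forall q, `|q| < 1 -> `|fps_eval a q| <= C) ->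
  `|a n| <= C.
Proof.
move=> ca aC; apply/ler_addgt0Pr => e e0.
have bern t (m : nat) : 0 <= t <= 1 -> 1 - m%:R * t <= (1 - t) ^+ m.
  move=> /andP[t0 t1]; elim: m => [|m IH]; first by rewrite mul0r subr0 expr0.
  rewrite exprS -natr1; have m0 : 0 <= m%:R :> R by [].
  have t1' : 0 <= 1 - t by rewrite subr_ge0.
  have := ler_wpM2l t1' IH; have := mulr_ge0 m0 (sqr_ge0 t).
  by rewrite expr2; move: (_ ^+ m) m%:R => x y; nra.
have A0 : 0 <= `|a n| * n%:R by rewrite mulr_ge0.
(* On the sphere of radius 1 - t, Bernoulli's inequality gives |a_n| <= C + |a_n| n t, and the last
   term is at most [e]. *)
pose t := Num.min 2^-1 (e / (`|a n| * n%:R + 1)).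
have D1 : 0 < `|a n| * n%:R + 1 by rewrite ltr_pwDr.
have t0 : 0 < t by rewrite lt_min invr_gt0 ltr0n divr_gt0.
have th : t <= 2^-1 by rewrite ge_min lexx.
have te : t * (`|a n| * n%:R + 1) <= e by rewrite -ler_pdivlMr // ge_min lexx orbT.
have r01 : 0 < 1 - t < 1 by apply/andP; split; lra.
have h1 q : `|q| = 1 - t -> `|q| < 1 by move=> ->; lra.
have le := cauchy_estimate n ca r01 (fun q qr => aC q (h1 q qr)).
have t01 : 0 <= t <= 1 by apply/andP; split; lra.
have := ler_wpM2l (normr_ge0 (a n)) (bern t n t01).
by move: le te A0 t0; move: ((1 - t) ^+ n) `|a n| n%:R => x y z; nra.
Qed.

(** Otherwise (y / x)^n tends to 0, against 1 <= C (y / x)^n. This removes the constant left over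
    when powers of a series are estimated. *)
Lemma exp_comparison x y C : 0 <= x -> 0 <= y ->
  (forall n, x ^+ n <= C * y ^+ n) -> x <= y.
Proof.
move=> x0 y0 h; rewrite leNgt; apply/negP => yx.
have xp : 0 < x by apply: le_lt_trans yx.
have C1 : 1 <= C by have := h 0%N; rewrite !expr0 mulr1.
have t01 : 0 <= y / x < 1 by apply: ratio01.
have C2 : 0 < (2 * C)^-1 by rewrite invr_gt0; lra.
have [m hm] := expr_lt_eventually t01 C2.
have xm : 0 < x ^+ (2 ^ m) by rewrite exprn_gt0.
have : x ^+ (2 ^ m) * 1 <= x ^+ (2 ^ m) * (C * (y / x) ^+ (2 ^ m)).
  by rewrite mulr1 expr_div_n [X in _ <= _ * X]mulrA [leRHS]mulrC divfK ?gt_eqF.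
rewrite ler_pM2l // => le1.
have C0 : 0 <= C by lra.
have := ler_wpM2l C0 hm; rewrite invfM mulrCA divff; last by rewrite gt_eqF //; lra.
lra.
Qed.

Lemma fps_convX_exp a n : fps_conv a -> fps_conv (a ^+ n).
Proof.
by move=> ca; elim: n => [|n IH]; [exact: fps_conv1|rewrite exprS; apply: fps_convM].
Qed.

(** The second factor is read at a conjugate of [q], which lies on the same sphere. *)
Lemma norm_fps_evalM_le a b r C D : fps_conv a -> fps_conv b -> r < 1 ->
  0 <= D -> (forall q, `|q| = r -> `|fps_eval a q| <= C) ->
  (forall q, `|q| = r -> `|fps_eval b q| <= D) ->
  forall q, `|q| = r -> `|fps_eval (a * b) q| <= C * D.
Proof.
move=> ca cb r1 D0 aC bD q qr; have q1 : `|q| < 1 by rewrite qr.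
have [a0|a0] := eqVneq (fps_eval a q) 0.
  rewrite fps_evalM0 // normr0 mulr_ge0 //.
  by apply: le_trans (aC q qr).
rewrite (fps_evalMn0 ca cb q1 a0) qnormM; apply: ler_pM => //; first exact: aC.
by apply: bD; rewrite norm_conj_by.
Qed.

Lemma norm_fps_evalX_le a n r C : fps_conv a -> r < 1 -> 0 <= C ->
  (forall q, `|q| = r -> `|fps_eval a q| <= C) ->
  forall q, `|q| = r -> `|fps_eval (a ^+ n) q| <= C ^+ n.
Proof.
move=> ca r1 C0 aC; elim: n => [|n IH] q qr.
  by rewrite !expr0 fps_eval1 qnorm1.
rewrite !exprS; apply: (norm_fps_evalM_le ca _ r1) => //.
  exact: fps_convX_exp.
exact: exprn_ge0.
Qed.

(* Multiplying by a constant makes the value at [p] real, so that it commutes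
   with [p] and powers may be evaluated pointwise there. *)
Lemma max_modulus k r C p : fps_conv k -> r < 1 -> `|p| < r ->
  (forall q, `|q| = r -> `|fps_eval k q| <= C) -> `|fps_eval k p| <= C.
Proof.
move=> ck r1 pr kC; have p1 : `|p| < 1 by apply: lt_trans r1.
have r0 : 0 < r by apply: le_lt_trans pr.
have C0 : 0 <= C.
  by apply: le_trans (kC r%:A _) => //; rewrite qnormA gtr0_norm.
set v := fps_eval k p; have [v0|v0] := eqVneq v 0; first by rewrite v0 normr0.
pose l := k * fps_const (qconj v).
have cl : fps_conv l by apply: fps_convM => //; exact: fps_conv_const.
have lp : fps_eval l p = (`|v| ^+ 2)%:A by rewrite fps_evalMC // mul_qconj.
have lnp n : fps_eval (l ^+ n) p = ((`|v| ^+ 2) ^+ n)%:A.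
  move: (`|v| ^+ 2) lp => x lp.
  elim: n => [|n IH]; first by rewrite !expr0 fps_eval1 scale1r.
  rewrite exprS fps_evalM_comm //; last by rewrite lp qalg_comm.
    by rewrite lp IH exprS -scalerAl mul1r scalerA.
  exact: fps_convX_exp.
have lC q : `|q| = r -> `|fps_eval l q| <= C * `|v|.
  move=> qr; rewrite fps_evalMC ?qr // qnormM norm_qconj ler_wpM2r //.
  exact: kC.
have nv : 0 < `|v| by rewrite normr_gt0.
suff : `|v| ^+ 2 <= C * `|v| by rewrite expr2 ler_pM2r.
(* The Cauchy estimates for l^n sum to a geometric series, whose constant does not depend on [n]. *)
apply: (@exp_comparison _ _ (1 - `|p| / r)^-1) => [||n]; first exact: sqr_ge0.
  by rewrite mulr_ge0.
have := norm_fps_eval_le (C := (C * `|v|) ^+ n) (fps_convX_exp n cl) (_ : `|p| < r < 1).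
rewrite pr r1 lnp qnormA ger0_norm ?exprn_ge0 //.
move=> /(_ isT) h; rewrite [leRHS]mulrC; apply: h => j.
rewrite exprVn ler_pdivlMr ?exprn_gt0 //.
apply: cauchy_estimate; first exact: fps_convX_exp.
  by rewrite r0.
by apply: norm_fps_evalX_le => //; rewrite mulr_ge0.
Qed.

Lemma max_modulus_limit k p : fps_conv k -> `|p| < 1 ->
  (forall e, 0 < e -> exists r, [/\ `|p| < r, r < 1 &
     forall q, `|q| = r -> `|fps_eval k q| <= 1 + e]) ->
  `|fps_eval k p| <= 1.
Proof.
move=> ck p1 h; apply/ler_addgt0Pr => e /h [r [pr r1 kr]].
exact: max_modulus ck r1 pr kr.
Qed.

Lemma cvg_sum_ord (n : nat) (u : 'I_n -> nat -> H) (l : 'I_n -> H) :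
  (forall i, u i @ \oo --> l i) ->
  (fun N => \sum_(i < n) u i N) @ \oo --> \sum_(i < n) l i.
Proof.
move=> ul; elim: n u l ul => [|n IH] u l ul.
  by under eq_fun do rewrite big_ord0; rewrite big_ord0; exact: cvg_cst.
under eq_fun do rewrite big_ord_recr /=.
rewrite big_ord_recr /=; apply: cvgD; last exact: ul.
by apply: IH => i; exact: ul.
Qed.

(** The geometric series in [b] converges coefficientwise, since b^n is bounded by C^n on the ball
    and hence so are its coefficients. Those of the sum are bounded by 1 / (1 - C), which gives
    convergence in the ball. *)
Lemma fps_neumann b C : fps_conv b -> C < 1 ->
  (forall q, `|q| < 1 -> `|fps_eval b q| <= C) ->
  exists c, [/\ fps_conv c, (1 - b) * c = 1 & c * (1 - b) = 1].
Proof.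
move=> cb C1 bC.
have C0 : 0 <= C by apply: le_trans (bC 0 _); rewrite ?normr0.
have C01 : 0 <= C < 1 by rewrite C0.
have bn n j : `|(b ^+ n) j| <= 1 * C ^+ n.
  rewrite mul1r; apply: fps_coef_le; first exact: fps_convX_exp.
  by move=> q q1; apply: (@norm_fps_evalX_le b n `|q| C) => // p pq; apply: bC; rewrite pq.
pose P N := \sum_(0 <= n < N) b ^+ n.
have PE N j : (P N) j = series (fun n => (b ^+ n) j) N.
  rewrite /P /series /=; elim/big_rec2: _ => [//|n x y _ <-].
  by rewrite coefDf.
pose c := Fps (fun j => limn (series (fun n => (b ^+ n) j))).
have Pc j : (fun N => (P N) j) @ \oo --> c j.
  under eq_fun do rewrite PE.
  exact: (series_dominated_cvg C01 (fun n => bn n j)).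
have cc : fps_conv c.
  apply: (@fps_conv_le _ _ (1 / (1 - C))) => j.
  apply: cvg_normle (Pc j) _ => N; rewrite PE.
  by apply: norm_series_le => // n; exact: bn.
have lim1 j : (fun N => (1 - b ^+ N) j) @ \oo --> (1 : fps H) j.
  have h : (fun N => (1 : fps H) j - (b ^+ N) j) @ \oo --> (1 : fps H) j - 0.
    by apply: cvgB; [exact: cvg_cst|exact: (geometric_bound_cvg0 C01 (fun n => bn n j))].
  by rewrite subr0 in h.
have Pl N : (1 - b) * P N = 1 - b ^+ N.
  by rewrite /P big_mkord -[1 - b]opprB mulNr -subrX1 opprB.
have Pr N : P N * (1 - b) = 1 - b ^+ N.
  rewrite -Pl; apply/esym; apply: commr_sum => i _.
  by apply/commrX/commr_sym/commrB; [exact: commr1|exact: commr_refl].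
have l1 j : (fun N => (1 - b ^+ N) j) @ \oo --> ((1 - b) * c) j.
  under eq_fun do rewrite -Pl coefMf.
  by rewrite coefMf; apply: cvg_sum_ord => i; apply: cvg_qmull; exact: Pc.
have l2 j : (fun N => (1 - b ^+ N) j) @ \oo --> (c * (1 - b)) j.
  under eq_fun do rewrite -Pr coefMf.
  by rewrite coefMf; apply: cvg_sum_ord => i; apply: cvg_qmulr; exact: Pc.
by exists c; split=> //; apply: fpsP => j;
  [exact: (cvg_unique (@norm_hausdorff _ _) (l1 j) (lim1 j))
  |exact: (cvg_unique (@norm_hausdorff _ _) (l2 j) (lim1 j))].
Qed.

End RegularFunctions.

(** * The Schwarz-Pick quotient *)

Section SchwarzPick.
Variable R : realType.
Local Notation H := (quat R).
Implicit Types (a b c g h k : fps H) (p q s u v w : H) (r : R).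
Local Notation X := (fpsX H).
Local Notation "c %:S" := (fps_const c) (at level 2, format "c %:S").

Hint Resolve fps_convX fps_conv_const fps_conv1 fps_convD fps_convB fps_convM fps_convN : core.

Lemma fps_eval_XB p q : `|p| < 1 -> fps_eval (X - q%:S) p = p - q.
Proof. by move=> p1; rewrite fps_evalB ?fps_evalX ?fps_eval_const. Qed.

Lemma fps_eval_1BXM p q : `|p| < 1 -> fps_eval (1 - X * q%:S) p = 1 - p * q.
Proof. by move=> p1; rewrite fps_evalB ?fps_eval1 ?fps_evalMC ?fps_evalX //; apply: fps_convM. Qed.

Lemma fps_eval_unit_neq0 a b q : fps_conv a -> fps_conv b -> a * b = 1 -> `|q| < 1 ->
  fps_eval a q != 0.
Proof.
move=> ca cb ab q1; apply/eqP => a0; have := fps_evalM0 ca cb q1 a0.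
by rewrite ab fps_eval1 => /eqP; rewrite oner_eq0.
Qed.

(* If [k 0 = 1] and [c] is the first later nonzero coefficient of [k], then [n c]
   is a coefficient of [k ^+ n], hence bounded. *)
Lemma fps_const_of_norm1 k : fps_conv k ->
  (forall q, `|q| < 1 -> `|fps_eval k q| <= 1) -> `|k 0%N| = 1 -> k = (k 0%N)%:S.
Proof.
move=> ck kle k1; pose l := k * (qconj (k 0%N))%:S.
have cl : fps_conv l by apply: fps_convM.
have lE n : l n = k n * qconj (k 0%N) by rewrite coefMCf.
have l0 : l 0%N = 1 by rewrite lE mul_qconj k1 expr1n scale1r.
have lle q : `|q| < 1 -> `|fps_eval l q| <= 1.
  by move=> q1; rewrite fps_evalMC // qnormM norm_qconj k1 mulr1 kle.
clearbody l.
have ln0 N : (l ^+ N) 0%N = 1.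
  by elim: N => [|N IH]; rewrite ?expr0 // exprS coefMf big_ord1 /= l0 IH mul1r.
have lm m : (forall j, (j < m)%N -> l j.+1 = 0) -> l m.+1 = 0.
  move=> lj; have lN N : (l ^+ N) m.+1 = N%:R *: l m.+1.
    elim: N => [|N IH]; first by rewrite expr0 scale0r.
    rewrite exprS coefMf big_ord_recl big_ord_recr /= big1 => [|i _]; last first.
      by rewrite /bump /= add1n lj ?mul0r.
    rewrite add0r /bump /= add1n subn0 subnn l0 ln0 mul1r mulr1 IH.
    by rewrite -natr1 scalerDl scale1r.
  apply/eqP; rewrite -normr_le0 leNgt; apply/negP => lp.
  have bd N : N%:R * `|l m.+1| <= 1.
    rewrite -[N%:R]ger0_norm // -normrZ -lN.
    apply: fps_coef_le => [|q q1]; first exact: fps_convX_exp.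
    rewrite -[X in _ <= X](expr1n _ N); apply: (@norm_fps_evalX_le _ _ _ `|q|) => // p pq.
    by apply: lle; rewrite pq.
  have := bd (Num.truncn `|l m.+1|^-1).+1.
  rewrite -ler_pdivlMr // mul1r leNgt => /negP; apply.
  by have := truncnS_gt `|l m.+1|^-1.
have l_eq0 m : l m.+1 = 0.
  elim/ltn_ind: m => m IH; apply: lm => j jm; exact: IH.
apply: fpsP => -[|m] //=; have := l_eq0 m; rewrite lE => /eqP.
rewrite qmul_eq0 => /orP[/eqP //|].
by rewrite -normr_eq0 norm_qconj k1 oner_eq0.
Qed.

Lemma norm_mulr_conj_lt1 p w : `|p| <= 1 -> `|w| < 1 -> 1 - p * qconj w != 0.
Proof.
move=> p1 w1; rewrite subr_eq0; apply/eqP => /(congr1 (fun q : H => `|q|)).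
rewrite qnorm1 qnormM norm_qconj => E.
by have := ler_piMl (normr_ge0 w) p1; rewrite -E leNgt w1.
Qed.

Lemma pick_factor_le p w : `|p| <= 1 -> `|w| < 1 -> `|p - w| <= `|1 - p * qconj w|.
Proof.
move=> p1 w1; rewrite -(ler_pXn2r (_ : 0 < 2)%N) ?nnegrE // -subr_ge0 norm1DM_sq.
by rewrite mulr_ge0 // subr_ge0 exprn_ile1 // ltW.
Qed.

Lemma pick_factor_lt p w : `|w| < 1 -> `|p - w| < `|1 - p * qconj w| -> `|p| < 1.
Proof.
move=> w1; rewrite -(ltr_pXn2r (_ : 0 < 2)%N) ?nnegrE // -subr_gt0 norm1DM_sq.
have w2 : 0 < 1 - `|w| ^+ 2 by rewrite subr_gt0 exprn_ilt1.
by rewrite pmulr_lgt0 // subr_gt0 expr_lt1.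
Qed.

Section PickTransform.
Variables (g G : fps H) (w : H).
Hypotheses (cg : fps_conv g) (cG : fps_conv G) (w1 : `|w| < 1).
Hypothesis g_le : forall q, `|q| < 1 -> `|fps_eval g q| <= 1.
Hypotheses (gG : (1 - g * (qconj w)%:S) * G = 1) (Gg : G * (1 - g * (qconj w)%:S) = 1).

Let cb : fps_conv (1 - g * (qconj w)%:S). Proof. by apply: fps_convB => //; apply: fps_convM. Qed.

Let eval_b q : `|q| < 1 ->
  fps_eval (1 - g * (qconj w)%:S) q = 1 - fps_eval g q * qconj w.
Proof. by move=> q1; rewrite fps_evalB ?fps_eval1 ?fps_evalMC //; apply: fps_convM. Qed.

(** Both G * (g - w) and G * (1 - g conj(w)) = 1 read their second factor at the same conjugate s of
    [q]; the modulus is thus |g(s) - w| / |1 - g(s) conj(w)|. *)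
Lemma pick_transform_le q : `|q| < 1 -> `|fps_eval (G * (g - w%:S)) q| <= 1.
Proof.
move=> q1; have y0 := fps_eval_unit_neq0 cG cb Gg q1.
rewrite (fps_evalMn0 cG _ q1 y0); last by apply: fps_convB.
have := fps_evalMn0 cG cb q1 y0; rewrite Gg fps_eval1.
set y := fps_eval G q in y0 *; set s := _ * y.
have s1 : `|s| < 1 by rewrite norm_conj_by.
rewrite eval_b // fps_evalB ?fps_eval_const // => /(congr1 (fun q : H => `|q|)).
rewrite qnorm1 !qnormM => ->.
by rewrite ler_wpM2l // pick_factor_le // g_le.
Qed.

(** Conversely g - w is 1 - g conj(w) times the transform; at [q] this gives |g(q) - w| < |1 - g(q)
    conj(w)|, which forces |g(q)| < 1. *)
Lemma pick_transform_lt :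
  (forall q, `|q| < 1 -> `|fps_eval (G * (g - w%:S)) q| < 1) ->
  forall q, `|q| < 1 -> `|fps_eval g q| < 1.
Proof.
move=> ult q q1; apply: (@pick_factor_lt _ w w1).
have v0 := fps_eval_unit_neq0 cb cG gG q1.
have cu : fps_conv (G * (g - w%:S)) by apply: fps_convM => //; apply: fps_convB.
have := fps_evalMn0 cb cu q1 v0; rewrite mulrA gG mul1r fps_evalB // fps_eval_const.
rewrite !eval_b // in v0 *; move=> ->; rewrite qnormM gtr_pMr ?normr_gt0 //.
by apply: ult; rewrite norm_conj_by.
Qed.

End PickTransform.

Lemma pick_inverse g w : fps_conv g -> `|w| < 1 ->
  (forall q, `|q| < 1 -> `|fps_eval g q| <= 1) ->
  exists G, [/\ fps_conv G, (1 - g * (qconj w)%:S) * G = 1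
    & G * (1 - g * (qconj w)%:S) = 1].
Proof.
move=> cg w1 gle; apply: (@fps_neumann _ _ `|w|) => // [|q q1].
  by apply: fps_convM.
by rewrite fps_evalMC // qnormM norm_qconj ler_piMl // gle.
Qed.

Lemma pick_inverse_left g w : fps_conv g -> `|w| < 1 ->
  (forall q, `|q| < 1 -> `|fps_eval g q| <= 1) ->
  exists G, [/\ fps_conv G, (1 - (qconj w)%:S * g) * G = 1
    & G * (1 - (qconj w)%:S * g) = 1].
Proof.
move=> cg w1 gle; apply: (@fps_neumann _ _ `|w|) => // [|q q1].
  by apply: fps_convM.
have [->|w0] := eqVneq (qconj w) 0.
  by rewrite fps_const0 mul0r -fps_const0 fps_eval_const normr0.
by rewrite fps_evalCM // qnormM norm_qconj ler_piMr // gle // norm_conj_by.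
Qed.

Lemma fps_eval_at0 a : fps_conv a -> fps_eval a 0 = a 0%N.
Proof. by move=> ca; rewrite fps_eval_shift ?normr0 // mul0r addr0. Qed.

(** The Pick transform of [k] at k(0) vanishes at 0, so Schwarz's lemma bounds it by |q| < 1, and
    the strict bound is carried back to [k]. *)
Lemma schwarz_strict k : fps_conv k -> (forall q, `|q| < 1 -> `|fps_eval k q| <= 1) ->
  `|k 0%N| < 1 -> forall q, `|q| < 1 -> `|fps_eval k q| < 1.
Proof.
move=> ck kle k0; have [G [cG kG Gk]] := pick_inverse ck k0 kle.
apply: (pick_transform_lt ck cG k0 kG) => q q1.
set u := G * _; have cu : fps_conv u by apply: fps_convM => //; apply: fps_convB.
have u0 : u 0%N = 0 by rewrite coefMf big_ord1 coefBf /= subrr mulr0.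
have uE p : `|p| < 1 -> fps_eval u p = p * fps_eval (fps_shift 1 u) p.
  by move=> p1; rewrite fps_eval_shift // u0 add0r.
have cs := fps_conv_shift 1 cu.
rewrite uE // qnormM; apply: le_lt_trans (q1); rewrite ler_piMr //.
apply: max_modulus_limit => // e e0.
(* Beyond |q|, and at least 1 / (1 + e), so that dividing the transform by the variable costs a
   factor at most 1 + e. *)
exists (Num.max ((1 + `|q|) / 2) (1 + e)^-1); split.
- by rewrite lt_max; apply/orP; left; lra.
- by rewrite gt_max invf_lt1 ?ltrDl ?e0 ?andbT; lra.
move=> p pr; have p1 : `|p| < 1.
  by rewrite pr gt_max invf_lt1 ?ltrDl ?e0 ?andbT; lra.
have re : (1 + e)^-1 <= `|p| by rewrite pr le_max lexx orbT.
have p0 : 0 < `|p| by apply: lt_le_trans re; rewrite invr_gt0; lra.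
have := pick_transform_le ck cG k0 kle Gk p1; rewrite -/u uE // qnormM.
rewrite -ler_pdivlMl // mulr1 => /le_trans; apply.
by rewrite -[1 + e]invrK lef_pV2 // ?posrE // invr_gt0; lra.
Qed.

Lemma max_modulus_strict k : fps_conv k ->
  (forall q, `|q| < 1 -> `|fps_eval k q| <= 1) ->
  (exists2 u : H, `|u| = 1 & k = u%:S) \/ (forall q, `|q| < 1 -> `|fps_eval k q| < 1).
Proof.
move=> ck kle; have := kle 0; rewrite normr0 fps_eval_at0 // => /(_ ltr01).
rewrite le_eqVlt => /orP[/eqP k1|k1]; last by right; exact: schwarz_strict.
by left; exists (k 0%N) => //; exact: fps_const_of_norm1.
Qed.

Lemma fps_XB_comm p q : p * q = q * p ->
  (X - p%:S) * (1 - q%:S * X) = (1 - q%:S * X) * (X - p%:S).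
Proof.
move=> pq; have cX (a : fps H) : GRing.comm a X by exact: fpsX_comm.
apply: commrB; first exact: commr1.
apply: commr_sym; apply: commrB; first exact: cX.
apply: commr_sym; apply: commrM; last exact: cX.
by rewrite /GRing.comm -!fps_constM pq.
Qed.

(** At s the product (X - q0) k reads [k] at (s - q0)^-1 s (s - q0). For given q with |q| > |q0|,
    the point s for which this is q is the conjugate of q by q - conj(q0). So [k] is controlled on
    entire spheres near the boundary, where the maximum modulus principle applies. *)
Lemma schwarz_pick_quotient g k q0 : fps_conv g -> fps_conv k -> `|q0| < 1 ->
  (forall q, `|q| < 1 -> `|fps_eval g q| <= 1) ->
  (1 - (qconj q0)%:S * X) * g = (X - q0%:S) * k ->
  forall p, `|p| < 1 -> `|fps_eval k p| <= 1.
Proof.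
move=> cg ck q01 gle gk p p1.
have key q : `|q0| < `|q| -> `|q| < 1 -> exists2 s : H, `|s| = `|q| &
    `|s - q0| * `|fps_eval k q| <= `|1 - s * qconj q0|.
  move=> qq q1; pose t := q - qconj q0.
  have t0 : t != 0.
    by rewrite subr_eq0; apply: contraTneq qq => ->; rewrite norm_qconj ltxx.
  pose s := t^-1 * q * t; have sq : `|s| = `|q| by rewrite norm_conj_by.
  have s1 : `|s| < 1 by rewrite sq.
  exists s => //.
  have s0 : s - q0 != 0 by rewrite subr_eq0; apply: contraTneq qq => <-; rewrite sq ltxx.
  have ts : t * s = q * t by rewrite /s !mulrA mulrV ?mul1r.
  (* [s (s - q0) = (s - q0) q] because [q t - t q0 = q^2 - 2 Re(q0) q + |q0|^2]. *)
  have ss : s * (s - q0) = (s - q0) * q.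
    apply: (qmulI t0).
    rewrite (mulrA t) ts -mulrA mulrBr ts (mulrA t) (mulrBr t) ts /t; clear.
    by move: q q0 => a b; quat_field.
  have sE : (s - q0)^-1 * s * (s - q0) = q.
    by rewrite -mulrA ss mulKr.
  have cXq : fps_conv (X - q0%:S) by apply: fps_convB.
  have cBq : fps_conv (1 - X * (qconj q0)%:S) by apply: fps_convB => //; apply: fps_convM.
  have := congr1 (fun a => fps_eval a s) gk.
  rewrite (fps_evalMn0 cXq ck s1) fps_eval_XB // sE fpsX_comm.
  have v0 : fps_eval (1 - X * (qconj q0)%:S) s != 0.
    by rewrite fps_eval_1BXM // norm_mulr_conj_lt1 // ltW.
  rewrite (fps_evalMn0 cBq cg s1 v0); move: v0; rewrite fps_eval_1BXM // => v0.
  move=> /(congr1 (fun q : H => `|q|)); rewrite !qnormM => <-.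
  by rewrite ler_piMr // gle // norm_conj_by.
apply: max_modulus_limit => // e e0.
(* On the sphere of radius [r], |s - q0| >= dl and 1 - r^2 <= 2 e dl^2; the identity for the linear
   factors gives |1 - s conj(q0)|^2 <= (1 + 2 e) |s - q0|^2. *)
pose dl := (1 - `|q0|) / 2; have dl0 : 0 < dl by rewrite /dl; lra.
pose r := Num.max (Num.max ((1 + `|p|) / 2) ((1 + `|q0|) / 2)) (1 - e * dl ^+ 2).
have rp : (1 + `|p|) / 2 <= r by rewrite !le_max lexx.
have rq : (1 + `|q0|) / 2 <= r by rewrite !le_max lexx orbT.
have re : 1 - e * dl ^+ 2 <= r by rewrite !le_max lexx !orbT.
have ed : 0 < e * dl ^+ 2 by rewrite mulr_gt0 // exprn_gt0.
have r1 : r < 1 by rewrite !gt_max; apply/andP; split; [apply/andP; split|]; lra.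
exists r; split=> [||q qr]; [lra|by []|].
have r0 : 0 <= r by rewrite -qr.
have [||s sq] := key q; rewrite ?qr //; first by lra.
have sd : dl <= `|s - q0|.
  by apply: le_trans (lerB_dist _ _); rewrite sq qr /dl; lra.
move=> le; rewrite -(ler_pM2l (lt_le_trans dl0 sd)); apply: le_trans le _.
rewrite -(ler_pXn2r (_ : 0 < 2)%N) ?nnegrE ?mulr_ge0 //; last by lra.
have := norm1DM_sq s q0; rewrite sq qr => /eqP; rewrite subr_eq => /eqP ->.
have h1 : (1 - r ^+ 2) * (1 - `|q0| ^+ 2) <= 2 * (e * dl ^+ 2).
  have a1 : 1 - r ^+ 2 <= 2 * (e * dl ^+ 2) by nra.
  have a2 : 0 <= 1 - r ^+ 2 by nra.
  apply: le_trans a1; move: a2 (sqr_ge0 `|q0|); move: (1 - r ^+ 2) (`|q0| ^+ 2) => x y.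
  by nra.
have h2 : dl ^+ 2 <= `|s - q0| ^+ 2 by rewrite lerXn2r ?nnegrE ?normr_ge0 ?(ltW dl0).
rewrite exprMn; have := sqr_ge0 `|s - q0|; move: h1 h2; move: (_ * (1 - `|q0| ^+ 2)) (`|s - q0| ^+ 2) (dl ^+ 2).
by move=> x y z; nra.
Qed.

End SchwarzPick.

Ltac fps_additive :=
  let n := fresh "n" in
  apply: fpsP => n; rewrite ?(coefDf, coefNf);
  repeat match goal with |- context [coef ?x ?m] =>
    move: (coef x m) => [? ? ? ?] end;
  congr Quat => /=; ring.

Section SchwarzPickFactor.
Variable R : realType.
Local Notation H := (quat R).
Implicit Types (a b g h k G : fps H) (p q s u v w : H) (r : R).
Local Notation X := (fpsX H).
Local Notation "c %:S" := (fps_const c) (at level 2, format "c %:S").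

Hint Resolve fps_convX fps_conv_const fps_conv1 fps_convD fps_convB fps_convM fps_convN : core.

Lemma fps_const_real_comm (x : R) a : (x%:A : H)%:S * a = a * (x%:A : H)%:S.
Proof. by apply: fpsP => n; rewrite coefCMf coefMCf qalg_comm. Qed.

(** The real number |w|^2 is central. Consequently the quotient with the reciprocal on the right, as
    in the theorem, equals the one with the reciprocal on the left, which [pick_transform_le]
    bounds. *)
Lemma pick_transform_sym a w :
  (1 - a * (qconj w)%:S) * (a - w%:S) = (a - w%:S) * (1 - (qconj w)%:S * a).
Proof.
have E : a * (qconj w)%:S * w%:S = w%:S * (qconj w)%:S * a.
  by rewrite -mulrA -!fps_constM mul_conjq mul_qconj fps_const_real_comm.
rewrite !(mulrBr, mulrBl, mul1r, mulr1, mulrA) E.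
move: (a * (qconj w)%:S * a) (w%:S * (qconj w)%:S * a) => x y.
by fps_additive.
Qed.

(* [G] and [r0] are the regular reciprocals of the theorem, and [k] is the factor by
   which each left-hand side differs from the corresponding right-hand side. *)
Lemma schwarz_pick_factor a q0 : fps_conv a -> `|q0| < 1 ->
  (forall q, `|q| < 1 -> `|fps_eval a q| < 1) ->
  let w := fps_eval a q0 in
  exists G (r0 k : fps H), [/\ fps_conv G, fps_conv r0 & fps_conv k] /\
    [/\ (1 - (qconj w)%:S * a) * G = 1, G * (1 - (qconj w)%:S * a) = 1,
        (1 - (qconj q0)%:S * X) * r0 = 1 & r0 * (1 - (qconj q0)%:S * X) = 1] /\
    [/\ fps_quot q0 a * G = r0 * k,
        (1 - a * (qconj w)%:S) * ((a - w%:S) * G) = a - w%:S,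
        (1 - (qconj q0)%:S * X) * ((a - w%:S) * G) = (X - q0%:S) * k
      & forall p, `|p| < 1 -> `|fps_eval k p| <= 1].
Proof.
move=> ca q01 alt w; have w1 : `|w| < 1 by exact: alt.
have ale q : `|q| < 1 -> `|fps_eval a q| <= 1 by move=> /alt /ltW.
have [G [cG FG GF]] := pick_inverse_left ca w1 ale.
have [G' [cG' F'G' G'F']] := pick_inverse ca w1 ale.
have Xle q : `|q| < 1 -> `|fps_eval X q| <= 1 by move=> q1; rewrite fps_evalX // ltW.
have [r0 [cr0 Br0 r0B]] := pick_inverse_left (@fps_convX R) q01 Xle.
have cR := fps_conv_quot q01 ca.
have cB : fps_conv (1 - (qconj q0)%:S * X) by apply: fps_convB => //; apply: fps_convM.
pose k := (1 - (qconj q0)%:S * X) * (fps_quot q0 a * G).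
have ck : fps_conv k by apply: fps_convM => //; apply: fps_convM.
have cg : fps_conv ((a - w%:S) * G) by apply: fps_convM => //; apply: fps_convB.
have gE : (a - w%:S) * G = G' * (a - w%:S).
  transitivity (G' * ((1 - a * (qconj w)%:S) * (a - w%:S)) * G).
    by rewrite mulrA G'F' mul1r.
  by rewrite pick_transform_sym -!mulrA FG mulr1.
have kE : (1 - (qconj q0)%:S * X) * ((a - w%:S) * G) = (X - q0%:S) * k.
  rewrite /k [RHS]mulrA fps_XB_comm ?mul_qconj ?mul_conjq // -mulrA; congr (_ * _).
  by rewrite mulrA fps_quotE.
exists G, r0, k; split=> //; split=> //; split=> //.
- by rewrite /k [RHS]mulrA r0B mul1r.
- by rewrite mulrA pick_transform_sym -mulrA FG mulr1.
- apply: (schwarz_pick_quotient cg ck q01 _ kE) => q q1; rewrite gE.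
  exact: (pick_transform_le ca cG' w1 ale G'F' q1).
Qed.

Lemma norm_fps_eval_unitM b c k q : fps_conv b -> fps_conv c -> fps_conv k ->
  b * c = 1 -> `|q| < 1 -> exists2 p, `|p| < 1 &
  `|fps_eval (b * k) q| = `|fps_eval b q| * `|fps_eval k p|.
Proof.
move=> cb cc ck bc q1; have b0 := fps_eval_unit_neq0 cb cc bc q1.
eexists; last by rewrite (fps_evalMn0 cb ck q1 b0) qnormM.
by rewrite norm_conj_by.
Qed.

Lemma trace_comm p q : p * (q + qconj q) = (q + qconj q) * p.
Proof. by quat_field. Qed.

Lemma char_poly_root p q :
  qconj p * qconj p * q - qconj p * ((p + qconj p) * q) + p * qconj p * q = 0.
Proof. by quat_field. Qed.

(** With q0 for [p] and c for [q], this is c F(p') = conj(1 - f^s(q0)) c, where F = 1 - conj(w) f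
    and p' = c^-1 conj(q0) c. *)
Lemma spherical_conj_identity p q w :
  q - (qconj p * q * (qconj w * q) + q * (qconj w * (w - p * q))) =
  (1 - (q * qconj w * qconj p + (w - p * q) * qconj w)) * q.
Proof. by quat_field. Qed.

(** * The sphere through q0 and the symmetrization *)

Section SphericalIdentity.
Variables (a G : fps H) (q0 : H).
Hypotheses (ca : fps_conv a) (cG : fps_conv G) (q01 : `|q0| < 1).
Local Notation w := (fps_eval a q0).
Local Notation c := (fps_eval (fps_quot q0 a) (qconj q0)).
Hypotheses (w1 : `|w| < 1) (FG : (1 - (qconj w)%:S * a) * G = 1).

Local Notation N0 := ((X - q0%:S) * (X - (qconj q0)%:S)).
Local Notation R' := (fps_quot (qconj q0) (fps_quot q0 a)).

Local Lemma norm_conj_q0_lt1 : `|qconj q0| < 1. Proof. by rewrite norm_qconj. Qed.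
Local Lemma fps_conv_quot1 : fps_conv (fps_quot q0 a). Proof. exact: fps_conv_quot. Qed.
Local Lemma fps_conv_quot2 : fps_conv R'. Proof. exact: (fps_conv_quot norm_conj_q0_lt1 fps_conv_quot1). Qed.
Local Lemma fps_conv_sphere_poly : fps_conv N0. Proof. by apply: fps_convM; apply: fps_convB. Qed.

Hint Resolve norm_conj_q0_lt1 fps_conv_quot1 fps_conv_quot2 fps_conv_sphere_poly : core.

Local Lemma sphere_poly_real : fps_conj N0 = N0.
Proof.
by rewrite fps_conjM !fps_conjD !fps_conjN !fps_conj_const fps_conjX qconjK.
Qed.

Local Lemma sphere_poly_comm b : N0 * b = b * N0.
Proof. exact: (fps_real_comm b sphere_poly_real). Qed.

(* Modulo [N0], that is on the sphere through [q0], [a] is affine. *)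
Local Lemma sphere_affine : a = X * c%:S + (w - q0 * c)%:S + N0 * R'.
Proof.
have h1 := fps_quotE ca q01; have h2 := fps_quotE fps_conv_quot1 norm_conj_q0_lt1.
rewrite -mulrA h2 mulrBr h1 mulrBl fps_constB fps_constM.
move: (X * c%:S) (q0%:S * c%:S) (w%:S) => x y z.
by fps_additive.
Qed.

Local Lemma sphere_affine_conj : fps_conj a =
  X * (qconj c)%:S + (qconj w - qconj c * qconj q0)%:S + N0 * fps_conj R'.
Proof.
rewrite {1}sphere_affine 2!fps_conjD (fps_conjM X) (fps_conjM _ R') sphere_poly_real fps_conjX.
by rewrite !fps_conj_const sphere_poly_comm fpsX_comm qconjB qconjM.
Qed.

Local Lemma sphere_poly_eval p : `|p| < 1 ->
  fps_eval N0 p = p * p - p * (q0 + qconj q0) + q0 * qconj q0.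
Proof.
move=> p1; have -> : N0 = X * X - X * (q0 + qconj q0)%:S + (q0 * qconj q0)%:S.
  rewrite mulrBl !mulrBr -fps_constM [q0%:S * X]fpsX_comm fps_constD mulrDr.
  move: (X * X) (X * q0%:S) (X * _) (_%:S) => x y z t.
  by fps_additive.
have cXX : fps_conv (X * X) by apply: fps_convM.
have cXt : fps_conv (X * (q0 + qconj q0)%:S) by apply: fps_convM.
rewrite (fps_evalD (fps_convB cXX cXt) (fps_conv_const _) p1) (fps_evalB cXX cXt p1).
rewrite fps_eval_const (fps_evalMC _ (@fps_convX R) p1).
by rewrite (fps_evalM_comm (@fps_convX R) (@fps_convX R) p1) !(fps_evalX p1).
Qed.

Local Lemma sphere_affine_eval s u v b p : fps_conv b -> `|p| < 1 -> fps_eval N0 p = 0 ->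
  fps_eval (s%:S * (X * u%:S + v%:S + N0 * b)) p = p * (s * u) + s * v.
Proof.
move=> cb p1 N0p.
have -> : s%:S * (X * u%:S + v%:S + N0 * b) =
    X * (s * u)%:S + (s * v)%:S + N0 * (s%:S * b).
  have h1 : s%:S * (X * u%:S) = X * (s * u)%:S by rewrite mulrA fpsX_comm -mulrA fps_constM.
  have h2 : s%:S * (N0 * b) = N0 * (s%:S * b).
    by rewrite [LHS]mulrA -(sphere_poly_comm s%:S) [RHS]mulrA.
  by rewrite 2!(mulrDr s%:S) h1 h2 (fps_constM s v).
have cXu : fps_conv (X * (s * u)%:S) by apply: fps_convM.
have cNb : fps_conv (N0 * (s%:S * b)) by apply: fps_convM => //; apply: fps_convM.
rewrite (fps_evalD (fps_convD cXu (fps_conv_const _)) cNb p1).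
rewrite (fps_evalD cXu (fps_conv_const _) p1) fps_eval_const.
rewrite (fps_evalMC _ (@fps_convX R) p1) (fps_evalX p1).
by rewrite (fps_evalM0 fps_conv_sphere_poly (fps_convM (fps_conv_const s) cb) p1 N0p) addr0.
Qed.

(** The point p = c^-1 conj(q0) c lies on the sphere of [q0]. There the affine forms give conj(w) as
    the value of the conjugate of [a], so F^c(p) = 1 - |w|^2 is real. Evaluating (F^c * F) * G = F^c
    at p then yields |F(p)| |G(p)| = 1, and |F(p)| = |1 - f^s(q0)| by explicit computation. *)
Lemma spherical_identity : c != 0 ->
  `|1 - fps_eval (a * fps_conj a) q0| * `|fps_eval G (c^-1 * qconj q0 * c)| = 1.
Proof.
move=> c0; set p : H := c^-1 * _ * _.
have p1 : `|p| < 1 by rewrite norm_conj_by.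
have cp : c * p = qconj q0 * c by rewrite /p !mulrA mulrV ?mul1r.
clearbody p.
have N0q : fps_eval N0 q0 = 0.
  by rewrite sphere_poly_eval // mulrDr opprD addrA subrr sub0r addNr.
have N0p : fps_eval N0 p = 0.
  have e1 : c * (p * p) = qconj q0 * qconj q0 * c by rewrite mulrA cp -mulrA cp mulrA.
  have e2 : c * (p * (q0 + qconj q0)) = qconj q0 * ((q0 + qconj q0) * c).
    by rewrite (mulrA c) cp -(mulrA (qconj q0)) trace_comm.
  have e3 : c * (q0 * qconj q0) = q0 * qconj q0 * c by rewrite mul_qconj qalg_comm.
  apply: (qmulI c0); rewrite mulr0 sphere_poly_eval // (mulrDr c) (mulrBr c) e1 e2 e3.
  exact: char_poly_root.
have cac : fps_conv (fps_conj a) by exact: fps_conv_conj.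
pose F := 1 - (qconj w)%:S * a; have cF : fps_conv F by apply: fps_convB => //; apply: fps_convM.
have pcb : p * qconj c = qconj c * qconj q0.
  apply: (qmulI c0).
  by rewrite (mulrA c p) cp (mulrA c (qconj c)) mul_qconj qalg_comm -mul_qconj mulrA.
have acp : fps_eval (fps_conj a) p = qconj w.
  have -> : fps_conj a = (1 : H)%:S *
      (X * (qconj c)%:S + (qconj w - qconj c * qconj q0)%:S + N0 * fps_conj R').
    by rewrite -sphere_affine_conj fps_const1 mul1r.
  rewrite (sphere_affine_eval _ _ _ (fps_conv_conj fps_conv_quot2) p1 N0p).
  by rewrite !mul1r pcb addrC subrK.
pose mu : R := 1 - `|w| ^+ 2.
have mu0 : mu != 0 by rewrite subr_eq0 eq_sym lt_eqF // expr_lt1.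
have FcE : fps_conj F = 1 - fps_conj a * w%:S.
  by rewrite fps_conjD fps_conjN fps_conjM fps_conj1 fps_conj_const qconjK.
have cFc : fps_conv (fps_conj F) by exact: fps_conv_conj.
have Fcp : fps_eval (fps_conj F) p = mu%:A.
  rewrite FcE fps_evalB ?fps_eval1 ?fps_evalMC // ?acp; last by apply: fps_convM.
  by rewrite mul_conjq scalerBl scale1r.
have rN : fps_conj (fps_conj F * F) = fps_conj F * F by rewrite fps_conjM fps_conjK.
have cN : fps_conv (fps_conj F * F) by apply: fps_convM.
have Np : fps_eval (fps_conj F * F) p = mu%:A * fps_eval F p.
  by rewrite fps_evalM_comm // Fcp ?qalg_comm.
have FGp : `|fps_eval F p| * `|fps_eval G p| = 1.
  have := fps_evalM_comm cN cG p1 (fps_real_eval_comm rN cN p1).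
  rewrite -mulrA (FG : F * G = 1) mulr1 Fcp Np => /(congr1 (fun q : H => `|q|)).
  rewrite !qnormM !qnormA -mulrA => E.
  have m0 : `|mu| != 0 by rewrite normr_eq0.
  by apply: (mulfI m0); rewrite mulr1 -E.
rewrite -FGp; congr (_ * _).
have Fp : fps_eval F p = 1 - (p * (qconj w * c) + qconj w * (w - q0 * c)).
  rewrite /F fps_evalB ?fps_eval1 //; last by apply: fps_convM.
  have := sphere_affine_eval (qconj w) c (w - q0 * c) fps_conv_quot2 p1 N0p.
  by rewrite -sphere_affine => ->.
have fs : fps_eval (a * fps_conj a) q0 =
    q0 * (w * qconj c) + w * (qconj w - qconj c * qconj q0).
  rewrite (fps_evalM ca cac q01) sphere_affine_conj.
  exact: (sphere_affine_eval _ _ _ (fps_conv_conj fps_conv_quot2) q01 N0q).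
have : c * fps_eval F p = qconj (1 - fps_eval (a * fps_conj a) q0) * c.
  rewrite Fp fs !(qconjB, qconjD, qconjM, qconjK) qconj1.
  rewrite (mulrBr c) (mulrDr c) mulr1 (mulrA c p) cp.
  exact: spherical_conj_identity.
move=> /(congr1 (fun q : H => `|q|)); rewrite !qnormM norm_qconj mulrC.
have n0 : `|c| != 0 by rewrite normr_eq0.
by move=> E; apply/esym; exact: (mulIf n0 E).
Qed.

End SphericalIdentity.

End SchwarzPickFactor.

(** * Regular Moebius transformations *)

Section MoebiusTransform.
Variable R : realType.
Local Notation H := (quat R).
Implicit Types (f g : fps H) (a u w p q : H).
Local Notation X := (fpsX H).
Local Notation "c %:S" := (fps_const c) (at level 2, format "c %:S").

(** A Moebius transformation with its denominator cleared. *)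
Definition fps_moebius_eq f a u :=
  (1 - X * (qconj a)%:S) * f = (X - a%:S) * u%:S.

Lemma norm1D_mulC p q : `|1 + p * q| = `|1 + q * p|.
Proof.
rewrite !qnormE; congr Num.sqrt.
by case: p q => [? ? ? ?] [? ? ? ?]; rewrite /qnorm2 /=; ring.
Qed.

Lemma qconjZ (k : R) p : qconj (k *: p) = k *: qconj p.
Proof. by case: p => ? ? ? ?; congr Quat; rewrite /= mulrN. Qed.

Lemma norm_unit_add a u w : `|u| = 1 -> `|u + qconj a * w| = `|1 + a * u * qconj w|.
Proof.
move=> u1; rewrite norm1D_mulC -[LHS]norm_qconj qconjD qconjM qconjK.
rewrite -[LHS]mulr1 -u1 -qnormM mulrDl mul_conjq u1 expr1n scale1r.
by rewrite mulrA.
Qed.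

(** In terms of the coefficients A, B, C, D of [moebius_transform]: A conj(B) = C conj(D). It ties
    the denominator of the new transformation to its numerator. *)
Lemma moebius_coef_identity a u w : `|u| = 1 ->
  (u + qconj a * w) * qconj (a * u + w) =
  (qconj a + u * qconj w) * qconj (1 + a * u * qconj w).
Proof.
move=> u1; have uu : u * qconj u = 1 by rewrite mul_qconj u1 expr1n scale1r.
rewrite !qconjD !qconjM qconj1 qconjK !mulrDl !mulrDr !mulr1 !mulrA.
rewrite uu mul1r -(mulrA u (qconj w) w) mul_conjq -(mulrA (qconj a) w (qconj w)) mul_qconj.
rewrite -(qalg_comm _ u) -(mulrA _ u (qconj u)) uu mulr1 qalg_comm.
move: (qconj a) (qconj a * (`|w| ^+ 2)%:A) (u * qconj w) (qconj a * w * qconj u * qconj a).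
by move=> ? ? ? ?; clear; quat_field.
Qed.

Lemma fps_const_XMC p q : p%:S * (X * q%:S) = X * (p * q)%:S.
Proof. by rewrite mulrA fpsX_comm -mulrA fps_constM. Qed.

(** Multiplying the second equation by 1 - X conj(a) and eliminating [f] leaves (D - X C) g = X A -
    B. Since |A| = |D| > |B| and A conj(B) = C conj(D), division by D gives the normal form. *)
Lemma moebius_transform f g a u w : `|a| < 1 -> `|u| = 1 -> `|w| < 1 ->
  fps_moebius_eq f a u -> (1 - f * (qconj w)%:S) * g = f - w%:S ->
  exists a' u', [/\ `|a'| < 1, `|u'| = 1 & fps_moebius_eq g a' u'].
Proof.
move=> a1 u1 w1 fE gE.
pose A := u + qconj a * w; pose B := a * u + w.
pose C := qconj a + u * qconj w; pose D := 1 + a * u * qconj w.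
have AD : `|A| = `|D| by exact: norm_unit_add.
have au1 : `|a * u| < 1 by rewrite qnormM u1 mulr1.
have D0 : D != 0.
  have := @norm_mulr_conj_lt1 _ (a * u) (- w) (ltW au1); rewrite normrN => /(_ w1).
  by rewrite qconjN mulrN opprK.
have A0 : A != 0 by rewrite -normr_eq0 AD normr_eq0.
have dg : (D%:S - X * C%:S) * g = X * A%:S - B%:S.
  have := congr1 (fun h => (1 - X * (qconj a)%:S) * h) gE; rewrite mulrA.
  rewrite mulrBr mulr1 mulrA fE mulrBr fE.
  have -> : 1 - X * (qconj a)%:S - (X - a%:S) * u%:S * (qconj w)%:S = D%:S - X * C%:S.
    rewrite /D /C !fps_constD !fps_constM mulrDr mulrBl mulrBl !mulrA fps_const1.
    move: (X * (qconj a)%:S) (X * u%:S * _) (a%:S * u%:S * _) => x y z.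
    by fps_additive.
  move=> ->; rewrite /A /B !fps_constD !fps_constM mulrDr !mulrBl mul1r !mulrA.
  move: (X * u%:S) (X * (qconj a)%:S * w%:S) (a%:S * u%:S) (w%:S) => x y z t.
  by fps_additive.
have nB : `|B| < `|D|.
  rewrite -(ltr_pXn2r (_ : 0 < 2)%N) ?nnegrE // -subr_gt0.
  have := norm1DM_sq (a * u) (- w); rewrite qconjN mulrN !opprK normrN => ->.
  by rewrite mulr_gt0 // subr_gt0 exprn_ilt1.
(* Read off from D^-1 (X A - B) = (X - a') u': u' = D^-1 A and a' u' = D^-1 B. *)
exists (D^-1 * B * A^-1 * D), (D^-1 * A); split.
- by rewrite !qnormM !qnormV AD mulrVK ?unitfE ?normr_eq0 // mulrC ltr_pdivrMr ?normr_gt0 // mul1r.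
- by rewrite qnormM qnormV AD mulVf // normr_eq0.
have aE : qconj (D^-1 * B * A^-1 * D) = D^-1 * C.
  have n0 : `|D| ^+ 2 != 0 by rewrite expf_neq0 // normr_eq0.
  have -> : qconj (D^-1 * B * A^-1 * D) =
      `|D| ^- 2 *: (`|D| ^- 2 *: (qconj D * (A * qconj B * D))).
    rewrite !qconjM (qVE A) (qVE D) AD !qconjZ !qconjK -!scalerAl -!scalerAr.
    by rewrite !mulrA.
  rewrite moebius_coef_identity // -/C -/D -mulrA mul_conjq -qalg_comm -scalerAl mul1r.
  by rewrite -scalerAr [X in _ *: X]scalerA mulVf // scale1r [in RHS]qVE -scalerAl.
rewrite /fps_moebius_eq aE.
have := congr1 (fun h => (D^-1)%:S * h) dg.
rewrite mulrA mulrBr fps_const_XMC -fps_constM mulVr // => ->.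
rewrite mulrBr fps_const_XMC -fps_constM mulrBl -fps_constM.
have -> // : D^-1 * B * A^-1 * D * (D^-1 * A) = D^-1 * B.
by rewrite -!mulrA mulVKr // mulVr // mulr1.
Qed.

End MoebiusTransform.

Section MoebiusCharacterization.
Variable R : realType.
Local Notation H := (quat R).
Implicit Types (a b k G : fps H) (f : H -> H) (u w p q : H).
Local Notation X := (fpsX H).
Local Notation "c %:S" := (fps_const c) (at level 2, format "c %:S").

Hint Resolve fps_convX fps_conv_const fps_conv1 fps_convD fps_convB fps_convM fps_convN : core.

Lemma fpsX_le q : `|q| < 1 -> `|fps_eval X q| <= 1.
Proof. by move=> q1; rewrite fps_evalX // ltW. Qed.

Lemma fps_eval_inverse s p q : fps_conv s -> `|p| < 1 -> p * q = q * p ->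
  (1 - q%:S * X) * s = 1 -> fps_eval s p = (1 - p * q)^-1.
Proof.
move=> cs p1 pq; rewrite fpsX_comm => Bs.
have cB : fps_conv (1 - X * q%:S) by apply: fps_convB => //; apply: fps_convM.
have v0 := fps_eval_unit_neq0 cB cs Bs p1; rewrite fps_eval_1BXM // in v0.
apply: (qmulI v0); rewrite [RHS]mulrV // -fps_eval_1BXM // -(fps_evalM_comm cB cs p1).
  by rewrite Bs fps_eval1.
by rewrite fps_eval_1BXM // mulrBr mulrBl mulr1 mul1r -mulrA -pq.
Qed.

Lemma regular_moebiusP f a : represented_by f a -> regular_moebius f <->
  exists p u, [/\ `|p| < 1, `|u| = 1 & fps_moebius_eq a p u].
Proof.
move=> fa; have key p u : `|p| < 1 -> exists M, [/\ M * (1 - X * (qconj p)%:S) = 1,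
    (1 - X * (qconj p)%:S) * M = 1
    & represented_by (reg_mul (reg_recip (fun q => 1 - q * qconj p)) (fun q => (q - p) * u))
        (M * ((X - p%:S) * u%:S))].
  move=> p1; have [M [cM BM MB]] := pick_inverse (@fps_convX R) p1 fpsX_le.
  exists M; split=> //; apply: represented_reg_mul.
    apply: (represented_reg_recip _ cM BM MB).
    apply: (represented_sub (represented_const 1)).
    by apply: represented_mulr; exact: represented_id.
  apply: represented_mulr; apply: represented_sub; first exact: represented_id.
  exact: represented_const.
split=> [[p [u [p1 u1 fE]]]|[p [u [p1 u1 aE]]]]; exists p, u; split=> //.
  have [M [MB BM fM]] := key p u p1.
  have -> : a = M * ((X - p%:S) * u%:S).
    by apply: represented_unique fa (represented_ext _ fM) => q q1; rewrite fE.
  by rewrite /fps_moebius_eq mulrA BM mul1r.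
move=> q q1; have [M [MB BM [_ fM]]] := key p u p1.
rewrite fM // -aE mulrA MB mul1r.
by case: fa => _ ->.
Qed.

(** Pick transforms preserve Moebius transformations. If [a] is one, so is g = (a - w) G, and it
    vanishes at [q0], which leaves a constant for [k]. Conversely a constant [k] makes g a Moebius
    transformation centred at [q0], and [a] is the Pick transform of g at -w. *)
Lemma schwarz_pick_factor_moebius a q0 G k : fps_conv a -> fps_conv G -> `|q0| < 1 ->
  let w := fps_eval a q0 in `|w| < 1 ->
  G * (1 - (qconj w)%:S * a) = 1 ->
  (1 - a * (qconj w)%:S) * ((a - w%:S) * G) = a - w%:S ->
  (1 - (qconj q0)%:S * X) * ((a - w%:S) * G) = (X - q0%:S) * k ->
  (exists p u, [/\ `|p| < 1, `|u| = 1 & fps_moebius_eq a p u]) <->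
  (exists2 u : H, `|u| = 1 & k = u%:S).
Proof.
move=> ca cG q01 w w1 GF gE kE; rewrite fpsX_comm in kE.
set g := (a - w%:S) * G in gE kE.
have caw : fps_conv (a - w%:S) by apply: fps_convB.
split=> [[p [u [p1 u1 aE]]]|[u u1 ku]].
  have [p' [u' [p'1 u'1 gM]]] := moebius_transform p1 u1 w1 aE gE.
  exists u' => //; have [M [cM BM MB]] := pick_inverse (@fps_convX R) p'1 fpsX_le.
  have MX : M * (X - p'%:S) = (X - p'%:S) * M.
    have BX : (X - p'%:S) * (1 - X * (qconj p')%:S) = (1 - X * (qconj p')%:S) * (X - p'%:S).
      by rewrite -fpsX_comm fps_XB_comm // mul_qconj mul_conjq.
    rewrite -[LHS]mulr1 -BM mulrA -[M * _ * _]mulrA BX.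
    by rewrite mulrA MB mul1r.
  have g0 : fps_eval g q0 = 0.
    apply: fps_evalM0 => //; rewrite fps_evalB // fps_eval_const.
    by rewrite subrr.
  have gMX : g = (X - p'%:S) * (M * u'%:S).
    by rewrite mulrA -MX -mulrA -gM mulrA MB mul1r.
  (* The other factor of g is invertible, so [p'] is its only zero. *)
  have qp : q0 = p'.
    apply/eqP; rewrite -subr_eq0; apply: contraTT isT => qp.
    have cX : fps_conv (X - p'%:S) by apply: fps_convB.
    have cMu : fps_conv (M * u'%:S) by apply: fps_convM.
    have x0 : fps_eval (X - p'%:S) q0 != 0 by rewrite fps_eval_XB.
    have cB : fps_conv (1 - X * (qconj p')%:S) by apply: fps_convB => //; apply: fps_convM.
    move: g0; rewrite gMX (fps_evalMn0 cX cMu q01 x0).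
    have s1 : `|(fps_eval (X - p'%:S) q0)^-1 * q0 * fps_eval (X - p'%:S) q0| < 1.
      by rewrite norm_conj_by.
    rewrite fps_evalMC // => /eqP.
    rewrite !qmul_eq0 (negPf x0) (negPf (fps_eval_unit_neq0 cM cB MB s1)) /=.
    by rewrite -normr_eq0 u'1 oner_eq0.
  by apply: (@fps_XBM_inj _ q0); rewrite -kE qp -gM.
have gM : fps_moebius_eq g q0 u by rewrite /fps_moebius_eq kE ku.
have Nw1 : `|- w| < 1 by rewrite normrN.
apply: (moebius_transform q01 u1 Nw1 gM).
have : g * (1 - (qconj w)%:S * a) = a - w%:S by rewrite /g -mulrA GF mulr1.
rewrite mulrBr mulr1 mulrA => h.
rewrite qconjN !fps_constN mulrN !opprK mulrDl mul1r.
have -> : g * (qconj w)%:S * a = g - (a - w%:S) by rewrite -h opprB addrC subrK.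
by fps_additive.
Qed.

End MoebiusCharacterization.


Theorem theorem1p7 (R : realType) (f : quat R -> quat R) (q0 : quat R)
    (f_regular : slice_regular (@unit_ball R) f)
    (f_ball : forall q, unit_ball q -> unit_ball (f q))
    (q0_ball : unit_ball q0) :
  let rf := reg_recip (fun q => 1 - (cst (qconj (f q0)) ** f) q) in
  let r0 := reg_recip (fun q => 1 - (cst (qconj q0) ** id) q) in
  let lhs_a q := `|((fun p => f p - f q0) ** rf) q| in
  let rhs_a q := `|((fun p => p - q0) ** r0) q| in
  let lhs_b q := `|(diff_quotient f q0 ** rf) q| in
  let rhs_b q := `|r0 q| in
  let lhs_c := `|(cullen_derivative f ** rf) q0| in
  let rhs_c := 1 / (1 - `|q0| ^+ 2) in
  let lhs_d := `|spherical_derivative f q0| / `|1 - reg_symm f q0| in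
  let rhs_d := 1 / `|1 - qconj q0 ^+ 2| in
  [/\ forall q, unit_ball q -> lhs_a q <= rhs_a q,
      forall q, unit_ball q -> lhs_b q <= rhs_b q,
      lhs_c <= rhs_c
    & lhs_d <= rhs_d] /\
  (regular_moebius f ->
    [/\ forall q, unit_ball q -> lhs_a q = rhs_a q,
        forall q, unit_ball q -> lhs_b q = rhs_b q,
        lhs_c = rhs_c
      & lhs_d = rhs_d]) /\
  (~ regular_moebius f ->
    [/\ forall q, unit_ball q -> q <> q0 -> lhs_a q < rhs_a q,
        lhs_a q0 = 0 /\ rhs_a q0 = 0,
        forall q, unit_ball q -> lhs_b q < rhs_b q,
        lhs_c < rhs_c
      & lhs_d < rhs_d]).
Proof.
move=> rf r0 lhs_a rhs_a lhs_b rhs_b lhs_c rhs_c lhs_d rhs_d.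
have [a fa] := regular_represented f_regular; have [ca fE] := fa.
have alt q : `|q| < 1 -> `|fps_eval a q| < 1.
  by move=> q1; rewrite -fE //; exact: f_ball.
have q01 : `|q0| < 1 by exact: q0_ball.
have q0b1 : `|qconj q0| < 1 by rewrite norm_qconj.
have [G [s [k [[cG cs ck] [[FG GF Bs sB] [RG gE kE kle]]]]]] := schwarz_pick_factor ca q01 alt.
set w := fps_eval a q0 in FG GF gE kE.
have w1 : `|w| < 1 by exact: alt.
have fw : f q0 = w by exact: fE.
pose X := fpsX (quat R).
have cX : fps_conv X by exact: fps_convX.
have cC u : fps_conv (fps_const u : fps (quat R)) by exact: fps_conv_const.
have cR := fps_conv_quot q01 ca.
have cRG : fps_conv (fps_quot q0 a * G) by exact: fps_convM.
have cB : fps_conv (1 - fps_const (qconj q0) * X).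
  by apply: fps_convB; [exact: fps_conv1|exact: fps_convM].
have rfG : represented_by rf G.
  apply: (represented_reg_recip _ cG FG GF).
  apply: (represented_sub (represented_const 1)).
  by rewrite -fw; apply: represented_reg_mul => //; exact: represented_const.
have r0s : represented_by r0 s.
  apply: (represented_reg_recip _ cs Bs sB).
  apply: (represented_sub (represented_const 1)).
  by apply: represented_reg_mul; [exact: represented_const|exact: represented_id].
have rq : represented_by (fun p => p - q0) (X - fps_const q0).
  by apply: represented_sub; [exact: represented_id|exact: represented_const].
have cXs : fps_conv ((X - fps_const q0) * s) by apply: fps_convM => //; exact: fps_convB.
have rR p : `|p| < 1 -> diff_quotient f q0 p = fps_eval (fps_quot q0 a) p.
  by move=> p1; have [_ ->] := represented_diff_quotient fa q01.
have E_b q : `|q| < 1 -> exists2 p, `|p| < 1 &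
    `|fps_eval (fps_quot q0 a * G) q| = `|fps_eval s q| * `|fps_eval k p|.
  by move=> q1; rewrite RG; exact: norm_fps_eval_unitM cs cB ck sB q1.
have s0 q : `|q| < 1 -> 0 < `|fps_eval s q|.
  by move=> q1; rewrite normr_gt0; exact: fps_eval_unit_neq0 cs cB sB q1.
have E_a q : `|q| < 1 -> q <> q0 -> 0 < rhs_a q /\ exists2 p, `|p| < 1 &
    lhs_a q = rhs_a q * `|fps_eval k p|.
  move=> q1 /eqP qq0; rewrite /lhs_a /rhs_a.
  have rl : represented_by (fun p => f p - f q0) (a - fps_const w).
    by apply: represented_sub => //; rewrite fw; exact: represented_const.
  have [_ e1] := represented_reg_mul rl rfG; have [_ e2] := represented_reg_mul rq r0s.
  rewrite (e1 _ q1) (e2 _ q1).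
  have x0 : fps_eval (X - fps_const q0) q != 0 by rewrite fps_eval_XB // subr_eq0.
  have xs0 : fps_eval ((X - fps_const q0) * s) q != 0.
    rewrite (fps_evalMn0 (fps_convB cX (cC _)) cs q1 x0) qmul_eq0 negb_or x0 /=.
    by rewrite -normr_gt0 s0 // norm_conj_by.
  split; first by rewrite normr_gt0.
  have e : (a - fps_const w) * G = (X - fps_const q0) * s * k.
    by rewrite -mulrA -RG mulrA fps_quotE.
  rewrite e (fps_evalMn0 cXs ck q1 xs0) qnormM.
  by eexists; last reflexivity; rewrite norm_conj_by.
(* A product at [q0] depends on its first factor only through the value at [q0], where the
   derivative and the difference quotient agree. *)
have E_c : lhs_c = `|fps_eval (fps_quot q0 a * G) q0|.
  have [_ e] := represented_reg_mul (represented_cullen fa) rfG; rewrite /lhs_c (e _ q01).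
  rewrite (fps_evalM (fps_conv_deriv ca) cG q01) (fps_deriv_eval ca q01).
  by rewrite -(fps_evalM cR cG q01).
have E_rc : rhs_c = `|fps_eval s q0|.
  have e0 : 0 < 1 - `|q0| ^+ 2 by rewrite subr_gt0 exprn_ilt1.
  rewrite (fps_eval_inverse cs q01 _ Bs); last by rewrite mul_qconj mul_conjq.
  have -> : 1 - q0 * qconj q0 = (1 - `|q0| ^+ 2)%:A by rewrite mul_qconj scalerBl scale1r.
  rewrite qnormV qnormA gtr0_norm //.
  by rewrite /rhs_c div1r.
have E_rd : rhs_d = `|fps_eval s (qconj q0)|.
  by rewrite (fps_eval_inverse cs q0b1 _ Bs) // qnormV /rhs_d div1r expr2.
have E_d : lhs_d = `|fps_eval (fps_quot q0 a * G) (qconj q0)|.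
  rewrite /lhs_d /spherical_derivative (rR _ q0b1).
  have [_ e] := represented_reg_symm fa; rewrite (e _ q01) {e}.
  (* When the spherical derivative vanishes both sides are 0; the conjugated point of
     [spherical_identity] exists only otherwise. *)
  have [c0|c0] := eqVneq (fps_eval (fps_quot q0 a) (qconj q0)) 0.
    by rewrite (fps_evalM0 cR cG q0b1 c0) c0 normr0 mul0r.
  rewrite (fps_evalMn0 cR cG q0b1 c0) qnormM; congr (_ * _).
  have := spherical_identity ca cG q01 w1 FG c0.
  move: (fps_eval G _) (1 - _) => x y e.
  have y0 : `|y| != 0 by apply: contraTneq isT => y0; move: e; rewrite y0 mul0r => /eqP; rewrite eq_sym oner_eq0.
  by apply: (mulfI y0); rewrite mulfV.
have moeb : regular_moebius f <-> (exists2 u : quat R, `|u| = 1 & k = fps_const u).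
  rewrite (regular_moebiusP fa).
  exact: (schwarz_pick_factor_moebius ca cG q01 w1 GF gE kE).
(* All four inequalities have this form, with [p] depending on the inequality and on the point;
   positivity of [rhs] is what makes the strict case strict. *)
have item lhs rhs : 0 < rhs -> (exists2 p, `|p| < 1 & lhs = rhs * `|fps_eval k p|) ->
    [/\ lhs <= rhs, regular_moebius f -> lhs = rhs & ~ regular_moebius f -> lhs < rhs].
  move=> rhs0 [p p1 ->]; split.
  - by rewrite ler_piMr ?(ltW rhs0) // kle.
  - by move=> /moeb [u u1 ->]; rewrite fps_eval_const u1 mulr1.
  - move=> nm; rewrite gtr_pMr //.
    by have [/moeb|->] := max_modulus_strict ck kle.
have I_b q : unit_ball q -> [/\ lhs_b q <= rhs_b q, regular_moebius f -> lhs_b q = rhs_b q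
    & ~ regular_moebius f -> lhs_b q < rhs_b q].
  move=> q1; have [_ h1] := r0s.
  have [_ h2] := represented_reg_mul (represented_diff_quotient fa q01) rfG.
  by apply: item; rewrite /rhs_b (h1 _ q1) ?s0 // /lhs_b (h2 _ q1); exact: E_b.
have I_a q : unit_ball q -> q <> q0 -> [/\ lhs_a q <= rhs_a q,
    regular_moebius f -> lhs_a q = rhs_a q & ~ regular_moebius f -> lhs_a q < rhs_a q].
  by move=> q1 qq; have [] := E_a q q1 qq; exact: item.
have a0 : lhs_a q0 = 0 /\ rhs_a q0 = 0.
  rewrite /lhs_a /rhs_a.
  have rl : represented_by (fun p => f p - f q0) (a - fps_const w).
    by apply: represented_sub => //; rewrite fw; exact: represented_const.
  have [_ h1] := represented_reg_mul rl rfG; have [_ h2] := represented_reg_mul rq r0s.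
  rewrite (h1 _ q01) (h2 _ q01).
  have e1 : fps_eval (a - fps_const w) q0 = 0.
    by rewrite fps_evalB // fps_eval_const subrr.
  have e2 : fps_eval (X - fps_const q0) q0 = 0 by rewrite fps_eval_XB // subrr.
  rewrite (fps_evalM0 (fps_convB ca (cC _)) cG q01 e1).
  by rewrite (fps_evalM0 (fps_convB cX (cC _)) cs q01 e2) normr0.
have [c1 c2 c3] : [/\ lhs_c <= rhs_c, regular_moebius f -> lhs_c = rhs_c
    & ~ regular_moebius f -> lhs_c < rhs_c].
  by apply: item; rewrite E_rc ?s0 // E_c; exact: E_b.
have [d1 d2 d3] : [/\ lhs_d <= rhs_d, regular_moebius f -> lhs_d = rhs_d
    & ~ regular_moebius f -> lhs_d < rhs_d].
  by apply: item; rewrite E_rd ?s0 // E_d; exact: E_b.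
split; last split=> hm; split.
- move=> q q1; have [->|/eqP qq] := eqVneq q q0; last by have [] := I_a q q1 qq.
  by have [-> ->] := a0.
- by move=> q /I_b [].
- exact: c1.
- exact: d1.
- move=> q q1; have [->|/eqP qq] := eqVneq q q0.
    by have [-> ->] := a0.
  by have [_ h _] := I_a q q1 qq; exact: h.
- by move=> q /I_b [_ h _]; exact: h.
- exact: c2.
- exact: d2.
- by move=> q q1 qq; have [_ _ h] := I_a q q1 qq; exact: h.
- exact: a0.
- by move=> q /I_b [_ _ h]; exact: h.
- exact: c3.
- exact: d3.
Qed.
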